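(* Let $u$ be a dissipative weak solution of the Camassa-Holm equation, with measure of accretion $\mu^+$. Then $\mu^+(t,dx) = 0$ for every $t \ge 0$.
   Context: Weak solution: for $u_0\in H^1(\mathbb{R})$, a function $u:[0,\infty)\times\mathbb{R}\to\mathbb{R}$ is a weak solution of the Camassa-Holm equation (with initial datum $u_0$) if $u\in C([0,\infty)\times\mathbb{R})\cap L^\infty([0,\infty),H^1(\mathbb{R}))$, $u(0,x)=u_0(x)$ for $x\in\mathbb{R}$, and $\partial_t u+\partial_x(u^2/2)+P_x=0$ in the sense of distributions, where $P(t,x)=\frac12 e^{-|x|}*\left(u^2(t,\cdot)+\frac{u_x^2(t,\cdot)}{2}\right)$ (convolution in $x$). Notation: $u_x^{\pm}=\max(\pm u_x,0)$. Dissipative: a weak solution is called dissipative if there is a constant such that $\partial_x u(t,x)\le \mathrm{const}\,(1+\frac1t)$ (Oleinik-type condition), and $\|u(t,\cdot)\|_{H^1(\mathbb{R})}\le\|u(0,\cdot)\|_{H^1(\mathbb{R})}$ for every $t>0$ (weak energy condition). Measure of accretion: for $t_0\in[0,\infty)$, $\mu^+(t_0,dx)$ is the measure on $\mathbb{R}$ defined by $$\int_{\mathbb{R}}\phi(x)\,\mu^+(t_0,dx)=\lim_{t\to t_0^+}\int_{\mathbb{R}}\phi(x)(u_x^+)^2(t,x)\,dx-\int_{\mathbb{R}}\phi(x)(u_x^+)^2(t_0,x)\,dx$$ for every continuous compactly supported $\phi$. It is known that these limits exist and define a bounded linear functional on $C_c(\mathbb{R})$, and that $\mu^+(t_0,dx)$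 is a nonnegative measure. *)

(* Defs.v *)
From HB Require Import structures.
From mathcomp Require Import all_boot all_order all_algebra.
From mathcomp Require Import all_classical all_reals all_analysis.
Set Implicit Arguments.
Unset Strict Implicit.
Unset Printing Implicit Defensive.
Import Order.TTheory GRing.Theory Num.Theory.
Import numFieldNormedType.Exports.
Local Open Scope classical_set_scope.
Local Open Scope ring_scope.

Section TestFunctions.
Context {R : realType} {V : normedModType R}.

Definition tsupport (f : V -> R) : set V := closure [set x | f x != 0].

(* In finite dimension this is the usual C^oo: every iterated directional
   derivative of f exists and is (totally) differentiable, hence continuous. *)
Definition smooth (f : V -> R) : Prop :=
  forall (vs : seq V) (x : V),
    differentiable (foldr (fun v (g : V -> R) => 'D_v g) f vs) x.

Definition test_function (f : V -> R) : Prop :=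
  smooth f /\ compact (tsupport f).

End TestFunctions.

Section Sobolev.
Context {R : realType}.
Local Notation leb := (@lebesgue_measure R).

Definition is_weak_deriv (f g : R -> R) : Prop :=
  [/\ locally_integrable setT f, locally_integrable setT g &
    forall phi : R -> R, test_function phi ->
      \int[leb]_x (f x * derive1 phi x) = - \int[leb]_x (g x * phi x)].

(* A representative of the weak derivative (unique up to a null set), and the
   zero function when f has none. *)
Definition wderiv (f : R -> R) : R -> R :=
  xget (cst 0) [set g | is_weak_deriv f g].

Definition in_H1 (f : R -> R) : Prop :=
  f \in Lfun leb 2%:E /\
  exists2 g : R -> R, g \in Lfun leb 2%:E & is_weak_deriv f g.

(* Meaningful only when in_H1 f: Rintegral sends infinite values to 0. *)
Definition H1norm (f : R -> R) : R :=
  Num.sqrt (\int[leb]_x (f x ^+ 2) + \int[leb]_x (wderiv f x ^+ 2)).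

End Sobolev.

(* Functions u of (t, x) are total on R * R; only the values at t >= 0 matter. *)
Section CamassaHolm.
Context {R : realType}.
Local Notation leb := (@lebesgue_measure R).
Implicit Types u : R -> R -> R.

Definition CH_P u (t x : R) : R :=
  2^-1 * \int[leb]_y (expR (- `|x - y|) *
                      (u t y ^+ 2 + wderiv (u t) y ^+ 2 / 2)).

(* The equation tested against phi in C_c^oo((0, oo) * R); (1, 0) is the
   direction of time and (0, 1) the direction of space. *)
Definition CH_distributional u : Prop :=
  forall phi : R * R -> R, test_function phi ->
    tsupport phi `<=` [set p | 0 < p.1] ->
    (\int[leb \x leb]_(p in [set p : R * R | (0 < p.1)%R])
       (u p.1 p.2 * 'D_(1, 0) phi p
        + u p.1 p.2 ^+ 2 / 2 * 'D_(0, 1) phi p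
        + CH_P u p.1 p.2 * 'D_(0, 1) phi p)%:E = 0)%E.

(* The strong measurability of t |-> u t implicit in L^oo([0, oo), H^1) follows
   from the continuity of u, H^1(R) being separable (Pettis). *)
Definition weak_solution (u0 : R -> R) u : Prop :=
  [/\ in_H1 u0,
      {within [set p : R * R | 0 <= p.1],
        continuous (fun p : R * R => u p.1 p.2)},
      exists M : R, {ae leb, forall t : R, 0 <= t ->
        in_H1 (u t) /\ H1norm (u t) <= M},
      forall x, u 0 x = u0 x &
      CH_distributional u].

Definition oleinik u : Prop :=
  exists C : R, forall t : R, 0 < t ->
    {ae leb, forall x : R, wderiv (u t) x <= C * (1 + t^-1)}.

Definition weak_energy u : Prop :=
  forall t : R, 0 < t -> in_H1 (u t) /\ H1norm (u t) <= H1norm (u 0).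

Definition dissipative u : Prop := oleinik u /\ weak_energy u.

Definition pos_energy u (phi : R -> R) (t : R) : R :=
  \int[leb]_x (phi x * (wderiv (u t))^\+ x ^+ 2).

(* The integral against mu is compared in \bar R, so that mu is finite on
   compact sets. *)
Definition accretion_measure u
    (mu : R -> {measure set (measurableTypeR R) -> \bar R}) : Prop :=
  forall t0 : R, 0 <= t0 ->
  forall phi : R -> R, continuous phi -> compact (tsupport phi) ->
    exists2 l : R, pos_energy u phi t @[t --> t0^'+] --> l &
      (\int[mu t0]_x (phi x)%:E = (l - pos_energy u phi t0)%:E)%E.

End CamassaHolm.

(* Main.v *)
Require Import Defs.
From mathcomp Require Import all_boot all_order all_algebra.
From mathcomp Require Import all_classical all_reals all_analysis.
From mathcomp Require Import measurable_realfun.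
From mathcomp Require Import ring lra.
From HB Require Import structures.
Import Order.TTheory GRing.Theory Num.Theory.
Import numFieldNormedType.Exports.
Local Open Scope classical_set_scope.
Local Open Scope ring_scope.

(** Let v = u_x. Formally, the equation gives

      d/dt (v^+)^2 + d/dx (u (v^+)^2) = 2 v^+ (u^2 - P),

    with a right-hand side that is under control as soon as v^+ is bounded.
    The Oleinik condition bounds v^+ after any positive time, so there the
    positive energy, tested against a cutoff phi, should grow at most linearly
    in time, which leaves no room for an upward jump. At time 0, where the
    Oleinik bound blows up, the energy inequality replaces it.

    Positive times. The computation is made at scale h, on the slope w of the
    average of u over ]x, x + h] (dslope). The conservation law on rectangles
    (conservation) expresses the increment of w in time through the second
    differences of the flux u^2/2 + P. Convexity of s |-> (s^+)^2 gives

      (w2^+)^2 - (w1^+)^2 <= 2 w2^+ (w2 - w1),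

    so only an upper bound of the weighted second differences is required.
    For the potential P it comes from the corner of the kernel exp(-|x|),
    which is convex elsewhere (potential_weighted). For u^2/2 the second
    difference is a transport term, integrated by parts against phi, plus a
    square that has the favourable sign up to K times the energy
    (transport_source). Both bounds are uniform in h; letting h tend to 0
    gives pos_energy_growth and then positive_accretion_le.

    Initial time. The quantity u^2 + v^2 - phi (v^+)^2 is convex in v, hence
    its integral is lower semicontinuous as t decreases to 0. Since the
    integral of u^2 + v^2 does not exceed its initial value, the integral of
    phi (v^+)^2 is upper semicontinuous at 0 (initial_accretion_le). Lower
    semicontinuity is proved on difference quotients: Jensen inequality
    (slice_avg), then Fatou in t at fixed h, then Fatou in h.

    In both cases the integral of every cutoff against the measure of
    accretion is at most 0, so this nonnegative measure vanishes. *)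

Set Implicit Arguments.
Unset Strict Implicit.
Unset Printing Implicit Defensive.

(** * Smooth transition functions *)

Section SmoothFunctions.
Context {R : realType}.
Implicit Types (f g : R -> R) (n : nat).

(** Recursion through the derivative makes products, inverses and affine
    changes of variable short inductions, without a Leibniz formula. *)
Fixpoint ndiff n f : Prop :=
  if n is n'.+1 then (forall x, derivable f x 1) /\ ndiff n' (derive1 f) else True.

Definition smooth1 f := forall n, ndiff n f.

Lemma ndiff_le n m f : (m <= n)%N -> ndiff n f -> ndiff m f.
Proof.
elim: n m f => [|n IH] [|m] f //= mn [df Df]; split=> //; exact: IH.
Qed.

Lemma smooth1_derivable f x : smooth1 f -> derivable f x 1.
Proof. by move=> /(_ 1%N)[]. Qed.

Lemma smooth1_derive f : smooth1 f -> smooth1 (derive1 f).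
Proof. by move=> sf n; have [] := sf n.+1. Qed.

Lemma smooth1_continuous f : smooth1 f -> continuous f.
Proof.
move=> sf x; apply: differentiable_continuous.
exact/derivable1_diffP/smooth1_derivable.
Qed.

Lemma ndiffD n f g : ndiff n f -> ndiff n g -> ndiff n (fun x => f x + g x).
Proof.
elim: n f g => [|n IH] f g //= [df Df] [dg Dg]; split.
  by move=> x; exact: derivableD.
have -> : derive1 (fun x => f x + g x) = (fun x => (derive1 f) x + (derive1 g) x).
  by apply/funext => x; rewrite !derive1E deriveD.
exact: IH.
Qed.

Lemma ndiffM n f g : ndiff n f -> ndiff n g -> ndiff n (fun x => f x * g x).
Proof.
elim: n f g => [|n IH] f g // Hf Hg.
have Hf' := ndiff_le (leqnSn n) Hf; have Hg' := ndiff_le (leqnSn n) Hg.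
case: Hf Hg => [df Df] [dg Dg] /=; split.
  by move=> x; exact: derivableM.
have -> : derive1 (fun x => f x * g x) = (fun x => f x * (derive1 g) x + g x * (derive1 f) x).
  by apply/funext => x; rewrite !derive1E deriveM.
by apply: ndiffD; exact: IH.
Qed.

Lemma ndiff_cst n (c : R) : ndiff n (fun=> c).
Proof.
elim: n c => [|n IH] c //=; split; first by move=> x; exact: derivable_cst.
have -> : derive1 (fun=> c) = (fun=> 0) :> (R -> R).
  by apply/funext => x; rewrite derive1_cst.
exact: IH.
Qed.

Lemma ndiffV n f : (forall x, f x != 0) -> ndiff n f ->
  ndiff n (fun x => (f x)^-1).
Proof.
move=> f0; elim: n => [//|n IH] Hf.
have Hf' := ndiff_le (leqnSn n) Hf.
case: Hf => [df Df] /=; split.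
  by move=> x; exact: derivableV.
have -> : derive1 (fun x => (f x)^-1) =
    (fun x => (- 1 * (derive1 f) x) * ((f x)^-1 * (f x)^-1)).
  apply/funext => x; rewrite !derive1E deriveV//.
  by rewrite -exprVn expr2 scaleNr -scalerN mulN1r /GRing.scale /= mulrC.
by apply: ndiffM; apply: ndiffM; [exact: ndiff_cst| |exact: IH|exact: IH].
Qed.

Lemma derive1_affine f (a b : R) x : (forall x, derivable f x 1) ->
  is_derive x (1:R) (fun x => f (a * x + b)) (a * (derive1 f) (a * x + b)).
Proof.
move=> df.
have H : is_derive x (1:R) (fun y => a * y + b) a.
  by apply: is_derive_eq; rewrite /GRing.scale /=; ring.
have H2 : is_derive (a * x + b) (1:R) f ((derive1 f) (a * x + b)).
  by rewrite derive1E; exact/derivableP.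
have := @is_derive1_comp R f (fun y => a * y + b) x _ _ H2 H.
by rewrite /comp mulrC.
Qed.

Lemma ndiff_affine n f (a b : R) : ndiff n f ->
  ndiff n (fun x => f (a * x + b)).
Proof.
elim: n f => [|n IH] f //= [df Df]; split.
  by move=> x; have [] := derive1_affine a b x df.
have -> : derive1 (fun x => f (a * x + b)) = (fun x => a * (derive1 f) (a * x + b)).
  by apply/funext => x; rewrite derive1E; have [_ ->] := derive1_affine a b x df.
by apply: ndiffM; [exact: ndiff_cst|exact: IH].
Qed.

Lemma smooth1D f g : smooth1 f -> smooth1 g -> smooth1 (fun x => f x + g x).
Proof. by move=> sf sg n; exact: ndiffD. Qed.
Lemma smooth1M f g : smooth1 f -> smooth1 g -> smooth1 (fun x => f x * g x).
Proof. by move=> sf sg n; exact: ndiffM. Qed.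
Lemma smooth1_cst (c : R) : smooth1 (fun=> c).
Proof. by move=> n; exact: ndiff_cst. Qed.
Lemma smooth1V f : (forall x, f x != 0) -> smooth1 f ->
  smooth1 (fun x => (f x)^-1).
Proof. by move=> f0 sf n; exact: ndiffV. Qed.
Lemma smooth1_affine f (a b : R) : smooth1 f -> smooth1 (fun x => f (a * x + b)).
Proof. by move=> sf n; exact: ndiff_affine. Qed.

(** The functions p(1/x) exp(-1/x) extended by 0 to x <= 0. The class is
    closed under differentiation, which is why the flat function of index p =
    1 is smooth at 0. *)
Definition flat (p : {poly R}) (x : R) : R :=
  if 0 < x then p.[x^-1] * expR (- x^-1) else 0.

Lemma poly_growth (p : {poly R}) : exists2 C, 0 <= C &
  forall y, 1 <= y -> `|p.[y]| <= C * y ^+ size p.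
Proof.
exists (\sum_(i < size p) `|p`_i|); first exact: sumr_ge0.
move=> y y1; rewrite horner_coef mulr_suml.
apply: le_trans (ler_norm_sum _ _ _) _.
apply: ler_sum => i _; rewrite normrM ler_wpM2l//.
have y0 : 0 <= y by exact: le_trans y1.
by rewrite ger0_norm ?exprn_ge0// ler_weXn2l// ltnW.
Qed.

(** The exponential series beats every power of 1/x. Applied to X * p, this
    decay makes the difference quotient of flat p at 0 vanish. *)
Lemma flat_bound (p : {poly R}) : exists2 C, 0 <= C &
  forall x, `|x| <= 1 -> `|flat p x| <= C * `|x|.
Proof.
have [C C0 Cp] := poly_growth p.
exists (C * (size p).+1`!%:R); first by rewrite mulr_ge0.
move=> x x1; rewrite /flat; case: ifPn => [x0|_]; last first.
  by rewrite normr0 !mulr_ge0.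
have xV : 1 <= x^-1.
  by rewrite -invr1 lef_pV2 ?posrE//; rewrite gtr0_norm in x1.
set y := x^-1 in xV *; have y0 : 0 < y by rewrite invr_gt0.
rewrite normrM (ger0_norm (expR_ge0 _)).
apply: (@le_trans _ _ (C * y ^+ size p * expR (- y))).
  by rewrite ler_wpM2r ?expR_ge0// Cp.
have E := @expR_ge1Dxn R y (size p) (ltW y0).
have E2 : y ^+ (size p).+1 / (size p).+1`!%:R <= expR y by apply: le_trans E; lra.
have f0 : 0 < (size p).+1`!%:R :> R by rewrite ltr0n fact_gt0.
rewrite expRN ler_pdivrMr ?expR_gt0// (gtr0_norm x0).
rewrite -(invrK x) -/y -!mulrA ler_wpM2l//.
apply: (@le_trans _ _ ((size p).+1`!%:R * (y^-1 * (y ^+ (size p).+1 / (size p).+1`!%:R)))).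
  rewrite exprS -mulrA mulKf ?gt_eqF// mulrCA divff ?gt_eqF// mulr1//.
by rewrite ler_wpM2l// ler_wpM2l// invr_ge0 ltW.
Qed.

(** For x > 0 the chain rule at 1/x produces X^2 * (p - p'), and at 0 the
    difference quotient of flat p is flat (X * p), which tends to 0. *)
Lemma flat_is_derive (p : {poly R}) x :
  is_derive x (1:R) (flat p) (flat ('X^2 * (p - p^`())) x).
Proof.
have [x0|x0|->] := ltgtP x 0.
- apply: (@near_eq_is_derive _ _ _ (cst 0)).
    near=> y; rewrite /flat ltNge ltW//=; near: y; exact: lt_nbhsl.
  by rewrite /flat ltNge ltW//=; exact: is_derive_cst.
- apply: (@near_eq_is_derive _ _ _ (fun y : R => p.[y^-1] * expR (- y^-1) : R)).
    near=> y; rewrite /flat ifT//; near: y; exact: lt_nbhsr.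
  have xn0 : x != 0 by rewrite gt_eqF.
  have dV : is_derive x (1:R) (fun y : R => y^-1) (- x ^- 2).
    apply: DeriveDef; first by apply: (@derivableV R _ id).
    by rewrite (@deriveV R _ id)// derive_id /GRing.scale /= mulr1.
  have dp : is_derive x (1:R) (fun y : R => p.[y^-1]) (p^`().[x^-1] * - x ^- 2).
    exact: (@is_derive1_comp R (horner p) (fun y => y^-1)).
  have de : is_derive x (1:R) (fun y : R => expR (- y^-1)) (expR (- x^-1) * (x ^- 2)).
    have dN : is_derive x (1:R) (fun y : R => - y^-1) (x ^- 2).
      by apply: is_derive_eq; rewrite opprK.
    exact: (@is_derive1_comp R expR (fun y => - y^-1)).
  apply: is_derive_eq; rewrite /flat x0 !hornerE /GRing.scale /= -exprVn; ring.
- rewrite {2}/flat ltxx.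
  have [C C0 HC] := flat_bound ('X * p).
  have lim0 : (fun h : R => h^-1 *: ((flat p \o shift 0) (h *: 1) - flat p 0)) h @[h --> 0^'] --> (0 : R).
    apply/cvgrPdist_le => e e0.
    have d0 : 0 < Num.min 1 (e / (C + 1)).
      by rewrite lt_min ltr01 divr_gt0// ltr_wpDl.
    near=> h.
    have h0 : h != 0 by near: h; exact: nbhs_dnbhs_neq.
    have hd : `|h| <= Num.min 1 (e / (C + 1)).
      by near: h; exact: dnbhs0_le.
    rewrite /= sub0r normrN addr0 /GRing.scale /= mulr1 {2}/flat ltxx subr0.
    have -> : h^-1 * flat p h = flat ('X * p) h.
      rewrite /flat; case: ifPn => [hp|_]; last by rewrite mulr0.
      by rewrite hornerM hornerX -mulrA.
    move: hd; rewrite le_min => /andP[h1 h2].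
    apply: le_trans (HC _ h1) _.
    apply: (@le_trans _ _ (C * (e / (C + 1)))); first by rewrite ler_wpM2l.
    rewrite mulrA ler_pdivrMr ?ltr_wpDl//; nra.
  by apply: DeriveDef; [apply/cvg_ex; exists 0|apply/cvg_lim].
Unshelve. all: by end_near. Qed.

Lemma flat_smooth p : smooth1 (flat p).
Proof.
move=> n; elim: n p => [//|n IH] p /=; split.
  by move=> x; have [] := flat_is_derive p x.
have -> : derive1 (flat p) = flat ('X^2 * (p - p^`())); last exact: IH.
by apply/funext => x; rewrite derive1E; have [_ ->] := flat_is_derive p x.
Qed.

(** A smooth transition from 0 on x <= 0 to 1 on x >= 1: at every x one of x
    and 1 - x is positive, so the denominator does not vanish. *)
Definition sstep (x : R) : R := flat 1 x / (flat 1 x + flat 1 (- 1 * x + 1)).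

Lemma flat1_ge0 x : 0 <= flat 1 x.
Proof. by rewrite /flat; case: ifP => // _; rewrite hornerE ?mul1r expR_ge0. Qed.
Lemma flat1_gt0 x : 0 < x -> 0 < flat 1 x.
Proof. by rewrite /flat => ->; rewrite hornerE ?mul1r expR_gt0. Qed.
Lemma flat1_le0 x : x <= 0 -> flat 1 x = 0.
Proof. by rewrite /flat leNgt => /negbTE ->. Qed.

Lemma sstep_den x : 0 < flat 1 x + flat 1 (- 1 * x + 1).
Proof.
have [x0|x0] := ltP 0 x.
  by rewrite ltr_pwDl ?flat1_gt0 ?flat1_ge0.
by rewrite ltr_wpDl ?flat1_ge0// flat1_gt0; lra.
Qed.

Lemma sstep_smooth : smooth1 sstep.
Proof.
apply: smooth1M; first exact: flat_smooth.
apply: smooth1V; first by move=> x; rewrite gt_eqF ?sstep_den.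
by apply: smooth1D; [|apply: smooth1_affine]; exact: flat_smooth.
Qed.

Lemma sstep_le0 x : x <= 0 -> sstep x = 0.
Proof. by move=> x0; rewrite /sstep flat1_le0// mul0r. Qed.

Lemma sstep_ge1 x : 1 <= x -> sstep x = 1.
Proof.
move=> x1; rewrite /sstep (@flat1_le0 (_ + _)); last lra.
by rewrite addr0 divff// gt_eqF// flat1_gt0//; lra.
Qed.

Lemma sstep_ge0 x : 0 <= sstep x.
Proof. by rewrite /sstep divr_ge0 ?flat1_ge0// ltW ?sstep_den. Qed.
Lemma sstep_le1 x : sstep x <= 1.
Proof. by rewrite /sstep ler_pdivrMr ?sstep_den// mul1r lerDl flat1_ge0. Qed.

Lemma flat1_mono x y : x <= y -> flat 1 x <= flat 1 y.
Proof.
move=> xy; have [y0|y0] := ltP 0 y; last by rewrite !flat1_le0// (le_trans xy).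
have [x0|x0] := ltP 0 x; last by rewrite (flat1_le0 x0) flat1_ge0.
by rewrite /flat x0 y0 !hornerE ?mul1r ler_expR lerN2 lef_pV2 ?posrE.
Qed.

Lemma sstep_mono x y : x <= y -> sstep x <= sstep y.
Proof.
move=> xy; rewrite /sstep ler_pdivrMr ?sstep_den// mulrAC ler_pdivlMr ?sstep_den//.
rewrite !mulrDr [X in X + _ <= _]mulrC lerD2l.
apply: ler_pM; rewrite ?flat1_ge0 ?flat1_mono//; lra.
Qed.

Lemma dsstep_ge0 x : 0 <= derive1 sstep x.
Proof.
rewrite derive1E.
have dx := smooth1_derivable (x := x) sstep_smooth.
rewrite /derive (cvg_at_rightE _ _ dx).
apply: limr_ge.
  by move: dx => /cvg_ex[l dx]; apply/cvg_ex; exists l; exact: cvg_dnbhs_at_right.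
near=> h.
have h0 : 0 < h by [].
rewrite /GRing.scale /= mulr1 mulr_ge0//; first by rewrite invr_ge0 ltW.
by rewrite subr_ge0 sstep_mono// lerDr ltW.
Unshelve. all: by end_near. Qed.

Lemma dsstep_le0 x : x <= 0 -> derive1 sstep x = 0.
Proof.
move=> x0; rewrite derive1E /derive (cvg_at_leftE _ _ (smooth1_derivable (x := x) sstep_smooth)).
apply/cvg_lim => //; apply: (@cvg_near_cst R); near=> h.
have h0 : h < 0 by [].
by rewrite /GRing.scale /= mulr1 !sstep_le0 ?subr0 ?mulr0//; lra.
Unshelve. all: by end_near. Qed.

Lemma dsstep_ge1 x : 1 <= x -> derive1 sstep x = 0.
Proof.
move=> x0; rewrite derive1E /derive (cvg_at_rightE _ _ (smooth1_derivable (x := x) sstep_smooth)).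
apply/cvg_lim => //; apply: (@cvg_near_cst R); near=> h.
have h0 : 0 < h by [].
by rewrite /GRing.scale /= mulr1 !sstep_ge1 ?subrr ?mulr0//; lra.
Unshelve. all: by end_near. Qed.

(** The transition from 0 to 1 takes place in [a, a + 1/n], so the derivative
    dstep is an approximate identity to the right of a. *)
Definition step n (a x : R) : R := sstep (n%:R * x + - (n%:R * a)).
Definition dstep n (a x : R) : R := n%:R * derive1 sstep (n%:R * x + - (n%:R * a)).

Lemma step_smooth n a : smooth1 (step n a).
Proof. by apply: smooth1_affine; exact: sstep_smooth. Qed.

Lemma step_is_derive n a x : is_derive x (1:R) (step n a) (dstep n a x).
Proof.
by apply: derive1_affine => y; apply: smooth1_derivable; exact: sstep_smooth.
Qed.

Lemma derive_step n a : derive1 (step n a) = dstep n a.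
Proof.
by apply/funext => x; rewrite derive1E; have [_ ->] := step_is_derive n a x.
Qed.

Lemma dstep_smooth n a : smooth1 (dstep n a).
Proof. by rewrite -derive_step; apply: smooth1_derive; exact: step_smooth. Qed.

Lemma step_ge0 n a x : 0 <= step n a x. Proof. exact: sstep_ge0. Qed.
Lemma step_le1 n a x : step n a x <= 1. Proof. exact: sstep_le1. Qed.

Lemma step_le n a x : x <= a -> step n a x = 0.
Proof.
move=> xa; apply: sstep_le0; rewrite -mulrN -mulrDr.
by rewrite mulr_ge0_le0// subr_le0.
Qed.

Lemma step_ge n a x : (0 < n)%N -> a + n%:R^-1 <= x -> step n a x = 1.
Proof.
move=> n0 ax; apply: sstep_ge1; rewrite -mulrN -mulrDr.
rewrite -[leLHS](@divff _ n%:R) ?pnatr_eq0 -?lt0n// ler_wpM2l//; lra.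
Qed.

Lemma step_antimono n a b x : a <= b -> step n b x <= step n a x.
Proof.
move=> ab; apply: sstep_mono; rewrite lerD2l lerN2.
by rewrite ler_wpM2l.
Qed.

Lemma dstep_ge0 n a x : 0 <= dstep n a x.
Proof. by rewrite mulr_ge0// dsstep_ge0. Qed.

Lemma dstep_le n a x : x <= a -> dstep n a x = 0.
Proof.
move=> xa; rewrite /dstep dsstep_le0 ?mulr0// -mulrN -mulrDr.
by rewrite mulr_ge0_le0// subr_le0.
Qed.

Lemma dstep_ge n a x : (0 < n)%N -> a + n%:R^-1 <= x -> dstep n a x = 0.
Proof.
move=> n0 ax; rewrite /dstep dsstep_ge1 ?mulr0// -mulrN -mulrDr.
rewrite -[leLHS](@divff _ n%:R) ?pnatr_eq0 -?lt0n// ler_wpM2l//; lra.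
Qed.

End SmoothFunctions.
Global Opaque step dstep.

(** * Test functions on the line and on the plane *)

Section TestFun.
Context {R : realType}.

Lemma smooth1_directional (f : R -> R) (v : R) : smooth1 f ->
  'D_v f = (fun x => v * derive1 f x).
Proof.
move=> sf; apply/funext => x.
have df := smooth1_derivable (x := x) sf.
rewrite deriveE; last exact/derivable1_diffP.
by rewrite deriv1E.
Qed.

(** On the line a directional derivative is a multiple of the derivative, so
    iterated directional derivatives stay infinitely differentiable. *)
Lemma smooth1_smooth (f : R -> R) : smooth1 f -> smooth f.
Proof.
move=> sf vs x; apply/derivable1_diffP.
suff: smooth1 (foldr (fun v (g : R -> R) => 'D_v g) f vs).
  by move=> /smooth1_derivable; exact.
elim: vs => [//|v vs IH] /=.
rewrite (smooth1_directional _ IH).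
by apply: smooth1M; [exact: smooth1_cst|exact: smooth1_derive].
Qed.

(** Sums of products of smooth functions of one variable. The class is stable
    under directional derivatives, so all its members are smooth on the plane;
    products of bumps are the only planar test functions used below. *)
Inductive tensor : (R * R -> R) -> Prop :=
| tensor_prod f g : smooth1 f -> smooth1 g ->
    tensor (fun p => f p.1 * g p.2)
| tensor_add F G : tensor F -> tensor G -> tensor (fun p => F p + G p).

Lemma is_diff_fst (p : R * R) : is_diff p (fst : R * R -> R) fst.
Proof.
have lf : linear (fst : R * R -> R^o) by [].
pose L := GRing.isLinear.Build R (R * R)%type R^o _ (fst : R * R -> R^o) lf.
pose F : {linear (R * R)%type -> R^o} := HB.pack (fst : R * R -> R^o) L.
have cF : continuous F by move=> x; exact: cvg_fst.
by apply: DiffDef; [exact: (@linear_differentiable _ _ _ F p cF)|exact: (@diff_lin _ _ _ F p cF)].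
Qed.

Lemma is_diff_snd (p : R * R) : is_diff p (snd : R * R -> R) snd.
Proof.
have lf : linear (snd : R * R -> R^o) by [].
pose L := GRing.isLinear.Build R (R * R)%type R^o _ (snd : R * R -> R^o) lf.
pose F : {linear (R * R)%type -> R^o} := HB.pack (snd : R * R -> R^o) L.
have cF : continuous F by move=> x; exact: cvg_snd.
by apply: DiffDef; [exact: (@linear_differentiable _ _ _ F p cF)|exact: (@diff_lin _ _ _ F p cF)].
Qed.

Lemma is_diff_smooth1 (f : R -> R) x : smooth1 f ->
  is_diff x f ( *:%R^~ (derive1 f x)).
Proof.
move=> sf; have df := smooth1_derivable (x := x) sf.
by apply: DiffDef; [exact/derivable1_diffP|exact: deriv1E].
Qed.

Lemma is_diff_tensor (f g : R -> R) (p : R * R) : smooth1 f -> smooth1 g ->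
  is_diff p (fun p : R * R => f p.1 * g p.2)
    (fun v => v.1 * (derive1 f p.1 * g p.2) + v.2 * (f p.1 * derive1 g p.2)).
Proof.
move=> sf sg.
have df1 := @is_diff_comp R _ _ _ fst fst f _ p (is_diff_fst p)
  (is_diff_smooth1 p.1 sf).
have dg1 := @is_diff_comp R _ _ _ snd snd g _ p (is_diff_snd p)
  (is_diff_smooth1 p.2 sg).
have := @is_diffM R _ _ _ _ _ p df1 dg1.
move=> H; apply: is_diff_eq.
apply/funext => v.
transitivity (f p.1 * (v.2 * derive1 g p.2) + g p.2 * (v.1 * derive1 f p.1)).
  by [].
ring.
Qed.

Lemma tensor_differentiable F p : tensor F -> differentiable F p.
Proof.
elim=> {F} [f g sf sg|F G _ dF _ dG].
  by have [] := is_diff_tensor p sf sg.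
exact: differentiableD.
Qed.

Lemma tensor_directional F v : tensor F -> tensor ('D_v F).
Proof.
elim=> {F} [f g sf sg|F G tF IF tG IG].
  rewrite (_ : 'D_v _ =
    (fun p => (v.1 * derive1 f p.1) * g p.2 + (v.2 * f p.1) * derive1 g p.2)).
    apply: tensor_add.
      apply: (@tensor_prod (fun x => v.1 * derive1 f x)) => //.
      by apply: smooth1M; [exact: smooth1_cst|exact: smooth1_derive].
    apply: (@tensor_prod (fun x => v.2 * f x)); last exact: smooth1_derive.
    by apply: smooth1M => //; exact: smooth1_cst.
  apply/funext => p; have [df E] := is_diff_tensor p sf sg.
  by rewrite deriveE// E !mulrA.
rewrite (_ : 'D_v _ = (fun p => 'D_v F p + 'D_v G p)); first exact: tensor_add.
apply/funext => p; rewrite deriveD//; apply: diff_derivable;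
  exact: tensor_differentiable.
Qed.

Lemma tensor_smooth F : tensor F -> smooth F.
Proof.
move=> tF vs x; apply: tensor_differentiable.
by elim: vs => [//|v vs IH] /=; exact: tensor_directional.
Qed.

Lemma tensor_derive (f g : R -> R) p (v : R * R) : smooth1 f -> smooth1 g ->
  'D_v (fun p : R * R => f p.1 * g p.2) p =
  v.1 * (derive1 f p.1 * g p.2) + v.2 * (f p.1 * derive1 g p.2).
Proof.
by move=> sf sg; have [df E] := is_diff_tensor p sf sg; rewrite deriveE// E.
Qed.

(** As n grows this tends to the indicator of ]a, b], while its derivative is
    a difference of approximate identities at a and b. *)
Definition bump n (a b x : R) : R := step n a x - step n b x.

Lemma bumpE n a b x : bump n a b x = step n a x - step n b x.
Proof. by []. Qed.

Lemma bump_smooth n a b : smooth1 (bump n a b).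
Proof.
have -> : bump n a b = (fun x => step n a x + (-1) * step n b x).
  by apply/funext => x; rewrite /bump mulN1r.
apply: smooth1D; first exact: step_smooth.
by apply: smooth1M; [exact: smooth1_cst|exact: step_smooth].
Qed.

Lemma derive_bump n a b :
  derive1 (bump n a b) = (fun x => dstep n a x - dstep n b x).
Proof.
apply/funext => x; rewrite derive1E.
have da := step_is_derive n a x; have db := step_is_derive n b x.
have H : is_derive x (1:R) (step n a - step n b) (dstep n a x - dstep n b x).
  exact: is_deriveB.
by have [_ <-] := H.
Qed.

Lemma bump_ge0 n a b x : a <= b -> 0 <= bump n a b x.
Proof. by move=> ab; rewrite subr_ge0 step_antimono. Qed.

Lemma bump_le1 n a b x : bump n a b x <= 1.
Proof.
have := step_le1 n a x; have := step_ge0 n b x; rewrite /bump; lra.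
Qed.

Lemma bump_out n a b x : (0 < n)%N -> a <= b -> (x <= a) || (b + 1 <= x) ->
  bump n a b x = 0.
Proof.
move=> n0 ab /orP[xa|xb].
  by rewrite /bump !step_le ?subrr// (le_trans xa).
have n1 : n%:R^-1 <= 1 :> R by rewrite invf_le1 ?ltr0n// ler1n.
by rewrite /bump !step_ge ?subrr//; lra.
Qed.

Lemma bump_support n a b : (0 < n)%N -> a <= b ->
  [set x | bump n a b x != 0] `<=` `[a, b + 1].
Proof.
move=> n0 ab x /= bx; rewrite in_itv /=; apply/andP.
split; rewrite leNgt; apply: contra bx => /ltW h; apply/eqP.
  by rewrite bump_out// h.
by rewrite bump_out// h orbT.
Qed.

Lemma bump_test n a b : (0 < n)%N -> a <= b -> test_function (bump n a b).
Proof.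
move=> n0 ab; split; first exact/smooth1_smooth/bump_smooth.
apply: (@subclosed_compact _ _ `[a, b + 1]%classic).
- exact: closed_closure.
- exact: segment_compact.
- apply: subset_trans (closure_subset (bump_support n0 ab)) _.
  by rewrite -(closure_id _).1//; exact: itv_closed.
Qed.

Definition bump2 n (t1 t2 x1 x2 : R) (p : R * R) : R :=
  bump n t1 t2 p.1 * bump n x1 x2 p.2.

Lemma bump2_tsupport n t1 t2 x1 x2 : (0 < n)%N -> t1 <= t2 -> x1 <= x2 ->
  tsupport (bump2 n t1 t2 x1 x2) `<=` `[t1, t2 + 1] `*` `[x1, x2 + 1].
Proof.
move=> n0 t12 x12.
have cl : closed (`[t1, t2 + 1]%classic `*` `[x1, x2 + 1]%classic : set (R * R)).
  apply: compact_closed; first exact: norm_hausdorff.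
  by apply: compact_setX; exact: segment_compact.
rewrite [X in _ `<=` X](closure_id _).1//.
apply: closure_subset => -[t x] /=; rewrite /bump2 mulf_eq0 negb_or => /andP[h1 h2].
by split => /=; [exact: bump_support h1|exact: bump_support h2].
Qed.

Lemma bump2_test n t1 t2 x1 x2 : (0 < n)%N -> t1 <= t2 -> x1 <= x2 ->
  test_function (bump2 n t1 t2 x1 x2).
Proof.
move=> n0 t12 x12; split.
  apply: tensor_smooth; apply: tensor_prod; exact: bump_smooth.
apply: (@subclosed_compact _ _ (`[t1, t2 + 1] `*` `[x1, x2 + 1])%classic).
- exact: closed_closure.
- by apply: compact_setX; exact: segment_compact.
- exact: bump2_tsupport.
Qed.

End TestFun.
Global Opaque bump.

(** * Integrability and approximate identities *)

Section IntegralTools.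
Context {R : realType}.
Local Notation leb := (@lebesgue_measure R).

Lemma integrable_scale d (T : measurableType d) (mu : {measure set T -> \bar R}) (D : set T)
    (c : R) (f : T -> R) : measurable D ->
  mu.-integrable D (EFin \o f) -> mu.-integrable D (EFin \o (fun x => c * f x)).
Proof. by move=> mD i; exact: (integrableZl mD c i). Qed.

Lemma integrable_add d (T : measurableType d) (mu : {measure set T -> \bar R}) (D : set T)
    (f g : T -> R) : measurable D ->
  mu.-integrable D (EFin \o f) -> mu.-integrable D (EFin \o g) ->
  mu.-integrable D (EFin \o (fun x => f x + g x)).
Proof. by move=> mD i j; exact: (integrableD mD i j). Qed.

Lemma integrable_sub d (T : measurableType d) (mu : {measure set T -> \bar R}) (D : set T)
    (f g : T -> R) : measurable D ->
  mu.-integrable D (EFin \o f) -> mu.-integrable D (EFin \o g) ->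
  mu.-integrable D (EFin \o (fun x => f x - g x)).
Proof. by move=> mD i j; exact: (integrableB mD i j). Qed.

Lemma integrable_dominated d (T : measurableType d) (mu : {measure set T -> \bar R}) (D : set T)
    (f g : T -> R) : measurable D -> measurable_fun D f ->
  (forall x, D x -> `|f x| <= g x) ->
  mu.-integrable D (EFin \o g) -> mu.-integrable D (EFin \o f).
Proof.
move=> mD mf fg; apply: le_integrable => //; first exact/measurable_EFinP.
by move=> x Dx; rewrite /= lee_fin (le_trans (fg _ Dx))// ler_norm.
Qed.

Lemma Rintegral_dct d (T : measurableType d) (mu : {measure set T -> \bar R})
    (f_ : nat -> T -> R) (f g : T -> R) :
  (forall n, measurable_fun setT (f_ n)) -> measurable_fun setT f ->
  {ae mu, forall x, f_ ^~ x @ \oo --> f x} ->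
  mu.-integrable setT (EFin \o g) ->
  (forall n x, `|f_ n x| <= g x) ->
  mu.-integrable setT (EFin \o f) /\
  \int[mu]_x f_ n x @[n --> \oo] --> \int[mu]_x f x.
Proof.
move=> mf_ mf cf ig fg.
have [|||||h1 _ h2] := @dominated_convergence _ T R mu setT measurableT
  (fun n => EFin \o f_ n) (EFin \o f) (EFin \o g).
- by move=> n; exact/measurable_EFinP.
- exact/measurable_EFinP.
- by apply: filterS cf => x cx _; apply: cvg_EFin; [exact: nearW|exact: cx].
- exact: ig.
- by apply: nearW => x n _ /=; rewrite lee_fin.
split; first exact: h1.
have If : (\int[mu]_x (f x)%:E)%E \is a fin_num by exact: integrable_fin_num.
by move: h2; rewrite -(fineK If) => /fine_cvg.
Qed.

Lemma integrable_support (f : R -> R) (a b B : R) :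
  measurable_fun setT f ->
  (forall x, a <= x <= b -> `|f x| <= B) ->
  (forall x, ~~ (a <= x <= b) -> f x = 0) ->
  leb.-integrable setT (EFin \o f).
Proof.
move=> mf fB f0.
have -> : f = f \_ `[a, b].
  apply/funext => x; rewrite patchE; case: ifPn => // h.
  by apply: f0; apply: contra h => h; rewrite inE /= in_itv.
rewrite -restrict_EFin; apply: (iffLR (integrable_mkcond _ _)) => //.
apply: measurable_bounded_integrable => //.
- by apply: compact_finite_measure; exact: segment_compact.
- exact: measurable_funTS.
- exists B; split => //; first exact: num_real.
  move=> y By x /=; rewrite in_itv /= => xab.
  exact: le_trans (fB _ xab) (ltW By).
Qed.

Lemma integral_dstep n (a : R) : (0 < n)%N -> \int[leb]_x (dstep n a x) = 1.
Proof.
move=> n0.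
have n0' : (0 : R) < n%:R^-1 by rewrite invr_gt0 ltr0n.
rewrite /Rintegral.
have -> : (\int[leb]_x (dstep n a x)%:E =
           \int[leb]_(x in `[a, (a + n%:R^-1)%R]) (dstep n a x)%:E)%E.
  rewrite [RHS]integral_mkcond; apply: eq_integral => x _.
  rewrite patchE; case: ifPn => //; rewrite notin_setE /= in_itv /= => /negP.
  rewrite negb_and -!ltNge => /orP[h|h].
    by rewrite dstep_le// ltW.
  by rewrite dstep_ge// ltW.
rewrite (@continuous_FTC2 R (dstep n a) (step n a)).
- by rewrite (step_le n (lexx a)) (step_ge n0 (lexx _)) sube0.
- by rewrite ltrDl.
- by apply: continuous_subspaceT; exact/smooth1_continuous/dstep_smooth.
- split.
  + by move=> x _; have [] := step_is_derive n a x.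
  + apply: cvg_at_right_filter; exact/smooth1_continuous/step_smooth.
  + apply: cvg_at_left_filter; exact/smooth1_continuous/step_smooth.
- by move=> x _; rewrite derive_step.
Qed.

Lemma dstep_measurable n (a : R) : measurable_fun setT (dstep n a).
Proof.
by apply: continuous_measurable_fun; apply: smooth1_continuous; exact: dstep_smooth.
Qed.

Lemma bump_measurable n (a b : R) : measurable_fun setT (bump n a b).
Proof.
by apply: continuous_measurable_fun; apply: smooth1_continuous; exact: bump_smooth.
Qed.

Lemma dstep_bounded n (a : R) : (0 < n)%N -> exists2 B, 0 <= B &
  forall x, `|dstep n a x| <= B.
Proof.
move=> n0.
have [||c _ Hc] := @EVT_max R (dstep n a) a (a + n%:R^-1).
- by rewrite lerDl invr_ge0.
- by apply: continuous_subspaceT; exact/smooth1_continuous/dstep_smooth.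
exists (dstep n a c); first exact: dstep_ge0.
move=> x; rewrite ger0_norm; last exact: dstep_ge0.
have [xa|xa] := leP x a; first by rewrite dstep_le// dstep_ge0.
have [xb|xb] := leP (a + n%:R^-1) x; first by rewrite dstep_ge// dstep_ge0.
by apply: Hc; rewrite in_itv /= !ltW.
Qed.

Lemma integrable_mul_dstep n (a : R) (g : R -> R) (B : R) : (0 < n)%N ->
  measurable_fun setT g ->
  (forall x, a < x <= a + n%:R^-1 -> `|g x| <= B) ->
  leb.-integrable setT (EFin \o (fun x => g x * dstep n a x)).
Proof.
move=> n0 mg gB; have [C C0 HC] := dstep_bounded a n0.
apply: (@integrable_support _ a (a + n%:R^-1) (`|B| * C)).
- by apply: measurable_funM => //; exact: dstep_measurable.
- move=> x /andP[ax xb]; rewrite normrM.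
  have [xa|xa] := leP x a; first by rewrite dstep_le// normr0 mulr0 mulr_ge0.
  by rewrite ler_pM// (le_trans (gB x _)) ?xa// ler_norm.
- move=> x; rewrite negb_and -!ltNge => /orP[h|h].
    by rewrite dstep_le ?mulr0// ltW.
  by rewrite dstep_ge ?mulr0// ltW.
Qed.

Lemma integrable_dstep n (a : R) : (0 < n)%N ->
  leb.-integrable setT (EFin \o dstep n a).
Proof.
move=> n0; have := @integrable_mul_dstep n a (cst 1) 1 n0.
rewrite [X in EFin \o X](_ : _ = dstep n a); first apply => //.
  by move=> x _; rewrite /= normr1.
by apply/funext => x; rewrite /= mul1r.
Qed.

Lemma approx_identity_bound n (a c e : R) (g : R -> R) : (0 < n)%N ->
  measurable_fun setT g ->
  (forall x, a < x <= a + n%:R^-1 -> `|g x - c| <= e) ->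
  `|\int[leb]_x (g x * dstep n a x) - c| <= e.
Proof.
move=> n0 mg ge.
have id := integrable_dstep a n0.
have i1 : leb.-integrable setT (EFin \o (fun x => g x * dstep n a x)).
  apply: (@integrable_mul_dstep _ _ _ (`|c| + e)) => // x /ge h.
  have := ler_normD (g x - c) c; rewrite subrK; lra.
have i2 : leb.-integrable setT (EFin \o (fun x => c * dstep n a x)).
  exact: integrable_scale.
have Ec k : k = \int[leb]_x (k * dstep n a x).
  by rewrite RintegralZl// integral_dstep// mulr1.
rewrite [X in _ - X]Ec -RintegralB//.
apply: le_trans (le_normr_Rintegral _ _) _ => //; first exact: integrable_sub.
rewrite (Ec e).
apply: le_Rintegral => //.
- apply: integrable_norm; exact: integrable_sub.
- exact: integrable_scale.
move=> x _; rewrite -mulrBl normrM (ger0_norm (dstep_ge0 _ _ _)).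
have [xa|xa] := leP x a; first by rewrite dstep_le ?mulr0.
have [xb|xb] := leP (a + n%:R^-1) x; first by rewrite dstep_ge ?mulr0.
by rewrite ler_wpM2r ?dstep_ge0// ge// xa ltW.
Qed.

(** Only the limit of g from the right counts, since dstep lives in [a, a +
    1/n]. *)
Lemma approx_identity (a c : R) (g : R -> R) :
  measurable_fun setT g -> g x @[x --> a^'+] --> c ->
  \int[leb]_x (g x * dstep n.+1 a x) @[n --> \oo] --> c.
Proof.
move=> mg /cvgrPdist_le gc; apply/cvgrPdist_le => e e0.
have := gc e e0; rewrite near_withinE => /nbhs_ballP[d /= d0 Hd].
near=> n; rewrite distrC; apply: approx_identity_bound => // x /andP[ax xn].
have nd : n.+1%:R^-1 < d by near: n; exact: near_infty_natSinv_lt (PosNum d0).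
rewrite distrC; apply: Hd => //=.
by rewrite -ball_normE /= distrC gtr0_norm ?subr_gt0// ltrBlDl (le_lt_trans xn)// ltrD2l.
Unshelve. all: by end_near. Qed.

End IntegralTools.

(** * Weak derivatives and the fundamental theorem of calculus *)

Section Limits.
Context {R : realType}.
Local Notation leb := (@lebesgue_measure R).

Lemma step_cvg (a x : R) : a < x -> step n.+1 a x @[n --> \oo] --> (1 : R).
Proof.
move=> ax; have d0 : 0 < x - a by rewrite subr_gt0.
apply: cvg_near_cst; near=> n.
rewrite step_ge// -lerBrDl ltW//.
by near: n; exact: near_infty_natSinv_lt (PosNum d0).
Unshelve. all: by end_near. Qed.

Lemma bump_cvg (a b x : R) : a <= b ->
  bump n.+1 a b x @[n --> \oo] --> (\1_(`]a, b]%classic) x : R).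
Proof.
move=> ab; rewrite indicE; have [xa|ax] := leP x a.
  rewrite memNset /= ?in_itv /=; last by rewrite ltNge xa.
  apply: cvg_near_cst; near=> n; rewrite bump_out// xa//.
have [xb|bx] := leP x b.
  rewrite mem_set /= ?in_itv /= ?ax ?xb// -(subr0 1).
  under eq_fun do rewrite bumpE.
  apply: cvgB; first exact: step_cvg.
  by apply: cvg_near_cst; near=> n; rewrite step_le.
rewrite memNset /= ?in_itv /=; last by rewrite ax leNgt bx.
have -> : false%:R = 1 - 1 :> R by rewrite subrr.
have xa : a < x by exact: le_lt_trans bx.
by under eq_fun do rewrite bumpE; apply: cvgB; exact: step_cvg.
Unshelve. all: by end_near. Qed.

Lemma bump_norm n (a b x : R) : (0 < n)%N -> a <= b ->
  `|bump n a b x| <= \1_(`[a, b + 1]%classic) x.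
Proof.
move=> n0 ab; rewrite ger0_norm ?bump_ge0// indicE.
case: (boolP (x \in _)) => h; first exact: bump_le1.
rewrite le_eqVlt; apply/orP; left; apply/eqP/bump_out => //.
move: h; rewrite notin_setE /= in_itv /= => /negP.
by rewrite negb_and -!ltNge => /orP[/ltW->//|/ltW->]; rewrite orbT.
Qed.

Lemma locally_integrable_itv (g : R -> R) (a b : R) : locally_integrable setT g ->
  leb.-integrable `[a, b] (EFin \o g).
Proof.
move=> [mg _ ig]; apply/integrableP; split.
  by apply/measurable_EFinP; exact: measurable_funTS.
by apply: ig => //; exact: segment_compact.
Qed.

Lemma Rintegral_indic (D : set R) (g : R -> R) :
  \int[leb]_x (g x * \1_D x) = \int[leb]_(x in D) g x.
Proof.
rewrite [RHS]Rintegral_mkcond; apply: eq_Rintegral => x _.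
by rewrite patchE indicE; case: ifP => _; rewrite ?mulr1 ?mulr0.
Qed.

Lemma integrable_indic_mul (D : set (measurableTypeR R)) (g : R -> R) : measurable D ->
  leb.-integrable D (EFin \o g) ->
  leb.-integrable setT (EFin \o (fun x => g x * \1_D x)).
Proof.
move=> mD ig; have := iffLR (integrable_mkcond _ mD) ig.
rewrite restrict_EFin; congr (_.-integrable _ (EFin \o _)); apply/funext => x.
by rewrite patchE indicE; case: ifP => _; rewrite ?mulr1 ?mulr0.
Qed.

(** In the definition of the weak derivative tested against bumps, one side
    tends to f a - f b because the derivative of the bump is a difference of
    approximate identities, and the other to minus the integral over ]a, b].
    *)
Lemma weak_deriv_ftc (f g : R -> R) (a b : R) : is_weak_deriv f g ->
  continuous f -> a <= b -> f b - f a = \int[leb]_(x in `]a, b]) g x.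
Proof.
move=> [_ lg fg] cf ab.
have mf : measurable_fun setT f by exact: continuous_measurable_fun.
have [mg _ _] := lg.
have L1 : \int[leb]_x (f x * derive1 (bump n.+1 a b) x) @[n --> \oo] --> f a - f b.
  have E n : \int[leb]_x (f x * derive1 (bump n.+1 a b) x) =
      \int[leb]_x (f x * dstep n.+1 a x) - \int[leb]_x (f x * dstep n.+1 b x).
    have K c : leb.-integrable setT (EFin \o (fun x => f x * dstep n.+1 c x)).
      have [||d _ Hd] := @EVT_max R (fun x => `|f x|) c (c + n.+1%:R^-1).
      - by rewrite lerDl invr_ge0.
      - apply: continuous_subspaceT => x; apply: cvg_norm; exact: cf.
      apply: (@integrable_mul_dstep _ _ _ _ (`|f d|)) => // x /andP[cx xc].
      by apply: Hd; rewrite in_itv /= xc (ltW cx).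
    rewrite -RintegralB//; apply: eq_Rintegral => x _.
    by rewrite derive_bump mulrBr.
  apply: cvg_trans (cvgB (approx_identity mf (cvg_at_right_filter (cf a)))
    (approx_identity mf (cvg_at_right_filter (cf b)))).
  by under eq_fun do rewrite E.
have L2 : \int[leb]_x (g x * bump n.+1 a b x) @[n --> \oo] -->
    \int[leb]_(x in `]a, b]) g x.
  rewrite -Rintegral_indic.
  have ig : leb.-integrable setT
      (EFin \o (fun x => `|g x * \1_(`[a, b + 1]%classic) x|)).
    apply: integrable_norm; apply: integrable_indic_mul => //.
    exact: locally_integrable_itv.
  apply: (proj2 (@Rintegral_dct _ _ _ leb (fun n x => g x * bump n.+1 a b x)
    (fun x => g x * \1_(`]a, b]%classic) x) _ _ _ _ ig _)).
  - move=> n; apply: measurable_funM => //; exact: bump_measurable.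
  - apply: measurable_funM => //; exact: measurable_indic.
  - by apply: nearW => x; apply: cvgMr; exact: bump_cvg.
  - move=> n x; rewrite !normrM ler_wpM2l//.
    by apply: le_trans (bump_norm _ _ _) (ler_norm _).
have L4 : \int[leb]_x (f x * derive1 (bump n.+1 a b) x) @[n --> \oo] -->
    - \int[leb]_(x in `]a, b]) g x.
  rewrite (_ : (fun n => _) = (fun n => - \int[leb]_x (g x * bump n.+1 a b x))).
    exact: cvgN L2.
  by apply/funext => n; rewrite fg//; exact: bump_test.
have H : f a - f b = - \int[leb]_(x in `]a, b]) g x.
  exact: cvg_unique L1 L4.
lra.
Qed.

End Limits.

(** * Integrals over rectangles *)

Section Planar.
Context {R : realType}.
Local Notation leb := (@lebesgue_measure R).
Local Notation T := (measurableTypeR R).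

(** Time is frozen at the grid points floor(n t) / n. On each of the countably
    many time strips the approximation is a continuous function of x, hence
    measurable, and continuity in time gives pointwise convergence. *)
Lemma separately_continuous_measurable (G : R -> R -> R) :
  (forall t, 0 <= t -> continuous (G t)) ->
  (forall x, continuous (fun t : R => G (Num.max t 0) x)) ->
  measurable_fun (setT : set (T * T)) (fun p => G (Num.max p.1 0) p.2).
Proof.
move=> cx ct.
(* floor (n t) is 0 for t <= 0, so the grid point tends to the positive part of t *)
pose tr (n : nat) (t : R) : R := (Num.truncn (n.+1%:R * t))%:R.
pose Gn (n : nat) (p : T * T) : R := G (tr n p.1 / n.+1%:R) p.2.
have mtr n : measurable_fun (setT : set T) (tr n).
  apply: nondecreasing_measurable => // s t st.
  by rewrite ler_nat le_truncn// ler_wpM2l.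
have mGn n : measurable_fun (setT : set (T * T)) (Gn n).
  pose E (k : nat) : set (T * T) := [set p | tr n p.1 = k%:R].
  have mE k : measurable (E k).
    have : measurable_fun (setT : set (T * T)) (tr n \o fst).
      exact: (measurableT_comp (mtr n) (@measurable_fst _ _ _ _)).
    move=> /(_ measurableT [set k%:R] (measurable_set1 _)).
    by rewrite setTI.
  have -> : (setT : set (T * T)) = \bigcup_k E k.
    apply/seteqP; split => // p _; exists (Num.truncn (n.+1%:R * p.1)) => //.
  apply/measurable_fun_bigcup => // k.
  apply: (@eq_measurable_fun _ _ _ _ _ (fun p => G (k%:R / n.+1%:R) p.2)).
    by move=> p; rewrite inE /E /Gn /= => ->.
  apply: measurable_funTS; apply: measurableT_comp => //.
  by apply: continuous_measurable_fun; apply: cx; rewrite divr_ge0.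
apply: (@measurable_fun_cvg _ _ _ _ Gn) => // -[t x] _ /=.
rewrite /Gn /=.
have L : tr n t / n.+1%:R @[n --> \oo] --> Num.max t 0.
  have [t0|t0] := leP t 0.
    apply: cvg_near_cst; near=> n; rewrite /tr.
    suff -> : Num.truncn (n.+1%:R * t) = 0%N by rewrite mul0r.
    by apply/truncn0Pn; rewrite -ltNge (le_lt_trans _ ltr01)// mulr_ge0_le0.
  apply/cvgrPdist_le => e e0; near=> n.
  have ne : n.+1%:R^-1 < e by near: n; exact: near_infty_natSinv_lt (PosNum e0).
  have nt : 0 <= n.+1%:R * t by rewrite mulr_ge0// ltW.
  have := truncn_itv nt; rewrite -/(tr n t) => /andP[h1 h2].
  have n0 : 0 < n.+1%:R :> R by rewrite ltr0n.
  have e1 : tr n t / n.+1%:R <= t by rewrite ler_pdivrMr// mulrC.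
  rewrite ger0_norm ?subr_ge0// (le_trans _ (ltW ne))//.
  rewrite lerBlDr -[X in X + _]mul1r -mulrDl ler_pdivlMr// mulrC.
  by rewrite ltW// (lt_le_trans h2)// -natr1 addrC.
have -> : (fun n => G (tr n t / n.+1%:R) x) =
    (fun n => G (Num.max (tr n t / n.+1%:R) 0) x).
  apply/funext => n; congr (G _ x); apply/esym/max_idPl.
  by rewrite divr_ge0.
have := @continuous_cvg _ _ _ _ _ (fun n => tr n t / n.+1%:R) (fun t : R => G (Num.max t 0) x) (Num.max t 0) (ct x _) L.
have -> : Num.max (Num.max t 0) 0 = Num.max t 0.
  by apply/max_idPl; rewrite le_max lexx orbT.
exact.
Unshelve. all: by end_near. Qed.

Lemma integrable_box (f : R * R -> R) (a b c d B : R) :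
  measurable_fun (setT : set (T * T)) f ->
  (forall p, a <= p.1 <= b -> c <= p.2 <= d -> `|f p| <= B) ->
  (forall p, ~~ ((a <= p.1 <= b) && (c <= p.2 <= d)) -> f p = 0) ->
  (leb \x leb)%E.-integrable (setT : set (T * T)) (EFin \o f).
Proof.
move=> mf fB f0.
pose D : set (T * T) := `[a, b]%classic `*` `[c, d]%classic.
have mD : measurable D by exact: measurableX.
have -> : f = f \_ D.
  apply/funext => x; rewrite patchE; case: ifPn => // h.
  apply: f0; apply: contra h => /andP[h1 h2].
  by rewrite inE /D; split; rewrite /= in_itv.
rewrite -restrict_EFin; apply: (iffLR (integrable_mkcond _ _)) => //.
apply: measurable_bounded_integrable => //.
- rewrite /= product_measure1E//.
  by apply: lte_mul_pinfty => //; [rewrite ge0_fin_numE//|];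
    apply: compact_finite_measure; exact: segment_compact.
- exact: measurable_funTS.
- exists B; split => //; first exact: num_real.
  move=> y By [x1 x2] /= [/= h1 h2]; apply: le_trans (fB _ _ _) (ltW By).
    by move: h1; rewrite in_itv.
  by move: h2; rewrite in_itv.
Qed.

Lemma Rfubini1 (f : R * R -> R) :
  (leb \x leb)%E.-integrable (setT : set (T * T)) (EFin \o f) ->
  (forall s, leb.-integrable setT (EFin \o (fun y => f (s, y)))) ->
  leb.-integrable setT (EFin \o (fun s => \int[leb]_y f (s, y))) /\
  \int[(leb \x leb)%E]_p f p = \int[leb]_s \int[leb]_y f (s, y).
Proof.
move=> ip is_.
have E : EFin \o (fun s => \int[leb]_y f (s, y)) =
    fubini_F leb (EFin \o f).
  apply/funext => s; rewrite /fubini_F /= /Rintegral fineK//.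
  exact: (integrable_fin_num measurableT (is_ s)).
split; first by rewrite E; exact: integrable_fubini_F.
rewrite {1}/Rintegral -(integral12_prod_meas1 ip); congr fine.
by apply: eq_integral => s _; exact: (esym (congr1 (fun h => h s) E)).
Qed.

Lemma Rfubini2 (f : R * R -> R) :
  (leb \x leb)%E.-integrable (setT : set (T * T)) (EFin \o f) ->
  (forall y, leb.-integrable setT (EFin \o (fun s => f (s, y)))) ->
  \int[(leb \x leb)%E]_p f p = \int[leb]_y \int[leb]_s f (s, y).
Proof.
move=> ip is_.
have E : EFin \o (fun y => \int[leb]_s f (s, y)) =
    fubini_G leb (EFin \o f).
  apply/funext => s; rewrite /fubini_G /= /Rintegral fineK//.
  exact: (integrable_fin_num measurableT (is_ s)).
rewrite {1}/Rintegral -(integral21_prod_meas1 ip); congr fine.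
by apply: eq_integral => s _; exact: (esym (congr1 (fun h => h s) E)).
Qed.

Section BoxLimit.
Variables (G : R * R -> R) (B s1 s2 y1 y2 : R).
Hypothesis mG : measurable_fun (setT : set (T * T)) G.
Hypotheses (s12 : s1 <= s2) (y12 : y1 <= y2).
Hypothesis GB : forall s y, s1 < s <= s2 + 1 -> y1 < y <= y2 + 1 ->
  `|G (s, y)| <= B.
Hypothesis Gy1 : forall s, s1 < s <= s2 + 1 ->
  G (s, y) @[y --> y1^'+] --> G (s, y1).
Hypothesis Gy2 : forall s, s1 < s <= s2 + 1 ->
  G (s, y) @[y --> y2^'+] --> G (s, y2).

(** The product bump of a box, differentiated in its second variable, is the
    test function that sees the flux of G through the two sides y1 and y2. *)
Definition box_integrand n (p : R * R) : R :=
  bump n s1 s2 p.1 * (G p * derive1 (bump n y1 y2) p.2).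

Lemma box_integrand_measurable n :
  measurable_fun (setT : set (T * T)) (box_integrand n).
Proof.
apply: measurable_funM.
  by apply: measurableT_comp => //; exact: bump_measurable.
apply: measurable_funM => //; rewrite derive_bump.
by apply: measurable_funB; apply: measurableT_comp => //; exact: dstep_measurable.
Qed.

Let dbump_bound n : (0 < n)%N -> exists2 C, 0 <= C &
  forall y, `|derive1 (bump n y1 y2) y| <= C.
Proof.
move=> n0; have [C1 C10 H1] := dstep_bounded y1 n0.
have [C2 C20 H2] := dstep_bounded y2 n0.
exists (C1 + C2); first exact: addr_ge0.
by move=> y; rewrite derive_bump (le_trans (ler_normB _ _))// lerD.
Qed.

Lemma dbump_out n y : (0 < n)%N -> ~~ (y1 < y <= y2 + 1) ->
  derive1 (bump n y1 y2) y = 0.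
Proof.
move=> n0; have n1 : n%:R^-1 <= 1 :> R by rewrite invf_le1 ?ltr0n// ler1n.
rewrite derive_bump negb_and -leNgt -ltNge => /orP[h|h].
  by rewrite !dstep_le ?subrr// (le_trans h).
have h2 : y2 + n%:R^-1 <= y by apply: ltW; apply: le_lt_trans h; rewrite lerD2l.
by rewrite !dstep_ge ?subrr//; apply: le_trans h2; rewrite lerD2r.
Qed.

Lemma bump_out' n s : (0 < n)%N -> ~~ (s1 < s <= s2 + 1) -> bump n s1 s2 s = 0.
Proof.
move=> n0; rewrite negb_and -leNgt -ltNge => /orP[h|h].
  by rewrite bump_out// h.
by rewrite bump_out// (ltW h) orbT.
Qed.

Lemma box_integrand_bound n : (0 < n)%N -> exists C, forall p,
  `|box_integrand n p| <= C /\
  (~~ ((s1 <= p.1 <= s2 + 1) && (y1 <= p.2 <= y2 + 1)) ->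
    box_integrand n p = 0).
Proof.
move=> n0; have [C C0 HC] := dbump_bound n0.
exists (`|B| * C) => -[s y]; rewrite /box_integrand /=.
case: (boolP (s1 < s <= s2 + 1)) => hs; last first.
  by rewrite bump_out'// !mul0r normr0; split => //; exact: mulr_ge0.
case: (boolP (y1 < y <= y2 + 1)) => hy; last first.
  by rewrite dbump_out// !mulr0 normr0; split => //; exact: mulr_ge0.
split.
  rewrite !normrM -[leRHS]mul1r ler_pM//.
    by rewrite ger0_norm ?bump_ge0// bump_le1.
  by rewrite ler_pM// (le_trans (GB hs hy))// ler_norm.
by move: hs hy => /andP[/ltW -> ->] /andP[/ltW -> ->].
Qed.

Lemma box_integrable n : (0 < n)%N ->
  (leb \x leb)%E.-integrable (setT : set (T * T)) (EFin \o box_integrand n).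
Proof.
move=> n0; have [C HC] := box_integrand_bound n0.
apply: (@integrable_box _ s1 (s2 + 1) y1 (y2 + 1) C).
- exact: box_integrand_measurable.
- by move=> p _ _; have [] := HC p.
- by move=> p; have [_] := HC p.
Qed.

Lemma box_slice1 n s : (0 < n)%N ->
  leb.-integrable setT (EFin \o (fun y => box_integrand n (s, y))).
Proof.
move=> n0; have [C HC] := box_integrand_bound n0.
apply: (@integrable_support _ _ y1 (y2 + 1) C).
- by apply: (@measurable_fun_pair2 _ _ _ T T) => //; exact: box_integrand_measurable.
- by move=> y _; have [] := HC (s, y).
- by move=> y hy; have [_ ->//] := HC (s, y); rewrite negb_and hy orbT.
Qed.

(** After integration in y, the derivative of the bump acts as an approximate
    identity at y1 and at y2; the bump in s then tends to the indicator of
    ]s1, s2], with dominated convergence. *)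
Lemma box_limit :
  \int[leb]_s \int[leb]_y box_integrand n.+1 (s, y) @[n --> \oo] -->
  \int[leb]_(s in `]s1, s2]) (G (s, y1) - G (s, y2)).
Proof.
have mGs s : measurable_fun setT (fun y => G (s, y)) by exact: (@measurable_fun_pair2 _ _ _ T T).
have GB0 s y : s1 < s <= s2 + 1 -> y1 < y <= y2 + 1 -> `|G (s, y) - 0| <= `|B|.
  by move=> hs hy; rewrite subr0 (le_trans (GB hs hy))// ler_norm.
have nn n : n.+1%:R^-1 <= 1 :> R by rewrite invf_le1 ?ltr0n// ler1n.
have win n c y : y1 <= c <= y2 -> c < y <= c + n.+1%:R^-1 -> y1 < y <= y2 + 1.
  move=> /andP[h1 h2] /andP[h3 h4]; rewrite (le_lt_trans h1)//=.
  by rewrite (le_trans h4)// lerD.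
have bd n s c : y1 <= c <= y2 -> s1 < s <= s2 + 1 ->
    `|\int[leb]_y (G (s, y) * dstep n.+1 c y)| <= `|B|.
  move=> hc hs.
  have := @approx_identity_bound R n.+1 c 0 `|B| (fun y => G (s, y)) isT (mGs s).
  rewrite subr0; apply=> y hy; apply: GB0 => //; exact: (win n c).
have b1 : y1 <= y1 <= y2 by rewrite lexx.
have b2 : y1 <= y2 <= y2 by rewrite lexx andbT.
have E n s : s1 < s <= s2 + 1 -> \int[leb]_y box_integrand n.+1 (s, y) =
    bump n.+1 s1 s2 s * (\int[leb]_y (G (s, y) * dstep n.+1 y1 y) -
      \int[leb]_y (G (s, y) * dstep n.+1 y2 y)).
  move=> hs.
  have K c : y1 <= c <= y2 ->
      leb.-integrable setT (EFin \o (fun y => G (s, y) * dstep n.+1 c y)).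
    move=> hc; apply: (@integrable_mul_dstep _ _ _ _ `|B|) => // y hy.
    by have := GB0 s y hs (win n c y hc hy); rewrite subr0.
  have K1 : leb.-integrable setT (EFin \o (fun y => G (s, y) * dstep n.+1 y1 y)).
    exact: K.
  have K2 : leb.-integrable setT (EFin \o (fun y => G (s, y) * dstep n.+1 y2 y)).
    exact: K.
  rewrite -(RintegralB measurableT K1 K2).
  rewrite -(RintegralZl (bump n.+1 s1 s2 s) measurableT (integrable_sub measurableT K1 K2)).
  by apply: eq_Rintegral => y _; rewrite /box_integrand derive_bump mulrBr.
have E0 n s : ~~ (s1 < s <= s2 + 1) -> \int[leb]_y box_integrand n.+1 (s, y) = 0.
  move=> hs; rewrite /Rintegral integral0_eq// => y _.
  by rewrite /box_integrand bump_out'// mul0r.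
have B0 : 0 <= 2 * `|B| by rewrite mulr_ge0.
rewrite -Rintegral_indic.
apply: (proj2 (@Rintegral_dct _ _ _ leb
  (fun n s => \int[leb]_y box_integrand n.+1 (s, y))
  (fun s => (G (s, y1) - G (s, y2)) * \1_(`]s1, s2]%classic) s)
  (fun s => (2 * `|B|) * \1_(`[s1, s2 + 1]%classic) s) _ _ _ _ _)).
- move=> n; have [+ _] := Rfubini1 (box_integrable (ltn0Sn n)) (fun s => box_slice1 s (ltn0Sn n)).
  by move=> /measurable_int/measurable_EFinP.
- apply: measurable_funM; last exact: measurable_indic.
  by apply: measurable_funB; apply: (@measurable_fun_pair1 _ _ _ T T).
- apply: nearW => s; case: (boolP (s1 < s <= s2 + 1)) => hs; last first.
    under eq_fun do rewrite E0//.
    rewrite indicE memNset ?mulr0; first exact: cvg_cst.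
    rewrite /= in_itv /=; apply/negP; apply: contra hs => /andP[-> h] /=; lra.
  under eq_fun do rewrite E//.
  rewrite mulrC; apply: cvgM; first exact: bump_cvg.
  by apply: cvgB; apply: approx_identity => //; [exact: Gy1|exact: Gy2].
- apply: integrable_scale => //; exact: integrable_indic_itv.
- move=> n s; case: (boolP (s1 < s <= s2 + 1)) => hs; last first.
    by rewrite E0// normr0 mulr_ge0// indicE.
  rewrite E// indicE mem_set ?mulr1; last first.
    by rewrite /= in_itv /=; move: hs => /andP[/ltW -> ->].
  rewrite normrM -[leRHS]mul1r ler_pM//.
    by rewrite ger0_norm ?bump_ge0// bump_le1.
  rewrite (le_trans (ler_normB _ _))// mulr2n mulrDl mul1r lerD//; exact: bd.
Qed.

End BoxLimit.
End Planar.

(** * Slices, difference quotients and convexity *)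

Section Slices.
Context {R : realType}.
Local Notation leb := (@lebesgue_measure R).
Local Notation T := (measurableTypeR R).
Implicit Types f v : R -> R.

(** The regularity of a solution at one fixed time, for an arbitrary
    representative v of the weak derivative. *)
Definition slice f v := [/\ continuous f, is_weak_deriv f v,
  leb.-integrable setT (EFin \o (fun x => f x ^+ 2)) &
  leb.-integrable setT (EFin \o (fun x => v x ^+ 2))].

Lemma weak_deriv_measurable f v : is_weak_deriv f v ->
  measurable_fun setT v.
Proof. by case=> _ []. Qed.

Lemma ae_mono (P Q : R -> Prop) : (forall x, P x -> Q x) ->
  {ae leb, forall x, P x} -> {ae leb, forall x, Q x}.
Proof.
by move=> PQ; apply: filterS => //; exact: (ae_filter_ringOfSetsType leb).
Qed.

Lemma ae_mono2 (P Q S : R -> Prop) : (forall x, P x -> Q x -> S x) ->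
  {ae leb, forall x, P x} -> {ae leb, forall x, Q x} -> {ae leb, forall x, S x}.
Proof.
by move=> PQ; apply: filterS2 => //; exact: (ae_filter_ringOfSetsType leb).
Qed.

(** By weak_deriv_ftc the function f is an indefinite integral of v, and the
    Lebesgue differentiation theorem applies on every half-line. *)
Lemma weak_deriv_ae f v : is_weak_deriv f v -> continuous f ->
  {ae leb, forall x, is_derive x (1:R) f (v x)}.
Proof.
move=> wf cf; have [_ lv _] := wf.
have H (N : nat) : {ae leb, forall x : R, - N%:R < x -> is_derive x (1:R) f (v x)}.
  have iv y : leb.-integrable [set` Interval (BRight (- N%:R)) (BRight y)] (EFin \o v).
    apply: (integrableS _ _ _ (locally_integrable_itv (- N%:R) y lv)) => //.
    by apply: subset_itvr; rewrite bnd_simp.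
  apply: ae_mono (FTC1 iv lv) => x Hx Nx.
  have {Hx} [|dF eF] := Hx; first by rewrite lte_fin.
  apply: (@near_eq_is_derive R R R (fun y : R => f (- N%:R) +
    \int[leb]_(t in [set` Interval (BRight (- N%:R)) (BRight y)]) v t)).
    near=> y; rewrite -(weak_deriv_ftc wf cf) ?subrKC//.
    by apply: ltW; near: y; exact: lt_nbhsr.
  apply: is_derive_eq; first apply: is_deriveD.
    by move/derivableP : dF; exact.
  by rewrite add0r -derive1E eF.
apply: ae_mono (ae_foralln H) => x Hx.
apply: (Hx (Num.truncn `|x|).+1).
rewrite ltrNl (le_lt_trans _ (truncnS_gt _))// (le_trans (ler_norm _))// normrN//.
Unshelve. all: by end_near. Qed.

(** Two weak derivatives of a continuous function agree almost everywhere,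
    both being its pointwise derivative. Square integrability therefore passes
    from the witness of in_H1 to the chosen representative wderiv. *)
Lemma in_H1_slice f : continuous f -> in_H1 f -> slice f (wderiv f).
Proof.
move=> cf [f2 [g g2 wg]].
have wd : is_weak_deriv f (wderiv f).
  rewrite /wderiv; case: xgetP => [h -> //|/(_ g)]; exact.
split => //; first exact: Lfun2_integrable_sqr.
have ig := Lfun2_integrable_sqr g2.
have [_ [mg _ _] _] := wg.
have mv := weak_deriv_measurable wd.
apply/integrableP; split.
  by apply/measurable_EFinP; exact: measurable_funX.
rewrite (_ : (\int[leb]_x _ = \int[leb]_x `|(g x ^+ 2)%:E|)%E).
  by move/integrableP: ig => [].
apply: ae_eq_integral => //.
- by apply: measurableT_comp => //; apply/measurable_EFinP; exact: measurable_funX.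
- by apply: measurableT_comp => //; apply/measurable_EFinP; exact: measurable_funX.
apply: ae_mono2 (weak_deriv_ae wd cf) (weak_deriv_ae wg cf) => x [_ d1] [_ d2] _.
by rewrite /= -d1 d2.
Qed.

Lemma H1norm_sqr f : slice f (wderiv f) ->
  H1norm f ^+ 2 = \int[leb]_x (f x ^+ 2) + \int[leb]_x (wderiv f x ^+ 2).
Proof.
move=> _; rewrite /H1norm sqr_sqrtr// addr_ge0//; apply: Rintegral_ge0 => x _;
  exact: sqr_ge0.
Qed.

Definition diffq (h : R) f (x : R) : R := (f (x + h) - f x) / h.

Definition strip (h : R) : set (T * T) :=
  [set p | (p.1 <= p.2) && (p.2 <= p.1 + h)].

Lemma strip_measurable h : measurable (strip h).
Proof.
have m1 : measurable_fun (setT : set (T * T)) (fun p : T * T => p.1 <= p.2).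
  by apply: measurable_fun_ler.
have m2 : measurable_fun (setT : set (T * T)) (fun p : T * T => p.2 <= p.1 + h).
  by apply: measurable_fun_ler => //; exact: measurable_funD.
have := measurable_and m1 m2 measurableT (Y := [set true]) I.
by rewrite setTI.
Qed.

Lemma integral_strip (g : R -> R) h x :
  (\int[leb]_(y in `[x, (x + h)%R]) (g y)%:E =
   \int[leb]_y (g y * \1_(strip h) (x, y))%:E)%E.
Proof.
rewrite [LHS]integral_mkcond; apply: eq_integral => y _.
rewrite patchE indicE (_ : (y \in `[x, (x + h)%R]%classic) = ((x, y) \in strip h)).
  by case: ifP => _; rewrite ?mulr1 ?mulr0.
by rewrite mem_setE in_itv /=; apply/idP/idP => [H|]; rewrite inE.
Qed.

Lemma strip_integrand_measurable (g : R -> R) h : measurable_fun setT g ->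
  measurable_fun (setT : set (T * T)) (fun p : T * T => (g p.2 * \1_(strip h) p)%:E).
Proof.
move=> mg; apply/measurable_EFinP; apply: measurable_funM.
  exact: measurableT_comp.
by apply: measurable_indic; exact: strip_measurable.
Qed.

Lemma integral_strip_measurable (g : R -> R) h : measurable_fun setT g ->
  (forall x, 0 <= g x) ->
  measurable_fun (setT : set T) (fun x => (\int[leb]_(y in `[x, (x + h)%R]) (g y)%:E)%E).
Proof.
move=> mg g0; under eq_fun do rewrite integral_strip.
apply: (@measurable_fun_fubini_tonelli_F _ _ T T R leb
  (fun p : T * T => (g p.2 * \1_(strip h) p)%:E)).
  exact: strip_integrand_measurable.
by move=> p; rewrite lee_fin mulr_ge0.
Qed.

(** The integrals are exchanged over the strip x <= y <= x + h. Averaging then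
    falls on the weight psi, which moves by at most L * h. *)
Lemma avg_tonelli (psi g : R -> R) (L h : R) : 0 < h ->
  measurable_fun setT g -> (forall x, 0 <= g x) ->
  continuous psi -> (forall x, 0 <= psi x) ->
  (forall x y, `|psi x - psi y| <= L * `|x - y|) ->
  (\int[leb]_x ((psi x)%:E * (h^-1%:E * \int[leb]_(y in `[x, (x + h)%R]) (g y)%:E))
   <= \int[leb]_y ((psi y + L * h) * g y)%:E)%E.
Proof.
move=> h0 mg g0 cp p0 pL.
have L0 : 0 <= L.
  have := pL 1 0; rewrite subr0 normr1 mulr1; exact: le_trans (normr_ge0 _).
have hV : 0 <= h^-1 by rewrite invr_ge0 ltW.
pose D := strip h; have mD : measurable D := strip_measurable h.
pose k (p : T * T) : \bar R := (psi p.1 * h^-1 * (g p.2 * \1_D p))%:E.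
have mk : measurable_fun (setT : set (T * T)) k.
  apply/measurable_EFinP; apply: measurable_funM.
    apply: measurable_funM => //; apply: measurableT_comp => //.
    exact: continuous_measurable_fun.
  apply: measurable_funM; first exact: measurableT_comp.
  exact: measurable_indic.
have k0 p : (0 <= k p)%E.
  by rewrite lee_fin !mulr_ge0.
rewrite [leLHS](_ : _ = \int[leb]_x \int[leb]_y k (x, y))%E; last first.
  apply: eq_integral => x _.
  have ms := @measurable_fun_pair2 _ _ _ T T _ _ x (strip_integrand_measurable h mg).
  have s0 y : (0 <= (g y * \1_(strip h) (x, y))%:E)%E by rewrite lee_fin mulr_ge0.
  rewrite integral_strip.
  rewrite -(ge0_integralZl _ measurableT ms) ?lee_fin//.
  rewrite -(ge0_integralZl _ measurableT (measurable_funeM _ ms)) ?lee_fin//; last first.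
    by move=> y _; rewrite mule_ge0.
  by apply: eq_integral => y _; rewrite /k /= -!EFinM mulrA.
rewrite (fubini_tonelli k mk k0).
apply: ge0_le_integral => //.
- by move=> y _; exact: integral_ge0.
- exact: measurable_fun_fubini_tonelli_G.
- apply/measurable_EFinP; apply: measurable_funM => //.
  by apply: measurable_funD => //; exact: continuous_measurable_fun.
move=> y _.
have c0 : 0 <= (psi y + L * h) * h^-1 * g y.
  by rewrite !mulr_ge0// addr_ge0// mulr_ge0// ltW.
apply: (@le_trans _ _ (\int[leb]_(x in `[(y - h)%R, y]) ((psi y + L * h) * h^-1 * g y)%:E)%E).
  rewrite [leRHS]integral_mkcond; apply: ge0_le_integral => //.
  - by apply: (@measurable_fun_pair1 _ _ _ T T).
  - by apply/(measurable_restrictT _ _).1.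
  move=> x _; rewrite /k patchE /= indicE.
  have -> : ((x, y) \in D) = (x \in `[(y - h)%R, y]%classic).
    rewrite [in RHS]mem_setE [in RHS]in_itv /=; apply/idP/idP; rewrite inE /D /strip /= => /andP[h1 h2];
      apply/andP; split; lra.
  case: ifPn => h1; last by rewrite !mulr0.
  rewrite mulr1 lee_fin ler_wpM2r// ler_wpM2r//.
  have := pL x y; move: h1; rewrite inE /= in_itv /= => /andP[h1 h2].
  rewrite ler_norml => /andP[_]; rewrite lerBlDr addrC => /le_trans; apply.
  rewrite lerD2l ler_wpM2l// ler_norml; apply/andP; split; lra.
rewrite integral_cst//= lebesgue_measure_itv /= lte_fin ltrBlDr ltrDl h0.
rewrite -EFinD -EFinM lee_fin opprB subrKC//.
rewrite -!mulrA [g y * h]mulrC [h^-1 * _]mulrA mulVf ?mul1r// gt_eqF//.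
Qed.

Lemma continuous_shift f a : continuous f -> continuous (fun x => f (x + a)).
Proof.
move=> cf x; apply: (@continuous_comp _ _ _ (fun y : R => y + a) f x).
  by apply: cvgD; [exact: cvg_id|exact: cvg_cst].
exact: cf.
Qed.

Lemma diffq_continuous f h : continuous f -> continuous (diffq h f).
Proof.
move=> cf x; apply: cvgMl; apply: cvgB; last exact: cf.
exact: (@continuous_shift f h cf x).
Qed.

Lemma slice_integral f v x h : 0 < h -> is_weak_deriv f v -> continuous f ->
  leb.-integrable `[x, x + h] (EFin \o v) /\
  \int[leb]_(y in `[x, x + h]) v y = f (x + h) - f x.
Proof.
move=> h0 wf cf; have [_ lv _] := wf.
have iv := locally_integrable_itv x (x + h) lv; split => //.
rewrite (weak_deriv_ftc wf cf) ?lerDl ?ltW//.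
rewrite -Rintegral_itv_obnd_cbnd//.
by apply: integrableS iv => //; apply: subset_itvr; rewrite bnd_simp.
Qed.

Lemma Rintegral_itv_cst x h (c : R) : 0 < h ->
  \int[leb]_(y in `[x, x + h]) c = c * h.
Proof.
move=> h0; rewrite Rintegral_cst//= lebesgue_measure_itv /= lte_fin ltrDl h0.
by rewrite -EFinD addrAC subrr add0r.
Qed.

Lemma integrable_itv_cst x h (c : R) :
  leb.-integrable `[x, x + h] (EFin \o (fun=> c)).
Proof.
apply: measurable_bounded_integrable => //.
  by apply: compact_finite_measure; exact: segment_compact.
by exists `|c|; split; [exact: num_real|move=> y cy z _; exact: ltW].
Qed.

(** Jensen inequality: diffq h f x is the mean of v over [x, x + h], and an
    affine minorant of beta at that mean integrates exactly. *)
Lemma jensen_avg f v (beta : R -> R) (d h x : R) : 0 < h ->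
  is_weak_deriv f v -> continuous f -> measurable_fun setT beta ->
  (forall s, 0 <= beta s) ->
  (forall s, beta (diffq h f x) + d * (s - diffq h f x) <= beta s) ->
  ((beta (diffq h f x))%:E <=
    h^-1%:E * \int[leb]_(y in `[x, (x + h)%R]) (beta (v y))%:E)%E.
Proof.
move=> h0 wf cf mb b0 bd; have [iv Iv] := slice_integral x h0 wf cf.
have mv := weak_deriv_measurable wf.
have mI : measurable (`[x, x + h]%classic : set T) by exact: measurable_itv.
have mbv : measurable_fun setT (fun y => beta (v y)) by exact: measurableT_comp.
set q := diffq h f x in bd *.
have [Ify|Ify] := ltP (\int[leb]_(y in `[x, (x + h)%R]) (beta (v y))%:E)%E +oo%E; last first.
  move: Ify; rewrite leye_eq => /eqP ->.
  by rewrite gt0_muley ?leey// lte_fin invr_gt0.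
have ib : leb.-integrable `[x, x + h] (EFin \o (fun y => beta (v y))).
  apply/integrableP; split; first by apply/measurable_EFinP; exact: measurable_funTS.
  by under eq_integral do rewrite /= ger0_norm//.
rewrite -(fineK (integrable_fin_num _ ib))// -EFinM lee_fin.
rewrite mulrC ler_pdivlMr//.
have i1 := integrable_itv_cst x h (beta q).
have i2 := integrable_itv_cst x h q.
have i3 := integrable_scale d mI (integrable_sub mI iv i2).
have -> : beta q * h = \int[leb]_(y in `[x, x + h]) (beta q + d * (v y - q)).
  rewrite (RintegralD mI i1 i3) Rintegral_itv_cst//.
  rewrite (RintegralZl _ mI (integrable_sub mI iv i2)) (RintegralB mI iv i2).
  rewrite Iv Rintegral_itv_cst// {3}/q /diffq divfK ?gt_eqF// subrr mulr0 addr0//.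
apply: le_Rintegral => //; first exact: (integrable_add mI i1 i3).
Qed.

(** Convex energies of difference quotients are controlled by the energy of
    the weak derivative, up to an error L * h coming from the weight. *)
Lemma slice_avg f v (beta dbeta psi : R -> R) (L h : R) : 0 < h ->
  is_weak_deriv f v -> continuous f -> measurable_fun setT beta ->
  (forall s, 0 <= beta s) ->
  (forall c s, beta c + dbeta c * (s - c) <= beta s) ->
  continuous psi -> (forall x, 0 <= psi x) ->
  (forall x y, `|psi x - psi y| <= L * `|x - y|) ->
  (\int[leb]_x (psi x * beta (diffq h f x))%:E
   <= \int[leb]_y ((psi y + L * h) * beta (v y))%:E)%E.
Proof.
move=> h0 wf cf mb b0 bd cp p0 pL.
have mv := weak_deriv_measurable wf.
have mbv : measurable_fun setT (fun y => beta (v y)) by exact: measurableT_comp.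
apply: le_trans (avg_tonelli h0 mbv _ cp p0 pL) => //.
apply: ge0_le_integral => //.
- by move=> x _; rewrite lee_fin mulr_ge0.
- apply/measurable_EFinP; apply: measurable_funM.
    exact: continuous_measurable_fun.
  apply: measurableT_comp => //; apply: continuous_measurable_fun.
  exact: diffq_continuous.
- apply: emeasurable_funM.
    by apply/measurable_EFinP; exact: continuous_measurable_fun.
  by apply: measurable_funeM; exact: integral_strip_measurable.
- move=> x _; rewrite EFinM lee_pmul// ?lee_fin//.
  exact: (jensen_avg h0 wf cf mb b0 (bd _)).
Qed.

End Slices.

(** * The nonlocal potential *)

Section LiminfTools.
Context {R : realType}.

Lemma limn_einf_le (a c : (\bar R)^nat) (l : \bar R) :
  (forall n, (a n <= c n)%E) -> c n @[n --> \oo] --> l -> (limn_einf a <= l)%E.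
Proof.
move=> ac cl; rewrite limn_einf_lim -(cvg_lim _ cl)//.
apply: lee_lim; [exact: is_cvg_einfs|by apply/cvg_ex; exists l|].
apply: nearW => n; apply: le_trans (ac n).
by apply: ereal_inf_lbound; exists n => //=.
Qed.

Lemma limn_esup_le (a c : (\bar R)^nat) (l : \bar R) :
  (forall n m, (n <= m)%N -> (a m <= c n)%E) -> c n @[n --> \oo] --> l ->
  (limn_esup a <= l)%E.
Proof.
move=> ac cl; rewrite limn_esup_lim -(cvg_lim _ cl)//.
apply: lee_lim; [exact: is_cvg_esups|by apply/cvg_ex; exists l|].
apply: nearW => n; apply: ge_ereal_sup => _ [m /= nm <-]; exact: ac.
Qed.

Lemma fatou_ae d (T : measurableType d) (mu : {measure set T -> \bar R})
    (f_ : nat -> T -> R) (f : T -> R) :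
  (forall n, measurable_fun setT (f_ n)) -> measurable_fun setT f ->
  (forall n x, 0 <= f_ n x) ->
  {ae mu, forall x, f_ n x @[n --> \oo] --> f x} ->
  (\int[mu]_x (f x)%:E <= limn_einf (fun n => \int[mu]_x (f_ n x)%:E))%E.
Proof.
move=> mf_ mf f_0 cf.
have mF n : measurable_fun setT (fun x => (f_ n x)%:E) by exact/measurable_EFinP.
have := fatou mu measurableT mF (fun n x _ => f_0 n x).
apply: le_trans.
rewrite le_eqVlt; apply/orP; left; apply/eqP.
apply: ae_eq_integral => //.
- exact/measurable_EFinP.
- rewrite (_ : (fun x => limn_einf _) =
      (fun x => - limn_esup (fun n => - (f_ n x)%:E))%E).
    apply: measurableT_comp => //; apply: measurable_fun_limn_esup => n.
    exact: measurableT_comp.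
  by apply/funext => x; rewrite (limn_esupN (fun n => (f_ n x)%:E)) oppeK.
apply: filterS cf => x cx _.
have : (f_ n x)%:E @[n --> \oo] --> (f x)%:E.
  by apply: cvg_EFin; [exact: nearW|exact: cx].
by move=> /cvg_limn_einf_sup[-> _].
Qed.

End LiminfTools.

Section Potential.
Context {R : realType}.
Local Notation leb := (@lebesgue_measure R).
Local Notation T := (measurableTypeR R).
Implicit Types f v : R -> R.

Definition density f v (y : R) : R := f y ^+ 2 + v y ^+ 2 / 2.

Definition kernel (z : R) : R := expR (- `|z|).

(** For f = u t and v = wderiv (u t) this is convertible to CH_P u t. *)
Definition potential f v (x : R) : R :=
  2^-1 * \int[leb]_y (kernel (x - y) * density f v y).

Definition mass f v : R := \int[leb]_y density f v y.

Lemma density_ge0 f v y : 0 <= density f v y.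
Proof. by rewrite addr_ge0 ?divr_ge0 ?sqr_ge0. Qed.

Lemma density_integrable f v : slice f v ->
  leb.-integrable setT (EFin \o density f v).
Proof.
move=> [_ _ i1 i2]; apply: integrable_add => //.
have := integrable_scale 2^-1 measurableT i2; apply: eq_integrable => // x _ /=.
by rewrite mulrC.
Qed.

Lemma density_measurable f v : slice f v -> measurable_fun setT (density f v).
Proof. by move=> /density_integrable/measurable_int/measurable_EFinP. Qed.

Lemma mass_ge0 f v : 0 <= mass f v.
Proof. by apply: Rintegral_ge0 => x _; exact: density_ge0. Qed.

Lemma massE f v : slice f v -> (\int[leb]_y (density f v y)%:E = (mass f v)%:E)%E.
Proof.
by move=> /density_integrable i; rewrite /mass /Rintegral fineK//; exact: integrable_fin_num i.
Qed.

Lemma kernel_ge0 z : 0 <= kernel z. Proof. exact: expR_ge0. Qed.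
Lemma kernel_le1 z : kernel z <= 1.
Proof. by rewrite /kernel expR_le1 oppr_le0. Qed.

Lemma expRN_lip (a b : R) : 0 <= a -> a <= b -> expR (- a) - expR (- b) <= b - a.
Proof.
move=> a0 ab; have -> : expR (- b) = expR (- a) * expR (a - b).
  by rewrite -expRD; congr expR; ring.
have := expR_ge1Dx (a - b); have := expR_gt0 (- a).
have : expR (- a) <= 1 by rewrite expR_le1 oppr_le0.
nra.
Qed.

Lemma kernel_lip z w : `|kernel z - kernel w| <= `|z - w|.
Proof.
wlog zw : z w / `|z| <= `|w|.
  by move=> H; have [/H//|/ltW/H] := leP `|z| `|w|; rewrite distrC [X in _ <= X]distrC.
rewrite ger0_norm; last by rewrite subr_ge0 ler_expR lerN2.
apply: le_trans (expRN_lip (normr_ge0 _) zw) _.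
by rewrite distrC; exact: lerB_dist.
Qed.

(** The kernel is convex on each side of its corner at 0, so away from the
    corner the left side is nonpositive; within distance h of it the Lipschitz
    bound gives 2 * h. *)
Lemma kernel_second_difference z h : 0 < h ->
  - (kernel (z + h) - 2 * kernel z + kernel (z - h)) <=
  (2 * h) * \1_(`[- h, h]%classic) z.
Proof.
move=> h0; rewrite indicE mem_setE in_itv /=.
case: (boolP ((- h <= z) && (z <= h))) => hz.
  rewrite mulr1.
  have := kernel_lip z (z + h); have := kernel_lip z (z - h).
  have -> : z - (z + h) = - h by ring.
  have -> : z - (z - h) = h by ring.
  rewrite normrN (gtr0_norm h0) !ler_norml => /andP[_ h1] /andP[_ h2]; lra.
rewrite mulr0.
have ch (a : R) : 2 <= expR a + expR (- a).
  have := expR_gt0 a; have e0 := expRxMexpNx_1 a; have := expR_gt0 (- a).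
  have := sqr_ge0 (expR a - 1); nra.
(* both sides are even in z; far from 0 the claim is 2 <= exp h + exp (-h) *)
wlog zp : z hz / 0 <= z.
  move=> H; have [z0|z0] := leP 0 z; first exact: H.
  have := H (- z); rewrite /kernel.
  have -> : - z + h = - (z - h) by ring.
  have -> : - z - h = - (z + h) by ring.
  rewrite !normrN => H2.
  suff : - (expR (- `|z - h|) - 2 * expR (- `|z|) + expR (- `|z + h|)) <= 0 by lra.
  apply: H2; last lra.
  by apply: contra hz => /andP[h1 h2]; apply/andP; split; lra.
have zh : h < z by rewrite ltNge; apply: contra hz => zh; apply/andP; split; lra.
rewrite /kernel !ger0_norm//; [|lra|lra].
have -> : - (z + h) = - z + - h by ring.
have -> : - (z - h) = - z + h by ring.
rewrite !expRD; have := ch h; have := expR_gt0 (- z); nra.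
Qed.

Lemma lipschitz_continuous (f : R -> R) (L : R) :
  (forall x y, `|f x - f y| <= L * `|x - y|) -> continuous f.
Proof.
move=> fL x; apply/cvgrPdist_le => e e0.
have L0 : 0 < `|L| + 1 by rewrite ltr_wpDl.
near=> y; apply: le_trans (fL _ _) _.
have : `|x - y| <= e / (`|L| + 1).
  by near: y; apply: cvgr_dist_le => //; rewrite divr_gt0.
rewrite ler_pdivlMr// => h; apply: le_trans h.
by rewrite mulrC ler_wpM2l// (le_trans (ler_norm _))// lerDl.
Unshelve. all: by end_near. Qed.

Lemma kernel_continuous x : continuous (fun y => kernel (x - y)).
Proof.
apply: (@lipschitz_continuous _ 1) => y z; rewrite mul1r.
apply: le_trans (kernel_lip _ _) _.
have -> : x - y - (x - z) = z - y by ring.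
by rewrite distrC.
Qed.

Lemma potential_integrable f v x : slice f v ->
  leb.-integrable setT (EFin \o (fun y => kernel (x - y) * density f v y)).
Proof.
move=> sl; apply: integrable_dominated (density_integrable sl) => //.
  apply: measurable_funM; last exact: density_measurable.
  apply: continuous_measurable_fun; exact: kernel_continuous.
move=> y _; rewrite normrM !ger0_norm ?kernel_ge0 ?density_ge0//.
by rewrite ler_piMl ?density_ge0 ?kernel_le1.
Qed.

Lemma potential_ge0 f v x : 0 <= potential f v x.
Proof.
rewrite mulr_ge0//; apply: Rintegral_ge0 => y _.
by rewrite mulr_ge0 ?density_ge0// expR_ge0.
Qed.

Lemma potential_le f v x : slice f v -> potential f v x <= mass f v.
Proof.
move=> sl; apply: (@le_trans _ _ (2^-1 * mass f v)).
  rewrite ler_wpM2l//; apply: le_Rintegral => //.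
  - exact: potential_integrable.
  - exact: density_integrable.
  by move=> y _; rewrite ler_piMl ?density_ge0 ?kernel_le1.
by have := mass_ge0 f v; lra.
Qed.

Lemma potential_lip f v x y : slice f v ->
  `|potential f v x - potential f v y| <= mass f v * `|x - y|.
Proof.
move=> sl; have i1 := potential_integrable x sl; have i2 := potential_integrable y sl.
have i3 := density_integrable sl.
rewrite /potential -mulrBr -(RintegralB measurableT i1 i2) normrM ger0_norm//.
apply: (@le_trans _ _ (2^-1 * (mass f v * `|x - y|))); last first.
  by have := mulr_ge0 (mass_ge0 f v) (normr_ge0 (x - y)); lra.
rewrite ler_wpM2l//.
apply: le_trans (le_normr_Rintegral measurableT (integrable_sub measurableT i1 i2)) _.
rewrite mulrC /mass -(RintegralZl _ measurableT i3).
apply: le_Rintegral => //.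
- exact: integrable_norm (integrable_sub measurableT i1 i2).
- exact: integrable_scale.
move=> z _; rewrite -mulrBl normrM [X in _ * X]ger0_norm ?density_ge0//.
rewrite ler_wpM2r ?density_ge0//.
have := kernel_lip (x - z) (y - z).
by have -> : x - z - (y - z) = x - y by ring.
Qed.

Lemma potential_continuous f v : slice f v -> continuous (potential f v).
Proof.
by move=> sl; apply: (@lipschitz_continuous _ (mass f v)) => x y; exact: potential_lip.
Qed.

(** Only the points y at distance at most h from x + h feel the corner of the
    kernel. *)
Lemma potential_second_difference f v x h : slice f v -> 0 < h ->
  - (potential f v (x + 2 * h) - 2 * potential f v (x + h) + potential f v x) <=
  h * \int[leb]_(y in `[x, x + 2 * h]) density f v y.
Proof.
move=> sl h0.
have i1 := potential_integrable (x + 2 * h) sl.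
have i2 := potential_integrable (x + h) sl.
have i3 := potential_integrable x sl.
have i0 := density_integrable sl.
have j2 := integrable_scale 2 measurableT i2.
have j12 := integrable_sub measurableT i1 j2.
have j := integrable_add measurableT j12 i3.
have jN := integrable_scale (- 1) measurableT j.
have k0 : leb.-integrable setT (EFin \o (fun y => density f v y * \1_(`[x, x + 2 * h]%classic) y)).
  by apply: integrable_indic_mul => //; apply: integrableS i0.
have -> : - (potential f v (x + 2 * h) - 2 * potential f v (x + h) + potential f v x) =
   2^-1 * \int[leb]_y (-1 * (kernel (x + 2 * h - y) * density f v y -
      2 * (kernel (x + h - y) * density f v y) + kernel (x - y) * density f v y)).
  rewrite (RintegralZl _ measurableT j) (RintegralD measurableT j12 i3).
  rewrite (RintegralB measurableT i1 j2) (RintegralZl _ measurableT i2).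
  rewrite /potential.
  move: (\int[leb]_y (kernel (x + 2 * h - y) * density f v y)) => A1.
  move: (\int[leb]_y (kernel (x + h - y) * density f v y)) => A2.
  by move: (\int[leb]_y (kernel (x - y) * density f v y)) => A3; ring.
rewrite -[X in _ <= _ * X]Rintegral_indic.
have E Y : h * Y = 2^-1 * ((2 * h) * Y) by rewrite -mulrA mulKf// pnatr_eq0.
rewrite E ler_wpM2l//.
rewrite -(RintegralZl _ measurableT k0).
apply: (le_Rintegral measurableT jN (integrable_scale (2 * h) measurableT k0)).
move=> y _.
have := kernel_second_difference (x + h - y) h0.
have -> : x + h - y + h = x + 2 * h - y by ring.
have -> : x + h - y - h = x - y by ring.
have -> : \1_(`[- h, h]%classic) (x + h - y) = \1_(`[x, x + 2 * h]%classic) y :> R.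
  rewrite !indicE; congr (_%:R); congr nat_of_bool.
  rewrite !mem_setE !in_itv /=; apply/idP/idP => /andP[h1 h2]; apply/andP; split; lra.
move=> H; have := ler_wpM2r (density_ge0 f v y) H.
set k1 := kernel _; set k2 := kernel _; set k3 := kernel _; set I := \1_ _ _.
move=> H2; apply: le_trans (le_trans H2 _).
  by rewrite le_eqVlt; apply/orP; left; apply/eqP; ring.
by rewrite -[X in X <= _]mulrA [I * _]mulrC.
Qed.

End Potential.

(** * Estimates on slices, and measurability in space-time *)

Section SliceBounds.
Context {R : realType}.
Local Notation leb := (@lebesgue_measure R).
Local Notation T := (measurableTypeR R).
Implicit Types f v : R -> R.

Lemma sqr_subgradient (c s : R) : c ^+ 2 + 2 * c * (s - c) <= s ^+ 2.
Proof. by have := sqr_ge0 (s - c); nra. Qed.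

(** Convex and continuously differentiable; at the slope of u this is the
    quantity that pos_energy weighs by phi. *)
Definition pospart_sqr (s : R) : R := Num.max s 0 ^+ 2.

Lemma pospart_sqr_ge0 s : 0 <= pospart_sqr s. Proof. exact: sqr_ge0. Qed.

Lemma pospart_sqr_subgradient (c s : R) :
  pospart_sqr c + 2 * Num.max c 0 * (s - c) <= pospart_sqr s.
Proof.
rewrite /pospart_sqr; case: (leP c 0) => hc.
  by rewrite mulr0 mul0r expr0n /= add0r sqr_ge0.
case: (leP s 0) => hs; last exact: sqr_subgradient.
have := mulr_ge0_le0 (ltW hc) hs; have := sqr_ge0 c; rewrite expr0n /=; nra.
Qed.

Lemma slice_measurable f v : slice f v -> measurable_fun setT f.
Proof. by case=> cf _ _ _; exact: continuous_measurable_fun. Qed.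

Lemma diffq_measurable f h : continuous f -> measurable_fun setT (diffq h f).
Proof. by move=> cf; apply: continuous_measurable_fun; exact: diffq_continuous. Qed.

Lemma diffq_sqr_integral f v h : slice f v -> 0 < h ->
  leb.-integrable setT (EFin \o (fun x => diffq h f x ^+ 2)) /\
  \int[leb]_x (diffq h f x ^+ 2) <= \int[leb]_x (v x ^+ 2).
Proof.
move=> [cf wf _ iv] h0.
have msq : measurable_fun setT (fun s : R => s ^+ 2) by exact: measurable_funX.
have c1 : continuous (cst 1 : R -> R) by exact: cst_continuous.
have l1 (x y : R) : `|cst (1:R) x - cst 1 y| <= 0 * `|x - y|.
  by rewrite subrr normr0 mul0r.
have H : (\int[leb]_x (diffq h f x ^+ 2)%:E <= \int[leb]_x (v x ^+ 2)%:E)%E.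
  have := @slice_avg R f v (fun s => s ^+ 2) (fun c => 2 * c) (cst 1) 0 h h0 wf cf
    msq (fun s => sqr_ge0 s) sqr_subgradient c1 (fun x => ler01) l1.
  rewrite /cst; under eq_integral do rewrite mul1r.
  by under [X in (_ <= X)%E]eq_integral do rewrite mul0r addr0 mul1r.
have iq : leb.-integrable setT (EFin \o (fun x => diffq h f x ^+ 2)).
  apply/integrableP; split.
    by apply/measurable_EFinP; apply: measurable_funX; exact: diffq_measurable.
  under eq_integral do rewrite /= ger0_norm ?sqr_ge0//.
  apply: le_lt_trans H _.
  by move: iv => /(integrable_fin_num measurableT); rewrite ge0_fin_numE//; apply: integral_ge0 => x _; rewrite lee_fin sqr_ge0.
split => //; apply: fine_le => //.
- exact: integrable_fin_num iq.
- exact: integrable_fin_num iv.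
Qed.

Lemma derive_expansion f x (l e : R) : is_derive x (1:R) f l -> 0 < e ->
  exists2 d, 0 < d & forall s, 0 <= s -> s < d -> `|f (x + s) - f x - s * l| <= e * s.
Proof.
move=> [dx ex] e0.
have : h^-1 *: ((f \o shift x) (h *: (1:R)) - f x) @[h --> 0^'] --> l.
  by rewrite -ex; exact: dx.
move=> /cvgrPdist_le/(_ e e0); rewrite near_withinE => /nbhs_ballP[d /= d0 Hd].
exists d => // s; rewrite le_eqVlt => /predU1P[<- _|s0 sd].
  by rewrite addr0 subrr mul0r subr0 normr0 mulr0.
have := Hd s; rewrite -ball_normE /= sub0r normrN gtr0_norm// => /(_ sd).
move=> /(_ (lt0r_neq0 s0)); rewrite /GRing.scale /= mulr1 [s + x]addrC.
have -> : l - s^-1 * (f (x + s) - f x) = - (f (x + s) - f x - s * l) / s.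
  by field; rewrite gt_eqF.
by rewrite normrM normrN normfV (gtr0_norm s0) ler_pdivrMr.
Qed.

Lemma diffq_cvg f x (l : R) : is_derive x (1:R) f l ->
  diffq n.+1%:R^-1 f x @[n --> \oo] --> l.
Proof.
move=> dx; apply/cvgrPdist_le => e e0.
have [d d0 Hd] := derive_expansion dx e0.
near=> n.
have nd : n.+1%:R^-1 < d by near: n; exact: near_infty_natSinv_lt (PosNum d0).
have n0 : 0 < n.+1%:R^-1 :> R by rewrite invr_gt0.
have := Hd _ (ltW n0) nd; set s := n.+1%:R^-1 in n0 *.
have -> : l - diffq s f x = - ((f (x + s) - f x - s * l) / s).
  by rewrite /diffq; field; rewrite gt_eqF.
by rewrite normrN normrM normfV (gtr0_norm n0) ler_pdivrMr.
Unshelve. all: by end_near. Qed.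

Lemma diffq_cvg_ae f v : slice f v ->
  {ae leb, forall x, diffq n.+1%:R^-1 f x @[n --> \oo] --> v x}.
Proof.
by move=> [cf wf _ _]; apply: ae_mono (weak_deriv_ae wf cf) => x; exact: diffq_cvg.
Qed.

(** A difference quotient is a mean of v, so a bound on v almost everywhere
    becomes a bound everywhere. *)
Lemma diffq_le f v (K : R) x h : slice f v -> 0 < h ->
  {ae leb, forall x, v x <= K} -> diffq h f x <= K.
Proof.
move=> [cf wf _ _] h0 vK.
have [iv Iv] := slice_integral x h0 wf cf.
rewrite /diffq ler_pdivrMr// -Iv -(Rintegral_itv_cst x K h0) -subr_ge0.
have mI : measurable (`[x, x + h]%classic : set T) by exact: measurable_itv.
have ic := integrable_itv_cst x h K.
have ib := integrable_sub mI ic iv.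
rewrite -(RintegralB mI ic iv) /Rintegral.
rewrite (@ae_eq_integral _ T R leb _ (fun y => (`|K - v y|)%:E) (fun y => (K - v y)%:E))//.
- by apply: fine_ge0; apply: integral_ge0 => y _; rewrite lee_fin.
- exact: (measurable_int leb ib).
- exact: (measurable_int leb (integrable_norm ib)).
apply: ae_mono vK => y vy _.
by rewrite ger0_norm// subr_ge0.
Qed.

Lemma second_difference_bound (a b c m : R) : a <= m -> b <= m -> c <= m ->
  0 <= a -> 0 <= b -> 0 <= c -> `|a - 2 * b + c| <= 4 * m.
Proof. by move=> *; rewrite ler_norml; apply/andP; split; lra. Qed.

(** Integration in x compensates the factor 1/h: divided by h^2, the right
    side is 2 * A * mass f v, uniformly in h. *)
Lemma potential_weighted f v (a : R -> R) (A c d h : R) : slice f v -> 0 < h ->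
  measurable_fun setT a -> (forall x, 0 <= a x <= A) ->
  \int[leb]_(x in `[c, d]) (a x * - (potential f v (x + 2 * h)
     - 2 * potential f v (x + h) + potential f v x)) <=
  A * (h * (2 * h * mass f v)).
Proof.
move=> sl h0 ma aA.
have h20 : 0 < 2 * h by rewrite mulr_gt0.
have A0 : 0 <= A by have /andP[] := aA 0; exact: le_trans.
have cp := potential_continuous sl.
pose D2 x := potential f v (x + 2 * h) - 2 * potential f v (x + h) + potential f v x.
have mD2 : measurable_fun setT D2.
  apply: continuous_measurable_fun => x; apply: cvgD; last exact: cp.
  apply: cvgB; first exact: (@continuous_shift R _ (2 * h) cp x).
  by apply: cvgMr; exact: (@continuous_shift R _ h cp x).
have D2b x : `|D2 x| <= 4 * mass f v.
  rewrite /D2; have p1 := potential_le (x + 2 * h) sl; have p2 := potential_le (x + h) sl.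
  have p3 := potential_le x sl; have q1 := potential_ge0 f v (x + 2 * h).
  have q2 := potential_ge0 f v (x + h); have q3 := potential_ge0 f v x.
  exact: second_difference_bound.
pose N x := \int[leb]_(y in `[x, x + 2 * h]) density f v y.
have iden := density_integrable sl.
have NE x : ((N x)%:E = \int[leb]_(y in `[x, (x + 2 * h)%R]) (density f v y)%:E)%E.
  by rewrite /N /Rintegral fineK//; apply: integrable_fin_num => //; exact: integrableS iden.
have N0 x : 0 <= N x by apply: Rintegral_ge0 => y _; exact: density_ge0.
have mN : measurable_fun setT N.
  apply/measurable_EFinP; rewrite (_ : EFin \o N = (fun x =>
     \int[leb]_(y in `[x, (x + 2 * h)%R]) (density f v y)%:E)%E).
    apply: integral_strip_measurable; last exact: density_ge0.
    exact: density_measurable.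
  by apply/funext => x; rewrite -NE.
have NI : (\int[leb]_x (N x)%:E <= (2 * h * mass f v)%:E)%E.
  have c1 : continuous (cst 1 : R -> R) by exact: cst_continuous.
  have l1 (x y : R) : `|cst (1:R) x - cst 1 y| <= 0 * `|x - y|.
    by rewrite subrr normr0 mul0r.
  have := avg_tonelli h20 (density_measurable sl) (density_ge0 f v) c1 (fun=> ler01) l1.
  under eq_integral do rewrite mul1e -NE -EFinM.
  under [X in (_ <= X)%E -> _]eq_integral do rewrite mul0r addr0 mul1r.
  rewrite massE// => H.
  have -> : (\int[leb]_x (N x)%:E = (2 * h)%:E * \int[leb]_x ((2 * h)^-1 * N x)%:E)%E.
    rewrite -ge0_integralZl ?lee_fin ?ltW//.
    - by apply: eq_integral => x _; rewrite -EFinM mulVKf// gt_eqF.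
    - by apply/measurable_EFinP; apply: measurable_funM.
    - by move=> x _; rewrite lee_fin mulr_ge0// invr_ge0 ltW.
  rewrite [X in (_ <= X)%E]EFinM.
  by apply: lee_wpmul2l; [rewrite lee_fin ltW|exact: H].
have iN : leb.-integrable setT (EFin \o N).
  apply/integrableP; split; first exact/measurable_EFinP.
  under eq_integral do rewrite /= ger0_norm//.
  by apply: le_lt_trans NI _; exact: ltry.
have mI : measurable (`[c, d]%classic : set T) by exact: measurable_itv.
have iN' : leb.-integrable `[c, d] (EFin \o (fun x => A * h * N x)).
  by apply: integrableS (integrable_scale (A * h) measurableT iN).
have ia : leb.-integrable `[c, d] (EFin \o (fun x => a x * - D2 x)).
  apply: measurable_bounded_integrable => //.
  - by apply: compact_finite_measure; exact: segment_compact.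
  - by apply: measurable_funTS; apply: measurable_funM => //; exact: measurableT_comp.
  exists (A * (4 * mass f v)); split; first exact: num_real.
  move=> y Ay x _; apply: le_trans (ltW Ay); rewrite normrM normrN ler_pM//.
  by have /andP[a0 aA'] := aA x; rewrite ger0_norm.
apply: le_trans (le_Rintegral mI ia iN' _) _.
  move=> x _; have /andP[a0 aA'] := aA x.
  rewrite -mulrA; apply: (@le_trans _ _ (a x * (h * N x))).
    by rewrite ler_wpM2l//; exact: potential_second_difference.
  by rewrite ler_wpM2r// mulr_ge0// ltW.
rewrite (RintegralZl _ mI); last by apply: integrableS iN.
rewrite -mulrA (ler_wpM2l A0)// (ler_wpM2l (ltW h0))//.
rewrite -lee_fin; apply: le_trans NI.
rewrite /Rintegral fineK; last by apply: integrable_fin_num => //; exact: integrableS iN.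
apply: ge0_subset_integral => //; first exact/measurable_EFinP.
by move=> x _; rewrite lee_fin.
Qed.

(** The representative wderiv is chosen separately at each time, so its
    dependence on time is not visibly measurable. Difference quotients do
    depend measurably on time, and they recover the potential: the upper bound
    comes from convexity, the lower bound from Fatou. The copy g of f allows
    for a slice of uext. *)
Lemma potential_limsup f v x (g : R -> R) : slice f v -> g = f ->
  limn_esup (fun n => \int[leb]_y
    (kernel (x - y) * density g (diffq n.+1%:R^-1 g) y)%:E)%E =
  (\int[leb]_y (kernel (x - y) * density f v y))%:E.
Proof.
move=> sl ->{g}; have [cf wf if2 iv2] := sl.
have mv := weak_deriv_measurable wf; have mf := slice_measurable sl.
have ck := @kernel_continuous R x.
have mk : measurable_fun setT (fun y : R => kernel (x - y)) by exact: continuous_measurable_fun.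
have ip := potential_integrable x sl.
have IE : ((\int[leb]_y (kernel (x - y) * density f v y))%:E =
    \int[leb]_y (kernel (x - y) * density f v y)%:E)%E.
  by rewrite /Rintegral fineK//; exact: (integrable_fin_num measurableT ip).
pose b (s : R) := s ^+ 2 / 2.
have mb : measurable_fun setT b by apply: measurable_funM => //; exact: measurable_funX.
have b0 s : 0 <= b s by rewrite divr_ge0 ?sqr_ge0.
have bs c s : b c + c * (s - c) <= b s.
  by rewrite /b; have := sqr_subgradient c s; lra.
have kl y z : `|kernel (x - y) - kernel (x - z)| <= 1 * `|y - z|.
  rewrite mul1r; have := kernel_lip (x - y) (x - z).
  have -> : x - y - (x - z) = z - y by ring.
  by rewrite (distrC z).
have ibv : leb.-integrable setT (EFin \o (fun y => b (v y))).
  have := integrable_scale 2^-1 measurableT iv2; apply: eq_integrable => // y _ /=.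
  by rewrite /b mulrC.
pose C := \int[leb]_y b (v y).
have C0 : 0 <= C by apply: Rintegral_ge0.
pose c (n : nat) : \bar R :=
  (\int[leb]_y (kernel (x - y) * density f v y) + n.+1%:R^-1 * C)%:E.
pose J (n : nat) := (\int[leb]_y
    (kernel (x - y) * density f (diffq n.+1%:R^-1 f) y)%:E)%E.
have mJ n : measurable_fun setT (fun y : R => kernel (x - y) * density f (diffq n.+1%:R^-1 f) y).
  apply: measurable_funM => //; apply: measurable_funD; first exact: measurable_funX.
  by apply: measurable_funM => //; apply: measurable_funX; exact: diffq_measurable.
have Jc n : (J n <= c n)%E.
  have h0 : 0 < n.+1%:R^-1 :> R by rewrite invr_gt0.
  have A := @slice_avg R f v b id (fun y => kernel (x - y)) 1 _ h0 wf cf mb b0 bs ck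
    (fun y => kernel_ge0 (x - y)) kl.
  have -> : J n = (\int[leb]_y (kernel (x - y) * f y ^+ 2)%:E +
      \int[leb]_y (kernel (x - y) * b (diffq n.+1%:R^-1 f y))%:E)%E.
    rewrite -ge0_integralD//.
    - by apply: eq_integral => y _; rewrite -EFinD -mulrDr.
    - by move=> y _; rewrite lee_fin mulr_ge0 ?kernel_ge0 ?sqr_ge0.
    - by apply/measurable_EFinP; apply: measurable_funM => //; exact: measurable_funX.
    - by move=> y _; rewrite lee_fin mulr_ge0 ?kernel_ge0.
    - apply/measurable_EFinP; apply: measurable_funM => //.
      by apply: (measurableT_comp mb); exact: diffq_measurable.
  apply: (@le_trans _ _ (\int[leb]_y (kernel (x - y) * f y ^+ 2)%:E +
     \int[leb]_y ((kernel (x - y) + 1 * n.+1%:R^-1) * b (v y))%:E)%E).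
    by apply: leeD.
  rewrite -ge0_integralD//; last 4 first.
  - by move=> y _; rewrite lee_fin mulr_ge0 ?kernel_ge0 ?sqr_ge0.
  - by apply/measurable_EFinP; apply: measurable_funM => //; exact: measurable_funX.
  - move=> y _; rewrite lee_fin mulr_ge0// addr_ge0 ?kernel_ge0// mul1r ltW//.
  - apply/measurable_EFinP; apply: measurable_funM; first exact: measurable_funD.
    exact: measurableT_comp.
  rewrite /c /C -(RintegralZl _ measurableT ibv).
  rewrite -(RintegralD measurableT ip (integrable_scale _ measurableT ibv)).
  rewrite /Rintegral fineK; last first.
    exact: integrable_fin_num (integrable_add measurableT ip (integrable_scale _ measurableT ibv)).
  rewrite le_eqVlt; apply/orP; left; apply/eqP; apply: eq_integral => y _.
  by rewrite -EFinD; congr EFin; rewrite /density /b mul1r; ring.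
have cn : c n @[n --> \oo] --> (\int[leb]_y (kernel (x - y) * density f v y))%:E.
  apply: cvg_EFin; first exact: nearW.
  rewrite -[X in _ --> X]addr0; apply: cvgD; first exact: cvg_cst.
  rewrite -(mul0r C); apply: cvgMl.
  exact: cvg_harmonic.
apply/eqP; rewrite eq_le; apply/andP; split.
  apply: (limn_esup_le _ cn) => n m nm; apply: le_trans (Jc m) _.
  by rewrite lee_fin lerD2l ler_wpM2r// lef_pV2 ?posrE// ler_nat.
rewrite IE; apply: le_trans (limn_einf_sup _).
apply: fatou_ae => //.
- by move: ip => /measurable_int/measurable_EFinP.
- by move=> n y; rewrite mulr_ge0 ?kernel_ge0 ?density_ge0.
apply: ae_mono (diffq_cvg_ae sl) => y qy.
apply: cvgMr; apply: cvgD; first exact: cvg_cst.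
by apply: cvgMl; apply: cvgM.
Qed.

End SliceBounds.

Section JointMeasurability.
Context {R : realType}.
Local Notation leb := (@lebesgue_measure R).
Local Notation T := (measurableTypeR R).
Variable u : R -> R -> R.
Hypothesis cu : {within [set p : R * R | 0 <= p.1],
        continuous (fun p : R * R => u p.1 p.2)}.
Hypothesis su : forall t, 0 < t -> slice (u t) (wderiv (u t)).

(** Time is stopped at 0, which extends u from t >= 0 to a function continuous
    on the whole plane. *)
Definition uext (p : R * R) : R := u (Num.max p.1 0) p.2.

Lemma uext_continuous : continuous uext.
Proof.
pose c (p : R * R) : R * R := (Num.max p.1 0, p.2).
have cc : continuous c.
  move=> p; have H1 : Num.max q.1 0 @[q --> p] --> Num.max p.1 0.
    have E (y : R) : Num.max y 0 = (y + `|y|) / 2 by rewrite maxr_absE addr0 subr0.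
    rewrite E; under eq_fun do rewrite E.
    by apply: cvgMl; apply: cvgD; [exact: cvg_fst|apply: cvg_norm; exact: cvg_fst].
  have H2 : q.2 @[q --> p] --> p.2 by exact: cvg_snd.
  exact: (cvg_pair H1 H2).
move=> p.
have A0 q : 0 <= (c q).1 by rewrite /= le_max lexx orbT.
have H := (iffLR (@subspace_continuousP _ _ _ _) cu) (c p) (A0 p).
apply: (@cvg_trans _ ((fun q : R * R => u q.1 q.2) @ within [set q | 0 <= q.1] (nbhs (c p)))); last exact: H.
move=> B HB; have {HB} : within [set q : R * R | 0 <= q.1] (nbhs (c p)) [set q : R * R | B (u q.1 q.2)] by exact: HB.
move=> /cc HB.
have : nbhs p [set q | B (uext q)].
  apply: (@filterS _ (nbhs p) _ _ _ _ HB) => q Hq.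
  exact: (Hq (A0 q)).
by [].
Qed.

(** The value 0 for t <= 0 makes this measurable on the whole plane. *)
Definition potential_pos (p : R * R) : R := if 0 < p.1 then CH_P u p.1 p.2 else 0.

Lemma uext_pos t x : 0 < t -> uext (t, x) = u t x.
Proof. by move=> t0; rewrite /uext /= max_l// ltW. Qed.

Lemma uext_slice_continuous t : continuous (fun x => uext (t, x)).
Proof.
move=> x; apply: (@continuous_comp _ _ _ (fun y : R => (t, y)) uext x); last exact: uext_continuous.
have H1 : (cst t y : R) @[y --> x] --> t by exact: cvg_cst.
have H2 : y @[y --> x] --> x by exact: cvg_id.
exact: (cvg_pair H1 H2).
Qed.

Lemma uext_time_continuous x : continuous (fun t => uext (t, x)).
Proof.
move=> t; apply: (@continuous_comp _ _ _ (fun s : R => (s, x)) uext t); last exact: uext_continuous.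
have H1 : (cst x y : R) @[y --> t] --> x by exact: cvg_cst.
have H2 : y @[y --> t] --> t by exact: cvg_id.
exact: (cvg_pair H2 H1).
Qed.

Lemma uext_measurable : measurable_fun (setT : set (T * T)) uext.
Proof.
apply: (@separately_continuous_measurable R (fun t x => u t x)).
  move=> t t0; have := @uext_slice_continuous t; rewrite /uext /=.
  by rewrite max_l.
exact: uext_time_continuous.
Qed.

Lemma uext_slice t : 0 < t -> (fun x => uext (t, x)) = u t.
Proof. by move=> t0; apply/funext => x; exact: uext_pos. Qed.

Lemma kernel_measurable : measurable_fun setT (@kernel R).
Proof.
apply: continuous_measurable_fun; apply: (@lipschitz_continuous _ _ 1) => z w.
by rewrite mul1r; exact: kernel_lip.
Qed.

Lemma potential_pos_measurable : measurable_fun (setT : set (T * T)) potential_pos.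
Proof.
pose q n (p : T * T) (y : T) := diffq n.+1%:R^-1 (fun y => uext (p.1, y)) y.
pose k n (z : (T * T) * T) : \bar R :=
  (kernel (z.1.2 - z.2) * density (fun y => uext (z.1.1, y)) (q n z.1) z.2)%:E.
have mu1 n : measurable_fun (setT : set ((T * T) * T)) (k n).
  apply/measurable_EFinP; apply: measurable_funM.
    have md : measurable_fun (setT : set ((T * T) * T)) (fun z => z.1.2 - z.2).
      apply: measurable_funB => //.
      exact: (measurableT_comp (@measurable_snd _ _ T T) (@measurable_fst _ _ (T * T)%type T)).
    exact: (measurableT_comp kernel_measurable md).
  have m1 (s : R) : measurable_fun (setT : set ((T * T) * T)) (fun z => uext (z.1.1, z.2 + s)).
    apply: (measurableT_comp uext_measurable); apply: measurable_fun_pair.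
      by apply: (measurableT_comp (@measurable_fst _ _ T T) (@measurable_fst _ _ (T * T)%type T)).
    by apply: measurable_funD => //.
  have m0 : measurable_fun (setT : set ((T * T) * T)) (fun z => uext (z.1.1, z.2)).
    by have := m1 0; under eq_fun do rewrite addr0.
  apply: measurable_funD; first exact: measurable_funX.
  apply: measurable_funM => //; apply: measurable_funX; apply: measurable_funM => //.
  exact: measurable_funB.
pose J n (p : T * T) : \bar R := (\int[leb]_y k n (p, y))%E.
have mJ n : measurable_fun (setT : set (T * T)) (J n).
  apply: (@measurable_fun_fubini_tonelli_F _ _ (T * T)%type T R leb (k n)) => // z.
  by rewrite lee_fin mulr_ge0 ?kernel_ge0 ?density_ge0.
pose Je p := limn_esup (fun n => J n p).
have mJe : measurable_fun (setT : set (T * T)) Je by exact: measurable_fun_limn_esup.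
have JE p : 0 < p.1 -> Je p = (\int[leb]_y (kernel (p.2 - y) * density (u p.1) (wderiv (u p.1)) y))%:E.
  move=> p0; exact: (potential_limsup p.2 (su p0) (uext_slice p0)).
rewrite (_ : potential_pos = (fun p => (if 0 < p.1 then 2^-1 * fine (Je p) else 0))); last first.
  apply/funext => p; rewrite /potential_pos; case: ifPn => // p0.
  by rewrite JE.
apply: measurable_fun_ifT => //.
  by apply: measurable_fun_ltr.
by apply: measurable_funM => //; apply: measurableT_comp.
Qed.

End JointMeasurability.

(** * The conservation law on rectangles *)

Section Conservation.
Context {R : realType}.
Local Notation leb := (@lebesgue_measure R).
Local Notation T := (measurableTypeR R).
Variable u : R -> R -> R.
Hypothesis cu : {within [set p : R * R | 0 <= p.1],
        continuous (fun p : R * R => u p.1 p.2)}.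
Hypothesis su : forall t, 0 < t -> slice (u t) (wderiv (u t)).
Variable E0 : R.
Hypothesis mE : forall t, 0 < t -> mass (u t) (wderiv (u t)) <= E0.
Hypothesis ud : CH_distributional u.

Lemma continuous_bounded_box (G : R * R -> R) a b c d : continuous G ->
  exists2 B, 0 <= B & forall s y, a <= s <= b -> c <= y <= d -> `|G (s, y)| <= B.
Proof.
move=> cG.
have [ab|ba] := leP a b; last first.
  by exists 0 => // s y /andP[h1 h2]; move: (lt_le_trans ba (le_trans h1 h2)); rewrite ltxx.
have [cd|dc] := leP c d; last first.
  by exists 0 => // s y _ /andP[h1 h2]; move: (lt_le_trans dc (le_trans h1 h2)); rewrite ltxx.
have [||| p _ Hp] := @compact_EVT_max _ R (fun p : R * R => `|G p|) (`[a, b] `*` `[c, d])%classic.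
- by exists (a, c); split => /=; rewrite in_itv /= lexx.
- by apply: compact_setX; exact: segment_compact.
- by apply: continuous_subspaceT => p; apply: cvg_norm; exact: cG.
exists `|G p| => // s y hs hy; apply: Hp.
by rewrite inE; split; rewrite /= in_itv.
Qed.

Definition flux (p : R * R) : R := uext u p ^+ 2 / 2 + potential_pos u p.

Lemma flux_measurable : measurable_fun (setT : set (T * T)) flux.
Proof.
apply: measurable_funD; last exact: potential_pos_measurable.
by apply: measurable_funM => //; apply: measurable_funX; exact: uext_measurable.
Qed.

Lemma flux_pos t x : 0 < t -> flux (t, x) = u t x ^+ 2 / 2 + potential (u t) (wderiv (u t)) x.
Proof. by move=> t0; rewrite /flux uext_pos// /potential_pos /= t0. Qed.

Lemma slice_cont t : 0 < t -> continuous (u t).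
Proof. by move=> /su[]. Qed.

Lemma flux_continuous t : 0 < t -> continuous (fun x => flux (t, x)).
Proof.
move=> t0; rewrite (_ : (fun x => _) =
  (fun x => u t x ^+ 2 / 2 + potential (u t) (wderiv (u t)) x)).
  move=> x; apply: cvgD; last exact: (potential_continuous (su t0)).
  by apply: cvgMl; apply: cvgM; exact: slice_cont.
by apply/funext => x; rewrite flux_pos.
Qed.

Lemma potential_pos_bound p : `|potential_pos u p| <= `|E0|.
Proof.
rewrite /potential_pos; case: ifPn => p0; last by rewrite normr0.
have -> : CH_P u p.1 p.2 = potential (u p.1) (wderiv (u p.1)) p.2 by [].
rewrite ger0_norm ?potential_ge0//.
apply: le_trans (potential_le _ (su p0)) _.
exact: le_trans (mE p0) (ler_norm _).
Qed.

Lemma flux_bounded a b c d : exists2 B, 0 <= B &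
  forall s y, a <= s <= b -> c <= y <= d -> `|flux (s, y)| <= B.
Proof.
have [B B0 HB] := continuous_bounded_box a b c d (uext_continuous cu).
exists (B ^+ 2 / 2 + `|E0|); first by rewrite addr_ge0 ?divr_ge0 ?sqr_ge0.
move=> s y hs hy; apply: le_trans (ler_normD _ _) _.
apply: lerD; last exact: potential_pos_bound.
rewrite normrM normrX [X in _ * X]ger0_norm// ler_wpM2r//.
by rewrite ler_sqr ?nnegrE//; exact: HB.
Qed.

(** The equation is tested against products of bumps tending to the indicator
    of the rectangle. Each of its two terms is an instance of box_limit, with
    the roles of time and space exchanged. *)
Lemma conservation t1 t2 x1 x2 : 0 < t1 -> t1 <= t2 -> x1 <= x2 ->
  \int[leb]_(x in `]x1, x2]) (u t2 x - u t1 x) =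
  \int[leb]_(t in `]t1, t2]) (flux (t, x1) - flux (t, x2)).
Proof.
move=> t10 t12 x12.
have [B1 B10 HB1] := flux_bounded t1 (t2 + 1) x1 (x2 + 1).
have [B2 B20 HB2] := continuous_bounded_box t1 (t2 + 1) x1 (x2 + 1) (uext_continuous cu).
(* the same function with space first, to apply box_limit to the time derivative *)
pose us (p : R * R) := uext u (p.2, p.1).
have mus : measurable_fun (setT : set (T * T)) us.
  apply: (measurableT_comp (uext_measurable cu)).
  by apply: measurable_fun_pair.
have b1 s y : t1 < s <= t2 + 1 -> x1 < y <= x2 + 1 -> `|flux (s, y)| <= B1.
  by move=> /andP[/ltW h1 h2] /andP[/ltW h3 h4]; apply: HB1; apply/andP.
have b2 s y : x1 < s <= x2 + 1 -> t1 < y <= t2 + 1 -> `|us (s, y)| <= B2.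
  by move=> /andP[/ltW h1 h2] /andP[/ltW h3 h4]; apply: HB2; apply/andP.
have cf y s : t1 < s <= t2 + 1 -> flux (s, z) @[z --> y^'+] --> flux (s, y).
  move=> /andP[ts _]; apply: cvg_at_right_filter.
  exact: (flux_continuous (lt_trans t10 ts)).
have cus y s : us (s, z) @[z --> y^'+] --> us (s, y).
  by apply: cvg_at_right_filter; exact: (uext_time_continuous cu).
have L1 := @box_limit R flux B1 t1 t2 x1 x2 flux_measurable t12 x12 b1 (cf x1) (cf x2).
have L2 := @box_limit R us B2 x1 x2 t1 t2 mus x12 t12 b2 (fun s _ => cus t1 s) (fun s _ => cus t2 s).
have S n : \int[leb]_s \int[leb]_y box_integrand flux t1 t2 x1 x2 n.+1 (s, y) + \int[leb]_s \int[leb]_y box_integrand us x1 x2 t1 t2 n.+1 (s, y) = 0.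
  have i1 := box_integrable flux_measurable t12 x12 b1 (ltn0Sn n).
  pose H2' (p : R * R) := box_integrand us x1 x2 t1 t2 n.+1 (p.2, p.1).
  have [C HC] := box_integrand_bound x12 t12 b2 (ltn0Sn n).
  have i2 : (leb \x leb)%E.-integrable (setT : set (T * T)) (EFin \o H2').
    apply: (@integrable_box _ _ t1 (t2 + 1) x1 (x2 + 1) C).
    - apply: (@measurableT_comp _ _ _ _ _ _ (box_integrand us x1 x2 t1 t2 n.+1)).
        exact: (box_integrand_measurable x1 x2 t1 t2 mus).
      by apply: measurable_fun_pair.
    - by move=> p _ _; have [] := HC (p.2, p.1).
    - by move=> p hp; have [_ HZ] := HC (p.2, p.1); apply: HZ; rewrite andbC.
  have [_ R1] := Rfubini1 i1 (fun s => box_slice1 flux_measurable t12 x12 b1 s (ltn0Sn n)).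
  have R2 : \int[(leb \x leb)%E]_p H2' p =
      \int[leb]_s \int[leb]_y box_integrand us x1 x2 t1 t2 n.+1 (s, y).
    have sl2 y : leb.-integrable setT (EFin \o (fun s => H2' (s, y))).
      have := box_slice1 mus x12 t12 b2 y (ltn0Sn n).
      by [].
    have := Rfubini2 i2 sl2.
    by [].
  transitivity (\int[(leb \x leb)%E]_p box_integrand flux t1 t2 x1 x2 n.+1 p + \int[(leb \x leb)%E]_p H2' p).
    by rewrite R1; congr (_ + _); exact: (esym R2).
  clear R1 R2.
  rewrite -(RintegralD measurableT i1 i2).
  have tpos : tsupport (bump2 n.+1 t1 t2 x1 x2) `<=` [set p | 0 < p.1].
    move=> p /(bump2_tsupport (ltn0Sn n) t12 x12)[/= + _]; rewrite in_itv /=.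
    by move=> /andP[h _]; exact: lt_le_trans h.
  have K := ud (bump2_test (ltn0Sn n) t12 x12) tpos.
  rewrite integral_mkcond in K.
  rewrite /Rintegral (_ : (\int[_]_x _ = 0)%E)// -[RHS]K.
  apply: eq_integral => p _; rewrite patchE; case: ifPn => hp.
    have p0 : 0 < p.1 by rewrite inE in hp.
    rewrite /H2' /= /box_integrand /bump2.
    rewrite !(tensor_derive _ _ (bump_smooth _ _ _) (bump_smooth _ _ _)) /=.
    rewrite /us -surjective_pairing /flux /potential_pos p0.
    rewrite (_ : uext u p = u p.1 p.2); last by case: p p0 {hp} => t x; exact: uext_pos.
    congr EFin.
    move: (u p.1 p.2) (CH_P u p.1 p.2) (bump n.+1 t1 t2 p.1) (bump n.+1 x1 x2 p.2)
      (derive1 (bump n.+1 t1 t2) p.1) (derive1 (bump n.+1 x1 x2) p.2) => *; ring.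
  have p0 : p.1 <= t1.
    by move: hp; rewrite notin_setE /= => /negP; rewrite -leNgt => /le_trans; apply; exact: ltW.
  rewrite /H2' /= /box_integrand /= bump_out// ?p0// mul0r.
  by rewrite derive_bump !dstep_le// ?(le_trans p0)// subrr !mulr0 addr0.
have L : \int[leb]_s \int[leb]_y box_integrand flux t1 t2 x1 x2 n.+1 (s, y) + \int[leb]_s \int[leb]_y box_integrand us x1 x2 t1 t2 n.+1 (s, y)
    @[n --> \oo] --> (0 : R).
  by under eq_fun do rewrite S; exact: cvg_cst.
have E : \int[leb]_(s in `]t1, t2]) (flux (s, x1) - flux (s, x2)) +
    \int[leb]_(s in `]x1, x2]) (us (s, t1) - us (s, t2)) = 0.
  exact: cvg_unique (cvgD L1 L2) L.
have -> : \int[leb]_(x in `]x1, x2]) (u t2 x - u t1 x) =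
  - \int[leb]_(s in `]x1, x2]) (us (s, t1) - us (s, t2)).
  have is_ : leb.-integrable `]x1, x2] (EFin \o (fun s => us (s, t1) - us (s, t2))).
    apply: measurable_bounded_integrable => //.
    - rewrite /= lebesgue_measure_itv /= lte_fin; case: ifP => _ //; rewrite -EFinD ltry//.
    - by apply: measurable_funTS; apply: measurable_funB; apply: (@measurable_fun_pair1 _ _ _ T T).
    exists (B2 + B2); split; first exact: num_real.
    move=> y By s /=; rewrite in_itv /= => /andP[s1 s2]; apply: le_trans (ltW By).
    rewrite (le_trans (ler_normB _ _))// lerD// /us; apply: HB2.
    - by rewrite /= lexx (le_trans t12)// lerDl.
    - by rewrite /= (ltW s1) (le_trans s2)// lerDl.
    - by apply/andP; split; [exact: t12|rewrite /= lerDl].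
    - by rewrite /= (ltW s1) (le_trans s2)// lerDl.
  rewrite -mulN1r -(RintegralZl _ _ is_)//; apply: eq_Rintegral => x _.
  rewrite /us !uext_pos//; [ring|exact: lt_le_trans t12].
by apply/eqP; rewrite eq_sym -addr_eq0 E.
Qed.

End Conservation.

(** * Averaged slopes and the transport estimate *)

Section Translation.
Context {R : realType}.
Local Notation leb := (@lebesgue_measure R).
Local Notation T := (measurableTypeR R).

Definition shiftR (a x : T) : T := x + a.

Lemma shiftR_measurable a : measurable_fun (setT : set T) (shiftR a).
Proof. by apply: measurable_funD. Qed.

HB.instance Definition _ (a : R) :=
  isMeasurableFun.Build _ _ _ _ (shiftR a) (shiftR_measurable a).

Lemma lebesgue_shift (a : R) (A : set T) : measurable A ->
  leb A = pushforward leb (shiftR a) A.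
Proof.
move=> mA; apply: (lebesgue_measure_unique _ mA) => _ [[b c]] _ <-.
have E : shiftR a @^-1` `]b, c]%classic = `]b - a, c - a]%classic.
  by apply/seteqP; split => x /=; rewrite /shiftR !in_itv /= ltrBlDr lerBrDr.
transitivity (leb `]b - a, c - a]%classic); last by rewrite -E.
rewrite !lebesgue_measure_itv /= !lte_fin ltrD2r.
by case: ifP => // _; rewrite -!EFinD opprB addrA subrK.
Qed.

Lemma ge0_integral_shift (f : R -> \bar R) (a : R) : measurable_fun (setT : set T) f ->
  (forall x, (0 <= f x)%E) -> (\int[leb]_x f (x + a)%R = \int[leb]_x f x)%E.
Proof.
move=> mf f0.
have -> : (\int[leb]_x f x = \int[pushforward leb (shiftR a)]_x f x)%E.
  by apply: eq_measure_integral => A mA _; exact: lebesgue_shift.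
by rewrite (ge0_integral_pushforward (shiftR_measurable a)).
Qed.

Lemma integrable_shift (g : R -> R) (a : R) : leb.-integrable setT (EFin \o g) ->
  leb.-integrable setT (EFin \o (fun x => g (x + a))).
Proof.
move=> ig; have mg : measurable_fun (setT : set T) (EFin \o g) := measurable_int leb ig.
apply/integrableP; split; first exact: (measurableT_comp mg (shiftR_measurable a)).
rewrite (ge0_integral_shift (f := fun x => `|(g x)%:E|%E)).
- by move/integrableP: ig => [].
- exact: measurableT_comp.
- by move=> x; exact: abse_ge0.
Qed.

Lemma Rintegral_shift (g : R -> R) (a : R) : leb.-integrable setT (EFin \o g) ->
  \int[leb]_x g (x + a) = \int[leb]_x g x.
Proof.
move=> ig; have mg : measurable_fun (setT : set T) (EFin \o g) := measurable_int leb ig.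
rewrite /Rintegral; congr fine.
have -> : (\int[leb]_x (g x)%:E = \int[pushforward leb (shiftR a)]_x (g x)%:E)%E.
  by apply: eq_measure_integral => A mA _; exact: lebesgue_shift.
by rewrite (integral_pushforward (shiftR_measurable a) mg (integrable_shift a ig)).
Qed.

End Translation.

Section Averages.
Context {R : realType}.
Local Notation leb := (@lebesgue_measure R).
Local Notation T := (measurableTypeR R).
Implicit Types f v : R -> R.

Definition avg (h : R) f (x : R) : R := h^-1 * \int[leb]_(y in `]x, x + h]) f y.

Lemma continuous_itv_integrable f a b : continuous f ->
  leb.-integrable `[a, b] (EFin \o f).
Proof.
move=> cf; apply: continuous_compact_integrable; first exact: segment_compact.
exact: continuous_subspaceT.
Qed.

Lemma avgE f h a x : continuous f -> 0 < h -> a < x ->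
  avg h f x = h^-1 * (\int[leb]_(y in `[a, x + h]) f y - \int[leb]_(y in `[a, x]) f y).
Proof.
move=> cf h0 ax; congr (_ * _); rewrite Rintegral_itvB//.
- exact: continuous_itv_integrable.
- by rewrite bnd_simp ltW.
- by rewrite bnd_simp lerDl ltW.
Qed.

Lemma avg_is_derive f h x : continuous f -> 0 < h ->
  is_derive x (1:R) (avg h f) (diffq h f x).
Proof.
move=> cf h0; pose a := x - 1; have ax : a < x by rewrite /a ltrBlDr ltrDl.
pose F y := \int[leb]_(z in `[a, y]) f z.
have dF y : a < y -> is_derive y (1:R) F (f y).
  move=> ay.
  have [||d e] := @continuous_FTC1_closed R f a y (y + 1) _ _ ay (cf y).
  - by rewrite ltrDl.
  - exact: continuous_itv_integrable.
  by rewrite -e derive1E; exact/derivableP.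
apply: (@near_eq_is_derive R R R (fun y => h^-1 * (F (y + h) - F y))).
  near=> y; rewrite (@avgE f h a)//; near: y; exact: lt_nbhsr.
have d1 := dF x ax.
have d2 : is_derive x (1:R) (fun y => F (y + h)) (f (x + h)).
  have axh : a < x + h by rewrite (lt_trans ax)// ltrDl.
  have ds : is_derive x (1:R) (fun y : R => y + h) 1.
    by apply: is_derive_eq; rewrite addr0.
  have := @is_derive1_comp R F (fun y : R => y + h) x _ _ (dF _ axh) ds.
  by rewrite mulr1.
have d3 : is_derive x (1:R) (fun y => F (y + h) - F y) (f (x + h) - f x).
  exact: is_deriveB.
by apply: is_derive_eq; rewrite /GRing.scale /= /diffq mulrC.
Unshelve. all: by end_near. Qed.

Lemma diffq_is_derive f (df : R -> R) h x : (forall y, is_derive y (1:R) f (df y)) ->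
  is_derive x (1:R) (diffq h f) (diffq h df x).
Proof.
move=> d.
have ds : is_derive x (1:R) (fun y : R => y + h) 1.
  by apply: is_derive_eq; rewrite addr0.
have d2 : is_derive x (1:R) (fun y => f (y + h)) (df (x + h)).
  by have := @is_derive1_comp R f (fun y : R => y + h) x _ _ (d _) ds; rewrite mulr1.
have d1 := d x.
have d3 : is_derive x (1:R) (fun y => f (y + h) - f y) (df (x + h) - df x).
  exact: is_deriveB.
have d4 : is_derive x (1:R) (fun y => h^-1 * (f (y + h) - f y)) (h^-1 * (df (x + h) - df x)).
  exact: is_deriveZ.
rewrite [diffq h df x]mulrC.
by rewrite (_ : diffq h f = (fun y => h^-1 * (f (y + h) - f y)))//; apply/funext => y; rewrite /diffq mulrC.
Qed.

(** The slope of the average of f is a second-order smoothing of its weak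
    derivative. Its derivative in x is the second difference quotient of f,
    and along a solution its increment in time is a second difference of the
    flux. *)
Definition dslope h f := diffq h (avg h f).

Lemma dslope_is_derive f h x : continuous f -> 0 < h ->
  is_derive x (1:R) (dslope h f) (diffq h (diffq h f) x).
Proof. by move=> cf h0; apply: diffq_is_derive => y; exact: avg_is_derive. Qed.

Lemma is_derive_continuous f (df : R -> R) : (forall y, is_derive y (1:R) f (df y)) ->
  continuous f.
Proof.
by move=> d x; apply: differentiable_continuous; apply/derivable1_diffP; have [] := d x.
Qed.

Lemma dslope_continuous f h : continuous f -> 0 < h -> continuous (dslope h f).
Proof.
move=> cf h0; apply: (@is_derive_continuous _ (diffq h (diffq h f))) => y.
exact: dslope_is_derive.
Qed.

Lemma diffq_mvt f (df : R -> R) h x : 0 < h -> (forall y, is_derive y (1:R) f (df y)) ->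
  exists2 c, x < c < x + h & diffq h f x = df c.
Proof.
move=> h0 d; have xh : x < x + h by rewrite ltrDl.
have [c cI E] := MVT xh (fun y _ => d y)
  (continuous_subspaceT (is_derive_continuous d)).
exists c; first by move: cI; rewrite in_itv.
by rewrite /diffq E addrC addKr mulfK// gt_eqF.
Qed.

(** The smoothed slope is a difference quotient at an intermediate point, so
    it inherits every upper bound on difference quotients. *)
Lemma dslope_mvt f h x : continuous f -> 0 < h ->
  exists2 c, x < c < x + h & dslope h f x = diffq h f c.
Proof. by move=> cf h0; apply: diffq_mvt => // y; exact: avg_is_derive. Qed.

Lemma dslope_le f h (K : R) x : continuous f -> 0 < h ->
  (forall y, diffq h f y <= K) -> dslope h f x <= K.
Proof. by move=> cf h0 fK; have [c _ ->] := dslope_mvt x cf h0. Qed.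

Lemma dslope_cvg f x (l : R) : continuous f -> is_derive x (1:R) f l ->
  dslope n.+1%:R^-1 f x @[n --> \oo] --> l.
Proof.
move=> cf dx; apply/cvgrPdist_le => e e0.
have e30 : 0 < e / 3 by rewrite divr_gt0.
have [d d0 Hd] := derive_expansion dx e30.
have d20 : 0 < d / 2 by rewrite divr_gt0.
near=> n.
have nd : n.+1%:R^-1 < d / 2 by near: n; exact: near_infty_natSinv_lt (PosNum d20).
have n0 : 0 < n.+1%:R^-1 :> R by rewrite invr_gt0.
move: nd n0; move: (n.+1%:R^-1) => h hd h0.
have [c /andP[xc ch] ->] := dslope_mvt x cf h0.
have [s [s0 sh cE]] : exists s, [/\ 0 <= s, s <= h & c = x + s].
  by exists (c - x); rewrite subr_ge0 lerBlDl !ltW// subrKC.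
have A1 : `|f (x + s) - f x - s * l| <= e / 3 * s by apply: Hd => //; lra.
have A2 : `|f (x + (s + h)) - f x - (s + h) * l| <= e / 3 * (s + h).
  by apply: Hd; lra.
have -> : l - diffq h f c = - ((f (x + (s + h)) - f x - (s + h) * l)
      - (f (x + s) - f x - s * l)) / h.
  rewrite /diffq cE -[x + s + h]addrA.
  by move: (f (x + (s + h))) (f (x + s)) (f x) => *; field; rewrite gt_eqF.
rewrite normrM normrN normfV (gtr0_norm h0) ler_pdivrMr//.
apply: le_trans (ler_normB _ _) _.
have : e / 3 * s <= e / 3 * h by rewrite ler_wpM2l// ltW.
have -> : e * h = e / 3 * h + e / 3 * h + e / 3 * h by field.
move: A1 A2; rewrite mulrDr; lra.
Unshelve. all: by end_near. Qed.

Lemma continuous_max0 (g : R -> R) : continuous g -> continuous (fun x => Num.max (g x) 0).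
Proof.
move=> cg; rewrite (_ : (fun x => _) = (fun x => (g x + `|g x|) / 2)).
  by move=> x; apply: cvgMl; apply: cvgD; [exact: cg|apply: cvg_norm; exact: cg].
by apply/funext => x; rewrite maxr_absE addr0 subr0.
Qed.

(** An expansion to second order, valid across the corner of max(s, 0) because
    pospart_sqr has a Lipschitz derivative. *)
Lemma pospart_sqr_quad (s k : R) :
  `|pospart_sqr (s + k) - pospart_sqr s - k * (2 * Num.max s 0)| <= k ^+ 2.
Proof.
have lo := pospart_sqr_subgradient s (s + k).
have up : pospart_sqr (s + k) <= pospart_sqr s + k * (2 * Num.max s 0) + k ^+ 2.
  rewrite /pospart_sqr; have k0 := sqr_ge0 k.
  case: (leP s 0) => hs; case: (leP (s + k) 0) => hk; have := sqr_ge0 (s + k); nra.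
rewrite (_ : s + k - s = k) in lo; last by ring.
rewrite mulrC in lo.
by rewrite ler_norml; apply/andP; split; have := sqr_ge0 k; lra.
Qed.

Lemma pospart_sqr_is_derive (s : R) : is_derive s (1:R) pospart_sqr (2 * Num.max s 0).
Proof.
have H : h^-1 *: ((pospart_sqr \o shift s) (h *: (1:R)) - pospart_sqr s) @[h --> 0^'] -->
    2 * Num.max s 0.
  apply/cvgrPdist_le => e e0; near=> h.
  have h0 : h != 0 by near: h; exact: nbhs_dnbhs_neq.
  have he : `|h| <= e by near: h; exact: dnbhs0_le.
  rewrite /= /GRing.scale /= mulr1 [h + s]addrC.
  have -> : 2 * Num.max s 0 - h^-1 * (pospart_sqr (s + h) - pospart_sqr s) =
     - (pospart_sqr (s + h) - pospart_sqr s - h * (2 * Num.max s 0)) / h.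
    by move: (pospart_sqr (s + h)) (pospart_sqr s) (Num.max s 0) => *; field.
  rewrite normrM normrN normfV ler_pdivrMr ?normr_gt0//.
  apply: le_trans (pospart_sqr_quad s h) _.
  by rewrite -real_normK ?num_real// expr2 ler_wpM2r.
by apply: DeriveDef; [apply/cvg_ex; eexists; exact: H|apply/cvg_lim; [|exact: H]].
Unshelve. all: by end_near. Qed.

Lemma integral_indic_itv (a b : R) : a <= b ->
  \int[leb]_x (\1_(`[a, b]%classic) x) = b - a.
Proof.
move=> ab; rewrite /Rintegral integral_indic// setIT /= lebesgue_measure_itv /= lte_fin.
move: ab; rewrite le_eqVlt => /predU1P[->|ab]; first by rewrite ltxx subrr.
by rewrite ab -EFinD.
Qed.

Lemma window_le (L : R) : 0 <= L -> - L - 1 <= L.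
Proof. lra. Qed.

Lemma window (L x s h : R) : 0 < s -> s <= 1 -> 0 < h -> h <= 1 ->
  - L - 1 <= x <= L ->
  - L - 1 <= x + s + 2 * h <= L + 3 /\ - L - 1 <= x + s + h <= L + 3.
Proof.
by move=> s0 s1 h0 h1 /andP[x1 x2]; split; apply/andP; split; lra.
Qed.

Lemma window_out (L x s : R) : 0 < s -> s <= 1 -> ~~ (- L - 1 <= x <= L) ->
  ~~ (- L <= x + s <= L) /\ ~~ (- L <= x <= L).
Proof.
move=> s0 s1 hx; split; apply: contra hx => /andP[x1 x2]; apply/andP; split; lra.
Qed.

(** Discrete form of the identity - 2 m (f^2 / 2)_xx = - 2 m f f_xx - 2 m
    f_x^2. With mid the mean of f2 and f1, and with difference quotients q1 =
    (f2 - f1) / h and q0 = (f1 - f0) / h, the second difference of f^2 / 2 is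
    mid * (q1 - q0) / h + (q1 + q0) * q0 / 2. The last term has the favourable
    sign up to q1^2 / 4, by completing the square in q0. *)
Lemma source_pointwise (h K p m f2 f1 f0 : R) : 0 < h -> 0 <= p <= 1 -> 0 <= m <= K ->
  p * (2 * m) * - ((f2 ^+ 2 / 2 - 2 * (f1 ^+ 2 / 2) + f0 ^+ 2 / 2) / h ^+ 2) <=
  -1 * (p * ((f2 + f1) / 2) * (2 * m * (((f2 - f1) / h - (f1 - f0) / h) / h)))
  + K * 4^-1 * ((f2 - f1) / h) ^+ 2.
Proof.
move=> h0 /andP[p0 p1] /andP[m0 m1].
have -> : p * (2 * m) * - ((f2 ^+ 2 / 2 - 2 * (f1 ^+ 2 / 2) + f0 ^+ 2 / 2) / h ^+ 2) =
  -1 * (p * ((f2 + f1) / 2) * (2 * m * (((f2 - f1) / h - (f1 - f0) / h) / h)))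
  + p * m * - ((f2 - f1) / h * ((f1 - f0) / h) + ((f1 - f0) / h) ^+ 2).
  by field; rewrite gt_eqF.
rewrite lerD2l; move: ((f2 - f1) / h) ((f1 - f0) / h) => y z.
have pm : p * m <= K by rewrite -[K]mul1r ler_pM.
apply: (@le_trans _ _ (p * m * (4^-1 * y ^+ 2))).
  apply: ler_wpM2l; first exact: mulr_ge0.
  have := sqr_ge0 (y / 2 + z); nra.
by rewrite -[K / 4 * _]mulrA; apply: ler_wpM2r => //; rewrite mulr_ge0// sqr_ge0.
Qed.

End Averages.

Section Transport.
Context {R : realType}.
Local Notation leb := (@lebesgue_measure R).
Local Notation T := (measurableTypeR R).
Variables (f v phi : R -> R) (K L B V h : R).
Hypothesis sl : slice f v.
Hypothesis vV : \int[leb]_x (v x ^+ 2) <= V.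
Hypotheses (h0 : 0 < h) (h1 : h <= 1) (K0 : 0 <= K) (L0 : 0 <= L).
Hypothesis qK : forall s y, 0 < s -> diffq s f y <= K.
Hypothesis phi01 : forall x, 0 <= phi x <= 1.
Hypothesis phi_lip : forall x y, `|phi x - phi y| <= `|x - y|.
Hypothesis phi_out : forall x, ~~ (- L <= x <= L) -> phi x = 0.
Hypothesis fB : forall x, - L - 1 <= x <= L + 3 -> `|f x| <= B.

Let cf : continuous f. Proof. by case: sl. Qed.
Let w := dslope h f.
Let q := diffq h f.
Let dq := diffq h (diffq h f).
Let mid x := (f (x + 2 * h) + f (x + h)) / 2.
Let G x := phi x * mid x.
Let b x := pospart_sqr (w x).
Let db x := 2 * Num.max (w x) 0 * dq x.

Let cw : continuous w. Proof. exact: dslope_continuous. Qed.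
Let cdq : continuous dq. Proof. by apply: diffq_continuous; exact: diffq_continuous. Qed.
Let cmid : continuous mid.
Proof.
move=> x; apply: cvgMl; apply: cvgD.
  exact: (@continuous_shift R f (2 * h) cf x).
exact: (@continuous_shift R f h cf x).
Qed.

Let cphi : continuous phi.
Proof. by apply: (@lipschitz_continuous _ _ 1) => x y; rewrite mul1r. Qed.

Let cG : continuous G. Proof. by move=> x; apply: cvgM; [exact: cphi|exact: cmid]. Qed.

Let b_derive x : is_derive x (1:R) b (db x).
Proof.
have := @is_derive1_comp R pospart_sqr w x _ _ (pospart_sqr_is_derive (w x)) (dslope_is_derive x cf h0).
by rewrite /db.
Qed.

Let cb : continuous b. Proof. exact: is_derive_continuous b_derive. Qed.

Let cmaxw : continuous (fun x => Num.max (w x) 0).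
Proof. exact: continuous_max0. Qed.

Let cdb : continuous db.
Proof.
move=> x; apply: cvgM; last exact: cdq.
by apply: cvgMr; exact: cmaxw.
Qed.

Let b_ge0 x : 0 <= b x. Proof. exact: pospart_sqr_ge0. Qed.

Let maxw x : 0 <= Num.max (w x) 0 <= K.
Proof.
rewrite le_max lexx orbT /= ge_max K0 andbT.
by apply: dslope_le => // y; exact: qK.
Qed.

Let b_le x : b x <= K ^+ 2.
Proof.
by rewrite /b /pospart_sqr ler_sqr ?nnegrE//; have /andP[] := maxw x.
Qed.

Let G_out x : ~~ (- L <= x <= L) -> G x = 0.
Proof. by move=> hx; rewrite /G phi_out// mul0r. Qed.

Let bounded_on (g : R -> R) (c d : R) : continuous g ->
  exists2 C, 0 <= C & forall x, c <= x <= d -> `|g x| <= C.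
Proof.
move=> cg; have [cd|dc] := leP c d; last first.
  by exists 0 => // s /andP[s1 s2]; move: (lt_le_trans dc (le_trans s1 s2)); rewrite ltxx.
have [|z _ Hz] := @EVT_max R (fun x => `|g x|) c d cd.
  by apply: continuous_subspaceT => x; apply: cvg_norm; exact: cg.
by exists `|g z| => // x hx; apply: Hz; rewrite in_itv.
Qed.

Let integrable_G (g : R -> R) : continuous g ->
  leb.-integrable setT (EFin \o (fun x => G x * g x)).
Proof.
move=> cg.
have cGg : continuous (fun x => G x * g x) by move=> x; apply: cvgM; [exact: cG|exact: cg].
have [C C0 HC] := bounded_on (- L) L cGg.
apply: (@integrable_support _ _ (- L) L C) => //.
- exact: continuous_measurable_fun.
- by move=> x hx; rewrite G_out// mul0r.
Qed.

(** The dominating function of diffq s G for every 0 < s <= 1: the Lipschitz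
    weight phi meets the bound B on f, and the increment of mid is absorbed by
    Young inequality into squares of difference quotients, whose integrals are
    bounded by V. *)
Let H s x : R := (B + 2^-1) * \1_(`[- L - 1, L]%classic) x
  + 4^-1 * (diffq s f (x + 2 * h) ^+ 2 + diffq s f (x + h) ^+ 2).

Let diffqG_le s x : 0 < s -> s <= 1 -> `|diffq s G x| <= H s x.
Proof.
move=> s0 s1; rewrite /H indicE.
have sq1 := sqr_ge0 (diffq s f (x + 2 * h)); have sq2 := sqr_ge0 (diffq s f (x + h)).
case: (boolP (- L - 1 <= x <= L)) => hx; last first.
  have [hx1 hx2] := window_out s0 s1 hx.
  rewrite /diffq !G_out//.
  - rewrite subrr mul0r normr0 addr_ge0//.
      by rewrite memNset ?mulr0//= in_itv /=; exact/negP.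
    by rewrite mulr_ge0// addr_ge0.
have xin : x \in `[- L - 1, L]%classic by rewrite inE /= in_itv.
rewrite xin mulr1.
have -> : diffq s G x = (phi (x + s) - phi x) / s * mid (x + s) + phi x * diffq s mid x.
  rewrite /diffq /G; move: (phi (x + s)) (phi x) (mid (x + s)) (mid x) => *; field.
  by rewrite gt_eqF.
have dm : diffq s mid x = (diffq s f (x + 2 * h) + diffq s f (x + h)) / 2.
  rewrite /diffq /mid -!addrA [s + 2 * h]addrC [s + h]addrC.
  move: (f (x + (2 * h + s))) (f (x + (h + s))) (f (x + 2 * h)) (f (x + h)) => *; field.
  by rewrite gt_eqF.
have p1 : `|(phi (x + s) - phi x) / s| <= 1.
  rewrite normrM normfV (gtr0_norm s0) ler_pdivrMr// mul1r.
  apply: le_trans (phi_lip _ _) _; have -> : x + s - x = s by ring.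
  by rewrite gtr0_norm.
have /andP[x1 x2] := hx.
have m1 : `|mid (x + s)| <= B.
  have [W1 W2] := window s0 s1 h0 h1 hx.
  have A1 := fB W1; have A2 := fB W2.
  rewrite /mid normrM [X in _ * X]ger0_norm// ler_pdivrMr//.
  apply: le_trans (ler_normD _ _) _; lra.
have /andP[p2 p3] := phi01 x.
apply: le_trans (ler_normD _ _) _; rewrite -addrA; apply: lerD.
  by rewrite normrM -[leRHS]mul1r ler_pM.
rewrite normrM (ger0_norm p2) dm.
move: sq1 sq2; move: (diffq s f (x + 2 * h)) (diffq s f (x + h)) => y z sq1 sq2.
have N : `|(y + z) / 2| <= 2^-1 + 4^-1 * (y ^+ 2 + z ^+ 2).
  rewrite ler_norml; apply/andP; split;
  have := sqr_ge0 (y - 1); have := sqr_ge0 (z - 1);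
  have := sqr_ge0 (y + 1); have := sqr_ge0 (z + 1); nra.
apply: le_trans N; rewrite ler_piMl//.
Qed.

Let integrable_H s : 0 < s -> leb.-integrable setT (EFin \o H s) /\
  \int[leb]_x H s x <= (B + 2^-1) * (2 * L + 1) + V / 2.
Proof.
move=> s0; have [iq Iq] := diffq_sqr_integral sl s0.
have i1 := integrable_shift (2 * h) iq; have i2 := integrable_shift h iq.
have i0 : leb.-integrable setT (EFin \o \1_(`[- L - 1, L]%classic)) by exact: integrable_indic_itv.
have j1 := integrable_scale (B + 2^-1) measurableT i0.
have j2 := integrable_scale 4^-1 measurableT (integrable_add measurableT i1 i2).
split; first exact: integrable_add.
rewrite (RintegralD measurableT j1 j2) (RintegralZl _ measurableT i0).
rewrite (RintegralZl _ measurableT (integrable_add measurableT i1 i2)) (RintegralD measurableT i1 i2).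
rewrite (Rintegral_shift (2 * h) iq) (Rintegral_shift h iq).
have -> : \int[leb]_x (\1_(`[- L - 1, L]%classic) x) = 2 * L + 1.
  rewrite integral_indic_itv; first ring.
  exact: window_le.
apply: lerD => //.
apply: (@le_trans _ _ (4^-1 * (V + V))); last by rewrite le_eqVlt; apply/orP; left; apply/eqP; field.
by rewrite ler_wpM2l// lerD// (le_trans Iq).
Qed.

(** Discrete integration by parts: the quotient moves from b, which is only
    known to lie in [0, K^2], to the compactly supported G. *)
Let ibp_diffq s : 0 < s -> s <= 1 ->
  - (\int[leb]_x (G x * diffq s b x)) <= K ^+ 2 * ((B + 2^-1) * (2 * L + 1) + V / 2).
Proof.
move=> s0 s1.
have cbs : continuous (fun x => b (x + s)) by exact: continuous_shift.
have i1 := integrable_G cbs; have i2 := integrable_G cb.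
have i3 := integrable_shift s i2.
have E : - (\int[leb]_x (G x * diffq s b x)) = \int[leb]_x (diffq s G x * b (x + s)).
  have -> : \int[leb]_x (G x * diffq s b x) =
     s^-1 * (\int[leb]_x (G x * b (x + s)) - \int[leb]_x (G x * b x)).
    rewrite -(RintegralB measurableT i1 i2) -(RintegralZl _ measurableT (integrable_sub measurableT i1 i2)).
    by apply: eq_Rintegral => x _; rewrite /diffq; ring.
  rewrite -(Rintegral_shift s i2).
  rewrite -mulrN opprB -(RintegralB measurableT i3 i1) -(RintegralZl _ measurableT (integrable_sub measurableT i3 i1)).
  by apply: eq_Rintegral => x _; rewrite /diffq; ring.
have [iH IH] := integrable_H s0.
rewrite E; apply: (@le_trans _ _ (\int[leb]_x (K ^+ 2 * H s x))); last first.
  by rewrite (RintegralZl _ measurableT iH) ler_wpM2l// sqr_ge0.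
apply: le_Rintegral => //.
- have := integrable_scale s^-1 measurableT (integrable_sub measurableT i3 i1).
  by apply: eq_integrable => // x _ /=; congr EFin; rewrite /diffq; ring.
- exact: integrable_scale.
move=> x _; apply: le_trans (ler_norm _) _.
rewrite normrM mulrC ler_pM//; first by rewrite ger0_norm.
exact: diffqG_le.
Qed.

Lemma transport_ibp :
  - (\int[leb]_x (phi x * mid x * db x)) <= K ^+ 2 * ((B + 2^-1) * (2 * L + 1) + V / 2).
Proof.
have [C C0 HC] := bounded_on (- L) (L + 1) cdb.
have [D D0 HD] := bounded_on (- L) L cG.
pose F n x := G x * diffq n.+1%:R^-1 b x.
have n0 n : 0 < n.+1%:R^-1 :> R by rewrite invr_gt0.
have n1 n : n.+1%:R^-1 <= 1 :> R by rewrite invf_le1 ?ltr0n// ler1n.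
have lim : \int[leb]_x F n x @[n --> \oo] --> \int[leb]_x (G x * db x).
  apply: (proj2 (@Rintegral_dct _ _ _ leb F (fun x => G x * db x)
    (fun x => (D * C) * \1_(`[- L, L]%classic) x) _ _ _ _ _)).
  - move=> n; apply: measurable_funM; first exact: continuous_measurable_fun.
    exact: diffq_measurable.
  - by apply: measurable_funM; exact: continuous_measurable_fun.
  - by apply: nearW => x; apply: cvgMr; exact: diffq_cvg.
  - by apply: integrable_scale => //; exact: integrable_indic_itv.
  move=> n x; rewrite /F indicE; case: (boolP (- L <= x <= L)) => hx; last first.
    by rewrite G_out// mul0r normr0 !mulr_ge0.
  have xin : x \in `[- L, L]%classic by rewrite inE /= in_itv.
  rewrite xin mulr1 normrM ler_pM//; first exact: HD.
  have [c /andP[c1 c2] ->] := diffq_mvt x (n0 n) b_derive.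
  have /andP[x1 x2] := hx; have := n1 n => n1'.
  by apply: HC; apply/andP; split; [apply: le_trans (ltW c1)|apply: le_trans (ltW c2) _; apply: lerD].
have limN : - (\int[leb]_x F n x) @[n --> \oo] --> - (\int[leb]_x (G x * db x)).
  exact: cvgN.
have -> : - (\int[leb]_x (phi x * mid x * db x)) = limn (fun n => - (\int[leb]_x F n x)).
  by rewrite (cvg_lim _ limN).
apply: limr_le; first by apply/cvg_ex; eexists; exact: limN.
apply: nearW => n.
exact: ibp_diffq.
Qed.

Definition second_diff (g : R -> R) (x : R) : R :=
  (g (x + 2 * h) - 2 * g (x + h) + g x) / h ^+ 2.

(** After integration by parts the transport term costs K^2 times the integral
    of a bound on the difference quotients of G; the quadratic term has the
    right sign up to K * V. Neither bound involves h. *)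
Lemma transport_source :
  \int[leb]_x (phi x * (2 * Num.max (w x) 0) * - second_diff (fun y => f y ^+ 2 / 2) x)
  <= K ^+ 2 * ((B + 2^-1) * (2 * L + 1) + V / 2) + K * V.
Proof.
have [iq0 Iq] := diffq_sqr_integral sl h0.
have iq := integrable_shift h iq0.
have iG := integrable_G cdb.
have j1 := integrable_scale (-1) measurableT iG.
have j2 := integrable_scale (K * 4^-1) measurableT iq.
have cs : continuous (fun x => phi x * (2 * Num.max (w x) 0) *
    - second_diff (fun y => f y ^+ 2 / 2) x).
  move=> x; apply: cvgM; first by apply: cvgM; [exact: cphi|apply: cvgMr; exact: cmaxw].
  apply: cvgN; apply: cvgMl; apply: cvgD; [apply: cvgB|].
  - apply: cvgMl; rewrite /= !expr2; apply: cvgM; exact: (@continuous_shift R f (2 * h) cf x).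
  - apply: cvgMr; apply: cvgMl; rewrite /= !expr2; apply: cvgM; exact: (@continuous_shift R f h cf x).
  - apply: cvgMl; rewrite /= !expr2; apply: cvgM; exact: cf.
apply: (@le_trans _ _ (\int[leb]_x (-1 * (G x * db x) + K * 4^-1 * q (x + h) ^+ 2))).
  apply: le_Rintegral => //.
  - have [C C0 HC] := bounded_on (- L) L cs.
    apply: (@integrable_support _ _ (- L) L C) => //; first exact: continuous_measurable_fun.
    by move=> x hx; rewrite phi_out// !mul0r.
  - exact: integrable_add.
  move=> x _; have /andP[p0 p1] := phi01 x; have /andP[w0 w1] := maxw x.
  rewrite /db /G /mid /dq /q /second_diff /diffq.
  have -> : x + h + h = x + 2 * h :> R by ring.
  exact: source_pointwise.
rewrite (RintegralD measurableT j1 j2) (RintegralZl _ measurableT iG) (RintegralZl _ measurableT iq).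
rewrite (Rintegral_shift h iq0) mulN1r; apply: lerD; first exact: transport_ibp.
have V0 : 0 <= V by apply: le_trans vV; apply: Rintegral_ge0 => x _; exact: sqr_ge0.
have := le_trans Iq vV; move: (Rintegral _ _ _) => I IV.
by rewrite -mulrA ler_wpM2l//; lra.
Qed.

End Transport.

(** * Uniform continuity and growth *)

Section Heine.
Context {R : realType}.

(** Uniform continuity over a compact rectangle, from the covering form of
    compactness. *)
Lemma time_modulus (G : R * R -> R) (a b c d e : R) : continuous G -> 0 < e ->
  exists2 del, 0 < del & forall s s' y, a <= s <= b -> c <= y <= d ->
    `|s' - s| < del -> `|G (s', y) - G (s, y)| <= e.
Proof.
move=> cG e0.
have cK : compact (`[a, b] `*` `[c, d])%classic.
  by apply: compact_setX; exact: segment_compact.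
move/compact_near_coveringP: cK => cov.
pose P (del : R) (p : R * R) := forall s', `|s' - p.1| < del -> `|G (s', p.2) - G p| <= e.
have [|del] := @filter_ex R (0^'+) _ (fun del => 0 < del /\ (`[a, b] `*` `[c, d])%classic `<=` P del).
  apply: filterI; first exact: nbhs_right_gt.
  apply: (cov R (0^'+) P _) => p _.
  have e20 : 0 < e / 2 by rewrite divr_gt0.
  have /cvgrPdist_le/(_ _ e20)/nbhs_ballP[r /= r0 Hr] := cG p.
  have r20 : 0 < r / 2 by rewrite divr_gt0.
  exists (ball p (r / 2), [set x | x < r / 2]).
    by split => /=; [exact: nbhsx_ballx|exact: nbhs_right_lt].
  move=> [q del] [/= [q1 q2] dr] s' hs'.
  have A1 : `|G p - G q| <= e / 2.
    apply: Hr; split => /=; [apply: lt_trans q1 _|apply: lt_trans q2 _]; lra.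
  have A2 : `|G p - G (s', q.2)| <= e / 2.
    apply: Hr; split => /=.
      rewrite /ball /= in q1 *; rewrite (_ : p.1 - s' = (p.1 - q.1) - (s' - q.1)); last by ring.
      by apply: le_lt_trans (ler_normB _ _) _; lra.
    by apply: lt_trans q2 _; lra.
  rewrite (_ : _ - _ = (G p - G q) - (G p - G (s', q.2))); last by ring.
  by apply: le_trans (ler_normB _ _) _; lra.
move=> [del0 H]; exists del => // s s' y hs hy; apply: (H (s, y)).
by split; rewrite /= in_itv.
Qed.

(** The local bounds telescope along a fine subdivision of [a, b]. *)
Lemma growth_bound (F : R -> R) (a b C : R) : a <= b ->
  (forall e, 0 < e -> exists2 del, 0 < del & forall s s', a <= s -> s <= s' -> s' <= b ->
    s' - s < del -> F s' - F s <= (C + e) * (s' - s)) ->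
  F b - F a <= C * (b - a).
Proof.
move=> ab H; apply/ler_addgt0Pr => e e0.
have ba0 : 0 <= b - a by rewrite subr_ge0.
(* the slack e is spread over [a, b]; adding 1 covers the case a = b *)
pose e' := e / (b - a + 1).
have e'0 : 0 < e' by rewrite divr_gt0// ltr_wpDl.
have [del d0 Hd] := H e' e'0.
have e'e : e' * (b - a) <= e.
  rewrite /e' mulrAC ler_pdivrMr; last by rewrite ltr_wpDl.
  by rewrite ler_pM2l// lerDl.
pose n := (Num.truncn ((b - a) / del)).
have nd : (b - a) / n.+1%:R < del.
  rewrite ltr_pdivrMr ?ltr0n// mulrC -ltr_pdivrMr//; exact: truncnS_gt.
pose r := (b - a) / n.+1%:R.
have r0 : 0 <= r by rewrite divr_ge0.
have nr : n.+1%:R * r = b - a by rewrite mulrC divfK// pnatr_eq0.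
have step_ k : (k <= n.+1)%N -> F (a + k%:R * r) - F a <= (C + e') * (k%:R * r).
  elim: k => [|k IH] kn; first by rewrite mul0r addr0 subrr mulr0.
  have S : F (a + k.+1%:R * r) - F (a + k%:R * r) <= (C + e') * r.
    have E : a + k.+1%:R * r - (a + k%:R * r) = r by rewrite -natr1; ring.
    have := Hd (a + k%:R * r) (a + k.+1%:R * r); rewrite E; apply.
    - by rewrite lerDl mulr_ge0.
    - by rewrite -subr_ge0 E.
    - by rewrite -lerBrDl -nr ler_wpM2r// ler_nat.
    - exact: nd.
  have {}IH := IH (ltnW kn).
  move: S IH; rewrite -natr1; lra.
have := step_ n.+1 (leqnn _); rewrite nr subrKC => Hn.
by apply: le_trans Hn _; rewrite mulrDl lerD2l.
Qed.

End Heine.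

(** * Exchange of integrals over a time slab *)

Section FubiniWindow.
Context {R : realType}.
Local Notation leb := (@lebesgue_measure R).
Local Notation T := (measurableTypeR R).

Lemma Rintegral_itv_oc_cst (M t1 t2 : R) : t1 <= t2 ->
  leb.-integrable setT (EFin \o (fun s => M * \1_(`]t1, t2]%classic) s)) /\
  \int[leb]_s (M * \1_(`]t1, t2]%classic) s) = M * (t2 - t1).
Proof.
move=> t12; have i1 : leb.-integrable setT (EFin \o (\1_(`]t1, t2]%classic) : R -> R)).
  exact: integrable_indic_itv.
split; first exact: integrable_scale.
rewrite RintegralZl//; congr (_ * _).
rewrite /Rintegral integral_indic// setIT /= lebesgue_measure_itv /= lte_fin.
move: t12; rewrite le_eqVlt => /predU1P[->|t12]; first by rewrite ltxx subrr.
by rewrite t12 -EFinD.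
Qed.

(** The exchange of integrals reduces the bound over the time slab to a bound
    at each time. *)
Lemma fubini_window (a : R -> R) (G : R * R -> R) (t1 t2 c d A B M : R) : t1 <= t2 ->
  measurable_fun (setT : set T) a -> (forall x, `|a x| <= A) ->
  (forall x, ~~ (c <= x <= d) -> a x = 0) ->
  measurable_fun (setT : set (T * T)) G ->
  (forall s y, t1 <= s <= t2 -> c <= y <= d -> `|G (s, y)| <= B) ->
  (forall s, t1 < s <= t2 -> \int[leb]_x (a x * G (s, x)) <= M) ->
  \int[leb]_x (a x * \int[leb]_(s in `]t1, t2]) G (s, x)) <= M * (t2 - t1).
Proof.
move=> t12 ma aA a_out mG GB HM.
pose I := \1_(`]t1, t2]%classic) : R -> R.
have I1 s : `|I s| <= 1.
  by rewrite /I indicE; case: (_ \in _); rewrite ?normr1 ?normr0.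
have I_out s : ~~ (t1 < s <= t2) -> I s = 0.
  by move=> hs; rewrite /I indicE memNset//= in_itv /=; exact/negP.
have I_out' s : ~~ (t1 <= s <= t2) -> I s = 0.
  by move=> hs; apply: I_out; apply: contra hs => /andP[/ltW -> ->].
have mI : measurable_fun (setT : set T) I by exact: measurable_indic.
(* extended by 0 outside the box, so that Fubini applies on the whole plane *)
pose F (p : R * R) := a p.2 * G p * I p.1.
have mF : measurable_fun (setT : set (T * T)) F.
  apply: measurable_funM; first apply: measurable_funM => //.
  - exact: (measurableT_comp ma).
  - exact: (measurableT_comp mI).
have A0 : 0 <= A by apply: le_trans (aA 0).
have FB s y : t1 <= s <= t2 -> c <= y <= d -> `|F (s, y)| <= A * B.
  move=> hs hy; rewrite /F /= !normrM -[leRHS]mulr1 ler_pM//.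
  by rewrite ler_pM//; exact: GB.
have F1 s y : ~~ (t1 <= s <= t2) -> F (s, y) = 0 by move=> h; rewrite /F /= I_out'// mulr0.
have F2 s y : ~~ (c <= y <= d) -> F (s, y) = 0 by move=> h; rewrite /F /= a_out// !mul0r.
have iF : (leb \x leb)%E.-integrable (setT : set (T * T)) (EFin \o F).
  apply: (@integrable_box _ F t1 t2 c d (A * B)) => // [[s y]|[s y]] /=; first exact: FB.
  by rewrite negb_and => /orP[]; [exact: F1|exact: F2].
have i1 s : leb.-integrable setT (EFin \o (fun y => F (s, y))).
  apply: (@integrable_support _ _ c d (A * B)).
  - exact: (@measurable_fun_pair2 _ _ _ T T).
  - move=> y hy; case: (boolP (t1 <= s <= t2)) => hs; first exact: FB.
    by rewrite F1// normr0 mulr_ge0//; move: (FB t1 y); rewrite lexx t12 => /(_ isT hy);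
      rewrite /F /= => _; apply: le_trans (GB t1 y _ hy); rewrite ?lexx.
  - by move=> y; exact: F2.
have i2 y : leb.-integrable setT (EFin \o (fun s => F (s, y))).
  apply: (@integrable_support _ _ t1 t2 `|A * B|).
  - exact: (@measurable_fun_pair1 _ _ _ T T).
  - move=> s hs; case: (boolP (c <= y <= d)) => hy; last by rewrite F2// normr0.
    by apply: le_trans (FB s y hs hy) (ler_norm _).
  - by move=> s; exact: F1.
have [i3 e3] := Rfubini1 iF i1; have e4 := Rfubini2 iF i2.
have [j1 j2] := Rintegral_itv_oc_cst M t12.
have -> : \int[leb]_x (a x * \int[leb]_(s in `]t1, t2]) G (s, x)) =
    \int[leb]_y \int[leb]_s F (s, y).
  apply: eq_Rintegral => x _.
  case: (boolP (c <= x <= d)) => hx; last first.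
    rewrite a_out// mul0r; apply/esym; rewrite /Rintegral integral0_eq// => s _.
    by rewrite F2.
  have iG : leb.-integrable (setT : set T) (EFin \o (fun s => G (s, x) * I s)).
    apply: (@integrable_support _ _ t1 t2 B).
    - by apply: measurable_funM => //; exact: (@measurable_fun_pair1 _ _ _ T T).
    - move=> s hs; rewrite normrM -[leRHS]mulr1 ler_pM//; exact: GB.
    - by move=> s hs; rewrite I_out'// mulr0.
  rewrite -Rintegral_indic -(RintegralZl _ measurableT iG).
  by apply: eq_Rintegral => s _; rewrite /F /= mulrA.
rewrite -e4 e3 -j2; apply: le_Rintegral => // s _.
rewrite -/(I s); case: (boolP (t1 < s <= t2)) => hs; last first.
  rewrite I_out// mulr0 /Rintegral integral0_eq// => y _.
  by rewrite /F /= I_out// mulr0.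
have -> : I s = 1 by rewrite /I indicE mem_set//= in_itv.
rewrite mulr1; apply: le_trans (HM s hs).
rewrite le_eqVlt; apply/orP; left; apply/eqP; apply: eq_Rintegral => y _.
by rewrite /F /= /I indicE mem_set ?mulr1//= in_itv.
Qed.

End FubiniWindow.

(** * Growth of the positive energy after a positive time *)

Section EnergyGrowth.
Context {R : realType}.
Local Notation leb := (@lebesgue_measure R).
Local Notation T := (measurableTypeR R).
Variable u : R -> R -> R.
Hypothesis cu : {within [set p : R * R | 0 <= p.1],
        continuous (fun p : R * R => u p.1 p.2)}.
Hypothesis su : forall t, 0 < t -> slice (u t) (wderiv (u t)).
Variable E0 : R.
Hypothesis mE : forall t, 0 < t -> mass (u t) (wderiv (u t)) <= E0.
Hypothesis ud : CH_distributional u.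

Lemma flux_time_integrable (t1 t2 x : R) :
  leb.-integrable `]t1, t2] (EFin \o (fun t => flux u (t, x))).
Proof.
have [B B0 HB] := flux_bounded cu su mE t1 t2 x x.
apply: measurable_bounded_integrable => //.
- by rewrite /= lebesgue_measure_itv /= lte_fin; case: ifP => _ //; rewrite -EFinD ltry.
- apply: measurable_funTS.
  exact: (@measurable_fun_pair1 _ _ _ T T _ (flux u) x (flux_measurable cu su)).
exists B; split; first exact: num_real.
move=> y By s /=; rewrite in_itv /= => /andP[/ltW s1 s2]; apply: le_trans (ltW By).
by apply: HB; rewrite ?lexx//; apply/andP.
Qed.

Lemma avg_sub (f g : R -> R) h x : continuous f -> continuous g -> 0 < h ->
  avg h f x - avg h g x = h^-1 * \int[leb]_(y in `]x, x + h]) (f y - g y).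
Proof.
move=> cf cg h0; rewrite /avg RintegralB//; first by rewrite mulrBr.
- by apply: integrableS (continuous_itv_integrable x (x + h) cf) => //; exact: subset_itv_oc_cc.
- by apply: integrableS (continuous_itv_integrable x (x + h) cg) => //; exact: subset_itv_oc_cc.
Qed.

(** The conservation law holds exactly for the averages over ]x, x + h] and ]x
    + h, x + 2 h]. The difference of the two flux differences is a second
    difference. *)
Lemma dslope_increment (h t1 t2 x : R) : 0 < h -> 0 < t1 -> t1 <= t2 ->
  dslope h (u t2) x - dslope h (u t1) x =
  \int[leb]_(t in `]t1, t2]) (- second_diff h (fun y => flux u (t, y)) x).
Proof.
move=> h0 t10 t12; have t20 := lt_le_trans t10 t12.
have c1 := slice_cont su t10; have c2 := slice_cont su t20.
have xh y : y <= y + h by rewrite lerDl ltW.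
have K0 := conservation cu su mE ud t10 t12 (xh x).
have K1 := conservation cu su mE ud t10 t12 (xh (x + h)).
have iF y := flux_time_integrable t1 t2 y.
have mI : measurable (`]t1, t2]%classic : set T) by [].
have iD y z := integrable_sub mI (iF y) (iF z).
have -> : dslope h (u t2) x - dslope h (u t1) x =
   h^-1 * ((avg h (u t2) (x + h) - avg h (u t1) (x + h)) - (avg h (u t2) x - avg h (u t1) x)).
  by rewrite /dslope /diffq; move: (avg h _ _) (avg h _ _) (avg h _ _) (avg h _ _) => *; ring.
rewrite !avg_sub// K0 K1 -mulrBr mulrA.
rewrite -(RintegralB mI (iD _ _) (iD _ _)) -(RintegralZl _ mI (integrable_sub mI (iD _ _) (iD _ _))).
apply: eq_Rintegral => t _; rewrite /second_diff.
have -> : x + h + h = x + 2 * h :> R by ring.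
move: (flux u _) (flux u _) (flux u _) => *; field.
by rewrite gt_eqF.
Qed.

Lemma second_diff_flux_measurable (h : R) :
  measurable_fun (setT : set (T * T)) (fun p => - second_diff h (fun y => flux u (p.1, y)) p.2).
Proof.
have m a : measurable_fun (setT : set (T * T)) (fun p : T * T => flux u (p.1, p.2 + a)).
  apply: (measurableT_comp (flux_measurable cu su)); apply: measurable_fun_pair => //.
  by apply: measurable_funD.
have m0 := flux_measurable cu su.
rewrite (_ : (fun p => _) = (fun p : T * T => (flux u (p.1, p.2 + 2 * h)
    - 2 * flux u (p.1, p.2 + h) + flux u p) * - (h ^+ 2)^-1)).
  apply: measurable_funM => //; apply: measurable_funD; last exact: m0.
  apply: measurable_funB; first exact: m.
  by apply: measurable_funM; [exact: measurable_cst|exact: m].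
by apply/funext => -[s y] /=; rewrite /second_diff mulrN.
Qed.

Lemma second_diff_bound (h w : R) (g : R -> R) x : 0 < h ->
  `|g (x + 2 * h)| <= w -> `|g (x + h)| <= w -> `|g x| <= w ->
  `|second_diff h g x| <= 4 * w / h ^+ 2.
Proof.
move=> h0; rewrite /second_diff normrM (@ger0_norm _ (h ^+ 2)^-1) ?invr_ge0 ?sqr_ge0//.
move: (g _) (g _) (g _) => a b c ha hb hc; rewrite ler_wpM2r ?invr_ge0 ?sqr_ge0//.
move: ha hb hc; rewrite !ler_norml => /andP[a1 a2] /andP[b1 b2] /andP[c1 c2].
apply/andP; split; lra.
Qed.

Lemma second_diff_continuous (h : R) (g : R -> R) : continuous g ->
  continuous (second_diff h g).
Proof.
move=> cg x; apply: cvgMl; apply: cvgD; last exact: cg.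
apply: cvgB; first exact: (@continuous_shift R g (2 * h) cg x).
by apply: cvgMr; exact: (@continuous_shift R g h cg x).
Qed.

Lemma window_shift (L x h : R) : 0 < h -> h <= 1 -> - L <= x <= L ->
  [/\ - L <= x + 2 * h <= L + 2, - L <= x + h <= L + 2 & - L <= x <= L + 2].
Proof. by move=> h0 h1 /andP[x1 x2]; split; apply/andP; split; lra. Qed.

Lemma slab_total (C e K L w h : R) : 0 < h ->
  C + ((h ^+ 2)^-1 * (2 * K * (h * (2 * h * e))) + 2 * K * (4 * w / h ^+ 2) * (L - - L))
  <= C + 4 * K * e + 16 * K * L * w / h ^+ 2.
Proof.
move=> h0; rewrite -addrA lerD2l le_eqVlt; apply/orP; left; apply/eqP; field.
by rewrite gt_eqF.
Qed.

Lemma modulus_choice (c e h : R) : 0 < h -> 0 <= c -> 0 < e ->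
  c * (e * h ^+ 2 / (c + 1)) / h ^+ 2 <= e.
Proof.
move=> h0 c0 e0; have c1 : 0 < c + 1 by rewrite ltr_wpDl.
have -> : c * (e * h ^+ 2 / (c + 1)) / h ^+ 2 = e * (c / (c + 1)).
  by field; rewrite !gt_eqF.
by apply: ler_piMr; [exact: ltW|rewrite ler_pdivrMr// mul1r lerDl].
Qed.

Lemma slab_pointwise (a h A e SP SU SE SF : R) : 0 < h -> 0 <= a <= A ->
  SF = SU + SP / h ^+ 2 + SE -> `|SE| <= e ->
  a * - SF <= a * - SU + ((h ^+ 2)^-1 * (a * - SP) + A * e).
Proof.
move=> h0 /andP[a0 a1] -> he.
have e0 : 0 <= e := le_trans (normr_ge0 _) he.
have -> : a * - (SU + SP / h ^+ 2 + SE) =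
    a * - SU + ((h ^+ 2)^-1 * (a * - SP) + a * - SE) by ring.
rewrite !lerD2l; apply: (@le_trans _ _ (a * e)); last by rewrite ler_wpM2r.
by rewrite ler_wpM2l//; apply: le_trans he; rewrite -normrN ler_norm.
Qed.

Section Window.
Variables (t0 t3 : R) (phi : R -> R) (K L B : R).
Hypotheses (t00 : 0 < t0) (K0 : 0 <= K) (L0 : 0 <= L).
Hypothesis qK : forall t, t0 <= t -> forall s y, 0 < s -> diffq s (u t) y <= K.
Hypothesis phi01 : forall x, 0 <= phi x <= 1.
Hypothesis phi_lip : forall x y, `|phi x - phi y| <= `|x - y|.
Hypothesis phi_out : forall x, ~~ (- L <= x <= L) -> phi x = 0.
Hypothesis uB : forall t, t0 <= t <= t3 -> forall x, - L - 1 <= x <= L + 3 -> `|u t x| <= B.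

Let V := 2 * E0.
Let CT := K ^+ 2 * ((B + 2^-1) * (2 * L + 1) + V / 2) + K * V.

Let cphi : continuous phi.
Proof. by apply: (@lipschitz_continuous _ _ 1) => x y; rewrite mul1r. Qed.

Lemma slope_energy_bound t : 0 < t -> \int[leb]_x (wderiv (u t) x ^+ 2) <= V.
Proof.
move=> tp; have := mE tp; have [_ _ i1 i2] := su tp.
have i3 : leb.-integrable setT (EFin \o (fun x => wderiv (u t) x ^+ 2 / 2)).
  by have := integrable_scale 2^-1 measurableT i2; apply: eq_integrable => // x _ /=; rewrite mulrC.
have i4 : leb.-integrable setT (EFin \o (fun x => 2^-1 * wderiv (u t) x ^+ 2)) by exact: integrable_scale.
rewrite /mass /density (RintegralD measurableT i1 i3).
have -> : \int[leb]_x (wderiv (u t) x ^+ 2 / 2) = 2^-1 * \int[leb]_x (wderiv (u t) x ^+ 2).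
  by rewrite -(RintegralZl _ measurableT i2); apply: eq_Rintegral => x _; rewrite mulrC.
have : 0 <= \int[leb]_x (u t x ^+ 2) by apply: Rintegral_ge0 => x _; exact: sqr_ge0.
rewrite /V; lra.
Qed.

Section FixedScale.
Variable h : R.
Hypotheses (h0 : 0 < h) (h1 : h <= 1).

Let a t x := phi x * (2 * Num.max (dslope h (u t) x) 0).

Let a_bounds t x : t0 <= t -> 0 <= a t x <= 2 * K.
Proof.
move=> tt; have /andP[p0 p1] := phi01 x.
have cu' : continuous (u t) by apply: (slice_cont su); exact: lt_le_trans tt.
have m0 : 0 <= Num.max (dslope h (u t) x) 0 by rewrite le_max lexx orbT.
have mK : Num.max (dslope h (u t) x) 0 <= K.
  by rewrite ge_max K0 andbT; apply: dslope_le => // y; exact: qK.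
rewrite /a mulr_ge0 ?mulr_ge0//= -[leRHS]mul1r ler_pM// ?mulr_ge0//.
by rewrite ler_pM2l.
Qed.

Let a_out t x : ~~ (- L <= x <= L) -> a t x = 0.
Proof. by move=> hx; rewrite /a phi_out// mul0r. Qed.

Let ca t : t0 <= t -> continuous (a t).
Proof.
move=> tt; have ct : continuous (u t) by apply: (slice_cont su); exact: lt_le_trans tt.
move=> x; apply: cvgM; first exact: cphi.
by apply: cvgMr; apply: (continuous_max0 (dslope_continuous ct h0)).
Qed.

Let weighted_integrable t (g : R -> R) : t0 <= t -> continuous g ->
  leb.-integrable setT (EFin \o (fun x => a t x * g x)).
Proof.
move=> tt cg.
have cg2 : continuous (fun p : R * R => g p.2).
  by move=> p; apply: continuous_comp; [exact: cvg_snd|exact: cg].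
have [C _ HC] := continuous_bounded_box 0 0 (- L) L cg2.
have gC x : - L <= x <= L -> `|g x| <= C by move=> hx; apply: (HC 0) => //; rewrite lexx.
apply: (@integrable_support _ _ (- L) L (2 * K * C)).
- by apply: continuous_measurable_fun => x; apply: cvgM; [exact: ca|exact: cg].
- move=> x hx; have /andP[a0 a1] := a_bounds x tt.
  by rewrite normrM ler_pM// ?gC// ger0_norm.
- by move=> x hx; rewrite a_out// mul0r.
Qed.

(** At time t the flux is split into the quadratic part at t2, handled by
    transport_source since the weight a t2 belongs to that time, the potential
    part, and an error controlled by w. The division of w by h^2 is harmless
    because w tends to 0 at fixed h. *)
Lemma slab_source (t t2 w : R) : t0 <= t -> t0 <= t2 <= t3 -> 
  (forall y, - L <= y <= L + 2 -> `|u t y ^+ 2 / 2 - u t2 y ^+ 2 / 2| <= w) ->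
  \int[leb]_x (a t2 x * - second_diff h (fun y => flux u (t, y)) x) <=
  CT + 4 * K * E0 + 16 * K * L * w / h ^+ 2.
Proof.
move=> tt tt2 Hw.
have /andP[tt2' _] := tt2.
have tp : 0 < t := lt_le_trans t00 tt.
have t2p : 0 < t2 := lt_le_trans t00 tt2'.
have c2 : continuous (u t2) := slice_cont su t2p.
have ct : continuous (u t) := slice_cont su tp.
have cP := potential_continuous (su tp).
pose U2 y := u t2 y ^+ 2 / 2.
have cU2 : continuous U2.
  by move=> x; apply: cvgMl; rewrite expr2; apply: cvgM; exact: c2.
pose P := potential (u t) (wderiv (u t)).
pose DP x := P (x + 2 * h) - 2 * P (x + h) + P x.
have cDP : continuous DP.
  move=> x; apply: cvgD; last exact: cP.
  apply: cvgB; first exact: (@continuous_shift R P (2 * h) cP x).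
  by apply: cvgMr; exact: (@continuous_shift R P h cP x).
have cN (g : R -> R) : continuous g -> continuous (fun x => - g x).
  by move=> cg x; apply: cvgN; exact: cg.
have i1 := weighted_integrable tt2' (cN _ (@second_diff_continuous h _ cU2)).
have i2 := weighted_integrable tt2' (cN _ cDP).
have i0 := weighted_integrable tt2' (cN _ (@second_diff_continuous h _ (flux_continuous su tp))).
have I2 : \int[leb]_x (a t2 x * - DP x) <= 2 * K * (h * (2 * h * E0)).
  have ma : measurable_fun (setT : set T) (a t2) by apply: continuous_measurable_fun; exact: ca.
  have H := potential_weighted (- L) L (su tp) h0 ma (fun x => a_bounds x tt2').
  have E : \int[leb]_x (a t2 x * - DP x) = \int[leb]_(x in `[- L, L]) (a t2 x * - DP x).
    rewrite -[RHS]Rintegral_indic; apply: eq_Rintegral => x _; rewrite indicE.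
    case: (boolP (- L <= x <= L)) => hx; last by rewrite a_out// !mul0r.
    by rewrite mem_set ?mulr1//= in_itv.
  rewrite E; apply: le_trans H _.
  apply: ler_wpM2l; first exact: mulr_ge0.
  apply: ler_wpM2l; first exact: ltW.
  apply: ler_wpM2l; first exact: (mulr_ge0 _ (ltW h0)).
  exact: mE.
have I1 := transport_source (su t2p) (slope_energy_bound t2p) h0 h1 K0 L0
  (qK tt2') phi01 phi_lip phi_out (uB tt2).
have LL : - L <= L by apply: le_trans L0; rewrite oppr_le0.
have iI : leb.-integrable setT (EFin \o (\1_(`[- L, L]%classic) : R -> R)).
  exact: integrable_indic_itv.
have j2 := integrable_scale (h ^+ 2)^-1 measurableT i2.
have j3 := integrable_scale (2 * K * (4 * w / h ^+ 2)) measurableT iI.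
have j4 := integrable_add measurableT j2 j3.
have j5 := integrable_add measurableT i1 j4.
apply: (@le_trans _ _ (\int[leb]_x (a t2 x * - second_diff h U2 x +
   ((h ^+ 2)^-1 * (a t2 x * - DP x) + 2 * K * (4 * w / h ^+ 2) * \1_(`[- L, L]%classic) x)))).
  apply: le_Rintegral => // x _; rewrite indicE.
  case: (boolP (- L <= x <= L)) => hx; last first.
    rewrite !a_out// !mul0r mulr0 !add0r memNset ?mulr0//= in_itv /=; exact/negP.
  rewrite mem_set ?mulr1; last by rewrite /= in_itv.
  apply: (@slab_pointwise _ _ _ _ _ _ (second_diff h (fun y => u t y ^+ 2 / 2 - u t2 y ^+ 2 / 2) x) _ h0 (a_bounds x tt2')).
    rewrite /second_diff !flux_pos// /U2 /DP -/P.
    move: (P _) (P _) (P _) (u t _) (u t _) (u t _) (u t2 _) (u t2 _) (u t2 _) => *; field.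
    by rewrite gt_eqF.
  have [X1 X2 X3] := window_shift h0 h1 hx.
  exact: (second_diff_bound h0 (Hw _ X1) (Hw _ X2) (Hw _ X3)).
rewrite (RintegralD measurableT i1 j4) (RintegralD measurableT j2 j3).
rewrite (RintegralZl _ measurableT i2) (RintegralZl _ measurableT iI).
rewrite (integral_indic_itv LL).
apply: le_trans (lerD I1 (lerD (_ : _ <= (h ^+ 2)^-1 * (2 * K * (h * (2 * h * E0)))) (lexx _))) _.
  by rewrite ler_wpM2l// invr_ge0 sqr_ge0.
exact: slab_total.
Qed.

Definition smoothed_energy t : R :=
  \int[leb]_x (phi x * pospart_sqr (dslope h (u t) x)).

Lemma smoothed_energy_integrable t : t0 <= t ->
  measurable_fun (setT : set T) (fun x => phi x * pospart_sqr (dslope h (u t) x)) /\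
  (forall x, `|phi x * pospart_sqr (dslope h (u t) x)| <= K ^+ 2 * \1_(`[- L, L]%classic) x).
Proof.
move=> tt; have ct : continuous (u t) by apply: (slice_cont su); exact: lt_le_trans tt.
split.
  apply: continuous_measurable_fun => x; apply: cvgM; first exact: cphi.
  rewrite /pospart_sqr expr2.
  by apply: cvgM; apply: (continuous_max0 (dslope_continuous ct h0)).
move=> x; rewrite indicE; case: (boolP (- L <= x <= L)) => hx; last first.
  by rewrite phi_out// mul0r normr0 mulr_ge0// sqr_ge0.
rewrite mem_set ?mulr1; last by rewrite /= in_itv.
have /andP[p0 p1] := phi01 x.
have q0 := pospart_sqr_ge0 (dslope h (u t) x).
rewrite normrM (ger0_norm p0) (ger0_norm q0) -[leRHS]mul1r; apply: ler_pM => //.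
rewrite /pospart_sqr ler_sqr ?nnegrE//; last by rewrite le_max lexx orbT.
by rewrite ge_max K0 andbT; apply: dslope_le => // y; exact: qK.
Qed.

(** The tangent of the convex function pospart_sqr at the later slope bounds
    the increment from above, so the weight a t2 does not vary with the time
    of integration. *)
Lemma smoothed_energy_increment t1 t2 w : t0 <= t1 -> t1 <= t2 -> t2 <= t3 ->
  (forall t, t1 < t <= t2 -> forall y, - L <= y <= L + 2 ->
     `|u t y ^+ 2 / 2 - u t2 y ^+ 2 / 2| <= w) ->
  smoothed_energy t2 - smoothed_energy t1 <=
  (CT + 4 * K * E0 + 16 * K * L * w / h ^+ 2) * (t2 - t1).
Proof.
move=> t01 t12 t23 Hw.
have t02 : t0 <= t2 := le_trans t01 t12.
have t1p : 0 < t1 := lt_le_trans t00 t01.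
have iI := integrable_scale (K ^+ 2) measurableT (integrable_indic_itv (- L) L true false).
have iE t : t0 <= t -> leb.-integrable setT
    (EFin \o (fun x => phi x * pospart_sqr (dslope h (u t) x))).
  move=> /smoothed_energy_integrable[m1 m2].
  by apply: (integrable_dominated measurableT m1 (fun x _ => m2 x)); exact: iI.
have c1 := slice_cont su t1p; have c2 := slice_cont su (lt_le_trans t1p t12).
have cdw : continuous (fun x => dslope h (u t2) x - dslope h (u t1) x).
  by move=> x; apply: cvgB; apply: dslope_continuous.
apply: (@le_trans _ _ (\int[leb]_x (a t2 x * (dslope h (u t2) x - dslope h (u t1) x)))).
  rewrite -(RintegralB measurableT (iE _ t02) (iE _ t01)).
  apply: le_Rintegral => //; [exact: (integrable_sub measurableT (iE _ t02) (iE _ t01))|exact: weighted_integrable|].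
  move=> x _; have /andP[p0 _] := phi01 x; rewrite -mulrBr /a -mulrA ler_wpM2l//.
  have := pospart_sqr_subgradient (dslope h (u t2) x) (dslope h (u t1) x).
  by move: (dslope _ _ _) (dslope _ _ _) => z1 z2 H; lra.
rewrite (_ : Rintegral _ _ _ = \int[leb]_x (a t2 x * \int[leb]_(t in `]t1, t2])
    (- second_diff h (fun y => flux u (t, y)) x))); last first.
  by apply: eq_Rintegral => x _; rewrite dslope_increment.
have [Bf Bf0 HB] := flux_bounded cu su mE t1 t2 (- L) (L + 2).
apply: (@fubini_window _ (a t2) (fun p => - second_diff h (fun y => flux u (p.1, y)) p.2)
   t1 t2 (- L) L (2 * K) (4 * Bf / h ^+ 2) _ t12).
- by apply: continuous_measurable_fun; exact: ca.
- by move=> x; have /andP[a0 a1] := a_bounds x t02; rewrite ger0_norm.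
- by move=> x; exact: a_out.
- exact: second_diff_flux_measurable.
- move=> s y hs hy; rewrite normrN.
  have [X1 X2 X3] := window_shift h0 h1 hy.
  exact: (second_diff_bound h0 (HB _ _ hs X1) (HB _ _ hs X2) (HB _ _ hs X3)).
move=> s hs; have /andP[s1 s2] := hs; apply: slab_source.
- exact: le_trans (ltW s1).
- by rewrite t02.
- exact: Hw.
Qed.

(** The rate of growth is independent of h, which is what survives the limit h
    -> 0. *)
Lemma smoothed_energy_growth : t0 <= t3 ->
  smoothed_energy t3 - smoothed_energy t0 <= (CT + 4 * K * E0) * (t3 - t0).
Proof.
move=> t03; apply: growth_bound => // e e0.
(* with this w the error term of the increment is at most e per unit of time *)
pose w := e * h ^+ 2 / (16 * K * L + 1).
have KL : 0 <= 16 * K * L by rewrite !mulr_ge0.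
have w0 : 0 < w by rewrite divr_gt0 ?mulr_gt0 ?exprn_gt0// ltr_wpDl.
have we : 16 * K * L * w / h ^+ 2 <= e by exact: modulus_choice.
have cU : continuous (fun p => uext u p ^+ 2 / 2).
  by move=> p; apply: cvgMl; rewrite expr2; apply: cvgM; exact: (uext_continuous cu).
have [del d0 Hd] := time_modulus t0 t3 (- L) (L + 2) cU w0.
exists del => // s s' ts ss' s't sd.
apply: le_trans (smoothed_energy_increment ts ss' s't (w := w) _) _.
  move=> t /andP[t1 t2] y hy.
  have tp : 0 < t by apply: lt_trans t1; exact: lt_le_trans ts.
  have := Hd s' t y; rewrite !uext_pos//; last exact: lt_le_trans t2.
  apply => //; first by rewrite s't (le_trans ts).
  by rewrite distrC ger0_norm ?subr_ge0//; apply: le_lt_trans sd; rewrite lerD2l lerN2 ltW.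
by rewrite ler_wpM2r ?subr_ge0// lerD2l.
Qed.

End FixedScale.

(** Smoothed slopes converge almost everywhere to the weak derivative, and
    their positive parts are bounded by K. *)
Lemma smoothed_energy_cvg t : t0 <= t ->
  smoothed_energy n.+1%:R^-1 t @[n --> \oo] --> pos_energy u phi t.
Proof.
move=> tt; have tp : 0 < t := lt_le_trans t00 tt.
have [ct wd _ _] := su tp.
have n0 n : 0 < n.+1%:R^-1 :> R by rewrite invr_gt0.
have iI := integrable_scale (K ^+ 2) measurableT (integrable_indic_itv (- L) L true false).
apply: (proj2 (@Rintegral_dct _ _ _ leb
  (fun n x => phi x * pospart_sqr (dslope n.+1%:R^-1 (u t) x))
  (fun x => phi x * pospart_sqr (wderiv (u t) x)) _ _ _ _ iI _)).
- by move=> n; have [] := smoothed_energy_integrable (n0 n) tt.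
- apply: measurable_funM; first exact: continuous_measurable_fun.
  rewrite /pospart_sqr; apply: measurable_funX; apply: measurable_funrpos.
  exact: weak_deriv_measurable wd.
- apply: ae_mono (weak_deriv_ae wd ct) => x dx.
  apply: cvgMr.
  have C : {for wderiv (u t) x, continuous pospart_sqr}.
    apply: differentiable_continuous; apply/derivable1_diffP.
    by have [] := pospart_sqr_is_derive (wderiv (u t) x).
  exact: (cvg_comp _ _ (dslope_cvg ct dx) C).
- by move=> n x; have [_] := smoothed_energy_integrable (n0 n) tt.
Qed.

Lemma pos_energy_growth : t0 <= t3 ->
  pos_energy u phi t3 - pos_energy u phi t0 <= (CT + 4 * K * E0) * (t3 - t0).
Proof.
move=> t03.
have n0 n : 0 < n.+1%:R^-1 :> R by rewrite invr_gt0.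
have n1 n : n.+1%:R^-1 <= 1 :> R by rewrite invf_le1 ?ltr0n// ler1n.
have lim : smoothed_energy n.+1%:R^-1 t3 - smoothed_energy n.+1%:R^-1 t0 @[n --> \oo] -->
    pos_energy u phi t3 - pos_energy u phi t0.
  exact: (cvgB (smoothed_energy_cvg t03) (smoothed_energy_cvg (lexx t0))).
have -> : pos_energy u phi t3 - pos_energy u phi t0 =
    limn (fun n => smoothed_energy n.+1%:R^-1 t3 - smoothed_energy n.+1%:R^-1 t0).
  by rewrite (cvg_lim _ lim).
apply: limr_le; first by apply/cvg_ex; eexists; exact: lim.
by apply: nearW => n; exact: smoothed_energy_growth.
Qed.

End Window.
End EnergyGrowth.

(** * The positive energy at the initial time *)

Section InitialTime.
Context {R : realType}.
Local Notation leb := (@lebesgue_measure R).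
Local Notation T := (measurableTypeR R).
Implicit Types f v phi : R -> R.

Lemma pospart_sqr_sum (s : R) : pospart_sqr s + pospart_sqr (- s) = s ^+ 2.
Proof.
rewrite /pospart_sqr; case: (leP s 0) => hs; case: (leP (- s) 0) => hs'; rewrite ?expr0n /=.
- have s0 : s = 0 by lra.
  by rewrite s0 expr0n addr0.
- by rewrite add0r sqrrN.
- by rewrite addr0.
- by rewrite oppr_gt0 in hs'; move: (lt_trans hs hs'); rewrite ltxx.
Qed.

Lemma pospart_sqr_le (s : R) : pospart_sqr s <= s ^+ 2.
Proof. by rewrite -(pospart_sqr_sum s) lerDl pospart_sqr_ge0. Qed.

(** What remains of the energy density s^2 once phi * (s^+)^2 is removed. It
    is convex in s because 0 <= phi <= 1. *)
Definition gap phi (x s : R) : R := s ^+ 2 - phi x * pospart_sqr s.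

Lemma gapE phi x s : gap phi x s = (1 - phi x) * pospart_sqr s + pospart_sqr (- s).
Proof. by rewrite /gap -(pospart_sqr_sum s); ring. Qed.

Lemma pospart_sqr_continuous : continuous (@pospart_sqr R).
Proof.
move=> s; apply: differentiable_continuous; apply/derivable1_diffP.
by have [] := pospart_sqr_is_derive s.
Qed.

Lemma gap_step (p b c h : R) : 0 <= h * c ->
  (1 - p + 1 * h) * b + (1 + 0 * h) * c <= (1 - p) * b + c + h * (b + c).
Proof.
move=> hc; have -> : (1 - p) * b + c + h * (b + c) =
  (1 - p + 1 * h) * b + (1 + 0 * h) * c + h * c by ring.
by rewrite lerDl.
Qed.

Section Gap.
Variable phi : R -> R.
Hypothesis phi01 : forall x, 0 <= phi x <= 1.
Hypothesis phi_lip : forall x y, `|phi x - phi y| <= `|x - y|.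

Let cphi : continuous phi.
Proof. by apply: (@lipschitz_continuous _ _ 1) => x y; rewrite mul1r. Qed.

Lemma gap_ge0 x s : 0 <= gap phi x s.
Proof.
rewrite gapE; have /andP[_ p1] := phi01 x.
by apply: addr_ge0; [apply: mulr_ge0; [rewrite subr_ge0|]|]; try exact: pospart_sqr_ge0.
Qed.

Lemma pospart_sqr_measurable (g : T -> R) : measurable_fun setT g ->
  measurable_fun setT (fun x => pospart_sqr (g x)).
Proof.
move=> mg; apply: (measurableT_comp _ mg).
exact: continuous_measurable_fun pospart_sqr_continuous.
Qed.

Lemma gap_measurable (g : T -> R) : measurable_fun setT g ->
  measurable_fun setT (fun x => gap phi x (g x)).
Proof.
move=> mg; apply: measurable_funB; first exact: measurable_funX.
apply: measurable_funM; first exact: continuous_measurable_fun.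
exact: pospart_sqr_measurable.
Qed.

Lemma weighted_pospart_integrable v : measurable_fun (setT : set T) v ->
  leb.-integrable setT (EFin \o (fun x => v x ^+ 2)) ->
  leb.-integrable setT (EFin \o (fun x => phi x * pospart_sqr (v x))).
Proof.
move=> mv iv; apply: (integrable_dominated measurableT _ _ iv).
  apply: measurable_funM; first exact: continuous_measurable_fun.
  exact: pospart_sqr_measurable.
move=> x _; have /andP[p0 p1] := phi01 x.
have q0 := pospart_sqr_ge0 (v x).
rewrite normrM (ger0_norm p0) (ger0_norm q0); apply: le_trans (pospart_sqr_le _).
exact: ler_piMl.
Qed.

Lemma gap_integral v : measurable_fun (setT : set T) v ->
  leb.-integrable setT (EFin \o (fun x => v x ^+ 2)) ->
  leb.-integrable setT (EFin \o (fun x => gap phi x (v x))) /\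
  \int[leb]_x gap phi x (v x) =
  \int[leb]_x (v x ^+ 2) - \int[leb]_x (phi x * pospart_sqr (v x)).
Proof.
move=> mv iv; have iw := weighted_pospart_integrable mv iv.
by split; [exact: integrable_sub|rewrite -(RintegralB measurableT iv iw)].
Qed.

(** By gapE the gap is a sum of two convex functions of s with Lipschitz
    weights 1 - phi and 1. *)
Lemma gap_diffq f v h : slice f v -> 0 < h ->
  (\int[leb]_x (gap phi x (diffq h f x))%:E <=
   (\int[leb]_x gap phi x (v x) + h * \int[leb]_x (v x ^+ 2))%:E)%E.
Proof.
move=> sl h0; have [cf wd if2 iv] := sl.
have mv : measurable_fun (setT : set T) v := weak_deriv_measurable wd.
have md := diffq_measurable h cf.
have mb : measurable_fun (setT : set T) (@pospart_sqr R).
  exact: continuous_measurable_fun pospart_sqr_continuous.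
have mbN : measurable_fun (setT : set T) (fun s : R => pospart_sqr (- s)).
  by apply: pospart_sqr_measurable; exact: measurable_funN.
have mbNv : measurable_fun (setT : set T) (fun x => pospart_sqr (- v x)).
  by apply: pospart_sqr_measurable; exact: measurable_funN.
have c1 : continuous (cst 1 : R -> R) by exact: cst_continuous.
have l1 (x y : R) : `|cst (1:R) x - cst 1 y| <= 0 * `|x - y|.
  by rewrite subrr normr0 mul0r.
have cpsi : continuous (fun x => 1 - phi x).
  by move=> x; apply: cvgB; [exact: cvg_cst|exact: cphi].
have psi0 x : 0 <= 1 - phi x by have /andP[_ p1] := phi01 x; rewrite subr_ge0.
have lpsi x y : `|(1 - phi x) - (1 - phi y)| <= 1 * `|x - y|.
  by rewrite mul1r distrC (_ : _ - _ = phi x - phi y)//; ring.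
have sN (c s : R) : pospart_sqr (- c) + - (2 * Num.max (- c) 0) * (s - c) <= pospart_sqr (- s).
  have := pospart_sqr_subgradient (- c) (- s); apply: le_trans.
  by rewrite le_eqVlt; apply/orP; left; apply/eqP; ring.
have A1 := slice_avg h0 wd cf mb (@pospart_sqr_ge0 R) (@pospart_sqr_subgradient R) cpsi psi0 lpsi.
have A2 := slice_avg h0 wd cf mbN (fun s => pospart_sqr_ge0 (- s)) sN c1 (fun=> ler01) l1.
have E0 : (\int[leb]_x (gap phi x (diffq h f x))%:E =
  \int[leb]_x ((1 - phi x) * pospart_sqr (diffq h f x))%:E +
  \int[leb]_x (cst 1 x * pospart_sqr (- diffq h f x))%:E)%E.
  rewrite -ge0_integralD//.
  - by apply: eq_integral => x _; rewrite -EFinD gapE mul1r.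
  - by move=> x _; rewrite lee_fin; apply: mulr_ge0 => //; exact: pospart_sqr_ge0.
  - apply/measurable_EFinP; apply: measurable_funM; first exact: continuous_measurable_fun.
    exact: pospart_sqr_measurable.
  - by move=> x _; rewrite lee_fin; apply: mulr_ge0 => //; exact: pospart_sqr_ge0.
  - apply/measurable_EFinP; apply: measurable_funM => //.
    by apply: pospart_sqr_measurable; exact: measurable_funN.
rewrite E0; apply: le_trans (leeD A1 A2) _.
have [ig _] := gap_integral mv iv.
have ih := integrable_scale h measurableT iv.
have -> : (\int[leb]_x gap phi x (v x) + h * \int[leb]_x (v x ^+ 2))%:E =
  (\int[leb]_x (gap phi x (v x) + h * v x ^+ 2)%:E)%E.
  rewrite -(RintegralZl _ measurableT iv) -(RintegralD measurableT ig ih) /Rintegral fineK//.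
  by apply: integrable_fin_num => //; exact: integrable_add.
have psih x : 0 <= 1 - phi x + 1 * h by rewrite addr_ge0// mul1r ltW.
rewrite -ge0_integralD//.
- apply: ge0_le_integral => //.
  + by move=> x _; rewrite lee_fin; apply: addr_ge0; apply: mulr_ge0;
      rewrite ?pospart_sqr_ge0// ?mul0r ?addr0.
  + apply/measurable_EFinP; apply: measurable_funD.
    * apply: measurable_funM; last exact: pospart_sqr_measurable.
      by apply: measurable_funD => //; exact: continuous_measurable_fun.
    * by apply: measurable_funM; [exact: (measurable_cst (1 + 0 * h))|exact: mbNv].
  + by apply/measurable_EFinP; apply: measurable_funD; [exact: gap_measurable|
      apply: measurable_funM => //; exact: measurable_funX].
  + move=> x _; rewrite -EFinD lee_fin gapE -(pospart_sqr_sum (v x)).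
    by apply: gap_step; rewrite mulr_ge0 ?pospart_sqr_ge0// ltW.
- by move=> x _; rewrite lee_fin; apply: mulr_ge0 => //; exact: pospart_sqr_ge0.
- apply/measurable_EFinP; apply: measurable_funM; last exact: pospart_sqr_measurable.
  by apply: measurable_funD => //; exact: continuous_measurable_fun.
- by move=> x _; rewrite lee_fin mul0r addr0 mul1r pospart_sqr_ge0.
- by apply/measurable_EFinP; apply: measurable_funM; [exact: (measurable_cst (1 + 0 * h))|exact: mbNv].
Qed.

Lemma energy_gap_integral f (g : R -> R) (c : R) : slice f (wderiv f) ->
  measurable_fun (setT : set T) g -> 
  (\int[leb]_x (gap phi x (g x))%:E <= c%:E)%E ->
  (\int[leb]_x (f x ^+ 2 + gap phi x (g x))%:E <= (\int[leb]_x (f x ^+ 2) + c)%:E)%E.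
Proof.
move=> sl mg Hg; have [cf _ if2 _] := sl.
have -> : (\int[leb]_x (f x ^+ 2 + gap phi x (g x))%:E =
   \int[leb]_x (f x ^+ 2)%:E + \int[leb]_x (gap phi x (g x))%:E)%E.
  rewrite -ge0_integralD//.
  - by move=> x _; rewrite lee_fin sqr_ge0.
  - by apply/measurable_EFinP; apply: measurable_funX; exact: continuous_measurable_fun.
  - by move=> x _; rewrite lee_fin gap_ge0.
  - by apply/measurable_EFinP; exact: gap_measurable.
rewrite EFinD; apply: leeD => //.
by rewrite /Rintegral fineK//; exact: integrable_fin_num.
Qed.

Section Initial.
Variable u : R -> R -> R.
Hypothesis cu : {within [set p : R * R | 0 <= p.1],
        continuous (fun p : R * R => u p.1 p.2)}.
Hypothesis su : forall t, 0 <= t -> slice (u t) (wderiv (u t)).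
Variable E1 : R.
Hypothesis hE : forall t, 0 < t ->
  \int[leb]_x (u t x ^+ 2) + \int[leb]_x (wderiv (u t) x ^+ 2) <= E1.
Hypothesis hE0 :
  \int[leb]_x (u 0 x ^+ 2) + \int[leb]_x (wderiv (u 0) x ^+ 2) = E1.

Let s_ (n : nat) : R := n.+1%:R^-1.
Let s0 n : 0 < s_ n. Proof. by rewrite /s_ invr_gt0. Qed.
Let s_cvg : s_ n @[n --> \oo] --> (0 : R). Proof. exact: cvg_harmonic. Qed.

Let cont t : 0 <= t -> continuous (u t). Proof. by move=> /su[]. Qed.
Let mwd t : 0 <= t -> measurable_fun (setT : set T) (wderiv (u t)).
Proof. by move=> /su[_ wd _ _]; exact: weak_deriv_measurable wd. Qed.

Let u_cvg x : u (s_ n) x @[n --> \oo] --> u 0 x.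
Proof.
have C : {for (0 : R), continuous (fun t : R => uext u (t, x))}.
  exact: uext_time_continuous.
have := cvg_comp _ _ s_cvg C.
rewrite /= {2}/uext /= maxxx; apply: cvg_trans.
by apply: near_eq_cvg; apply: nearW => n /=; rewrite uext_pos.
Qed.

(** At fixed h the difference quotients are continuous in time, so Fatou
    bounds their energy at time 0 by the energy available as t decreases to 0:
    at most E1 in total, of which l is taken by the positive part, up to the
    error h * E1 of gap_diffq. *)
Lemma energy_loss_scale (h l : R) : 0 < h ->
  pos_energy u phi t @[t --> 0^'+] --> l ->
  (\int[leb]_x (u 0 x ^+ 2 + gap phi x (diffq h (u 0) x))%:E <= (E1 - l + h * E1)%:E)%E.
Proof.
move=> h0 hl.
have ll : pos_energy u phi (s_ n) @[n --> \oo] --> l.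
  by move/cvg_at_rightP: hl; apply; split.
pose F n x := u (s_ n) x ^+ 2 + gap phi x (diffq h (u (s_ n)) x).
have mF t : 0 <= t ->
    measurable_fun (setT : set T) (fun x => u t x ^+ 2 + gap phi x (diffq h (u t) x)).
  move=> t0; apply: measurable_funD.
    by apply: measurable_funX; exact: (continuous_measurable_fun (cont t0)).
  by apply: gap_measurable; exact: diffq_measurable (cont t0).
apply: le_trans (@fatou_ae _ _ _ leb F
  (fun x => u 0 x ^+ 2 + gap phi x (diffq h (u 0) x)) _ _ _ _) _.
- by move=> n; exact: mF (ltW (s0 n)).
- exact: mF.
- by move=> n x; rewrite addr_ge0 ?sqr_ge0 ?gap_ge0.
- apply: nearW => x.
  have dq : diffq h (u (s_ n)) x @[n --> \oo] --> diffq h (u 0) x.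
    by apply: cvgMl; apply: cvgB; exact: u_cvg.
  apply: cvgD; first by rewrite expr2; apply: cvgM; exact: u_cvg.
  apply: cvgB; first by rewrite expr2; apply: cvgM; exact: dq.
  by apply: cvgMr; exact: (cvg_comp _ _ dq (@pospart_sqr_continuous _)).
apply: (@limn_einf_le _ _ (fun n => (E1 - pos_energy u phi (s_ n) + h * E1)%:E)).
  move=> n; have sl := su (ltW (s0 n)); have [_ _ _ iv] := sl.
  apply: le_trans (energy_gap_integral sl (diffq_measurable h (cont (ltW (s0 n))))
    (gap_diffq sl h0)) _.
  have [_ ->] := gap_integral (mwd (ltW (s0 n))) iv.
  have H := hE (s0 n); rewrite lee_fin.
  have : h * \int[leb]_x (wderiv (u (s_ n)) x ^+ 2) <= h * E1.
    rewrite ler_pM2l//; apply: le_trans H; rewrite lerDr.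
    by apply: Rintegral_ge0 => x _; exact: sqr_ge0.
  have -> : pos_energy u phi (s_ n) = \int[leb]_x (phi x * pospart_sqr (wderiv (u (s_ n)) x)) by [].
  move: H; move: (Rintegral _ _ _) (Rintegral _ _ _) (Rintegral _ _ _) (h * _) => a b c d.
  by move=> *; lra.
apply: cvg_EFin; first by apply: nearW.
by apply: cvgD; [apply: cvgB; [exact: cvg_cst|exact: ll]|exact: cvg_cst].
Qed.

(** As h tends to 0 the gap at time 0 is at most E1 - l, whereas it equals E1
    minus the positive energy. Lower semicontinuity of the convex gap is thus
    upper semicontinuity of the positive energy. *)
Lemma initial_accretion_le (l : R) : pos_energy u phi t @[t --> 0^'+] --> l ->
  l <= pos_energy u phi 0.
Proof.
move=> hl; have sl := su (lexx 0); have [c0 wd if2 iv] := sl.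
have mv := mwd (lexx 0).
have [ig eg] := gap_integral mv iv.
pose F n x := u 0 x ^+ 2 + gap phi x (diffq (s_ n) (u 0) x).
have mF (g : R -> R) : measurable_fun (setT : set T) g ->
    measurable_fun (setT : set T) (fun x => u 0 x ^+ 2 + gap phi x (g x)).
  move=> mg; apply: measurable_funD; last exact: gap_measurable.
  by apply: measurable_funX; exact: (continuous_measurable_fun c0).
have : (\int[leb]_x (u 0 x ^+ 2 + gap phi x (wderiv (u 0) x))%:E <= (E1 - l)%:E)%E.
  apply: le_trans (@fatou_ae _ _ _ leb F
    (fun x => u 0 x ^+ 2 + gap phi x (wderiv (u 0) x)) _ _ _ _) _.
  - by move=> n; apply: mF; exact: diffq_measurable.
  - exact: mF.
  - by move=> n x; rewrite addr_ge0 ?sqr_ge0 ?gap_ge0.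
  - apply: ae_mono (diffq_cvg_ae sl) => x dq.
    apply: cvgD; first exact: cvg_cst.
    apply: cvgB; first by rewrite expr2; apply: cvgM; exact: dq.
    by apply: cvgMr; exact: (cvg_comp _ _ dq (@pospart_sqr_continuous _)).
  apply: (@limn_einf_le _ _ (fun n => (E1 - l + s_ n * E1)%:E)).
    by move=> n; exact: energy_loss_scale.
  apply: cvg_EFin; first by apply: nearW.
  rewrite -[X in _ --> X]addr0; apply: cvgD; first exact: cvg_cst.
  by rewrite -[X in _ --> X](mul0r E1); apply: cvgMl; exact: s_cvg.
have -> : (\int[leb]_x (u 0 x ^+ 2 + gap phi x (wderiv (u 0) x))%:E)%E =
    (\int[leb]_x (u 0 x ^+ 2) + \int[leb]_x gap phi x (wderiv (u 0) x))%:E.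
  rewrite -(RintegralD measurableT if2 ig) /Rintegral fineK//.
  by apply: integrable_fin_num => //; exact: (integrable_add measurableT if2 ig).
rewrite lee_fin eg -hE0.
have -> : pos_energy u phi 0 = \int[leb]_x (phi x * pospart_sqr (wderiv (u 0) x)) by [].
move: (Rintegral _ _ _) (Rintegral _ _ _) (Rintegral _ _ _) => a b c *; lra.
Qed.

End Initial.
End Gap.
End InitialTime.

(** * No accretion *)

Section Conclusion.
Context {R : realType}.
Local Notation leb := (@lebesgue_measure R).
Local Notation T := (measurableTypeR R).

Definition cutoff (L x : R) : R := Num.max 0 (Num.min 1 (L - `|x|)).

Lemma cutoff_bounds L x : 0 <= cutoff L x <= 1.
Proof. by rewrite /cutoff le_max lexx /= ge_max ler01 ge_min lexx. Qed.

Lemma cutoff_lip L x y : `|cutoff L x - cutoff L y| <= `|x - y|.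
Proof.
wlog xy : x y / `|x| <= `|y|.
  by move=> H; have [/H//|/ltW/H] := leP `|x| `|y|; rewrite distrC [X in _ <= X]distrC.
have D : `|y| - `|x| <= `|x - y| by rewrite distrC; exact: lerB_dist.
apply: le_trans D; rewrite /cutoff; move: `|x| `|y| xy => a b ab.
rewrite ler_norml; apply/andP; split;
case: (leP 1 (L - a)) => h1; case: (leP 1 (L - b)) => h2; rewrite ?(max_r ler01);
case: (leP 0 (L - a)) => h3; case: (leP 0 (L - b)) => h4; lra.
Qed.

Lemma cutoff_out L x : ~~ (- L <= x <= L) -> cutoff L x = 0.
Proof.
rewrite -ler_norml -ltNge => h; apply: max_l.
by rewrite ge_min subr_le0 (ltW h) orbT.
Qed.

Lemma cutoff_one L x : - (L - 1) <= x <= L - 1 -> cutoff L x = 1.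
Proof.
rewrite -ler_norml => h; rewrite /cutoff min_l; first exact: max_r.
by rewrite lerBrDl -lerBrDr.
Qed.

Lemma cutoff_continuous L : continuous (cutoff L).
Proof. by apply: (@lipschitz_continuous _ _ 1) => x y; rewrite mul1r cutoff_lip. Qed.

Lemma cutoff_compact L : compact (tsupport (cutoff L)).
Proof.
apply: (subclosed_compact _ (@segment_compact R (- L) L)); first exact: closed_closure.
have cl : closed `[- L, L]%classic by exact: itv_closed.
rewrite [X in _ `<=` X](iffLR (closure_id _) cl); apply: closure_subset => x /=.
by rewrite in_itv /=; apply: contraNT => /cutoff_out ->.
Qed.

(** The cutoffs dominate the indicators of a sequence of intervals that
    exhausts the line. *)
Lemma measure_eq0_cutoff (m : {measure set T -> \bar R}) :
  (forall L : R, 1 <= L -> (\int[m]_x (cutoff L x)%:E <= 0)%E) ->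
  forall A : set T, measurable A -> m A = 0%E.
Proof.
move=> H A mA.
have neg : m.-negligible (\bigcup_n (`[- n%:R, n%:R]%classic : set T)).
  apply: negligible_bigcup => n; exists (`[- n%:R, n%:R]%classic : set T); split => //.
  apply/eqP; rewrite eq_le measure_ge0 andbT.
  have L1 : 1 <= n%:R + 1 :> R by rewrite lerDr.
  apply: le_trans (H _ L1).
  rewrite -[X in m X]setIT -integral_indic//.
  apply: ge0_le_integral => //.
  - by apply/measurable_EFinP; exact: measurable_indic.
  - apply/measurable_EFinP; apply: continuous_measurable_fun; exact: cutoff_continuous.
  move=> x _; rewrite lee_fin indicE; case: (boolP (x \in _)) => /=; last first.
    by move=> _; have /andP[] := cutoff_bounds (n%:R + 1) x.
  by rewrite inE /= in_itv /= => hx; rewrite cutoff_one// addrK.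
apply: measure_negligible => //; apply: (negligibleS _ neg) => x _.
exists (Num.truncn `|x|).+1 => //=; rewrite in_itv /= -ler_norml.
exact: ltW (truncnS_gt _).
Qed.

Section PositiveTime.
Variable u : R -> R -> R.
Hypothesis cu : {within [set p : R * R | 0 <= p.1],
        continuous (fun p : R * R => u p.1 p.2)}.
Hypothesis su : forall t, 0 < t -> slice (u t) (wderiv (u t)).
Variable E0 : R.
Hypothesis mE : forall t, 0 < t -> mass (u t) (wderiv (u t)) <= E0.
Hypothesis ud : CH_distributional u.
Hypothesis ol : oleinik u.

(** After a positive time the Oleinik bound is uniform, so the positive energy
    grows at most linearly and cannot jump up. *)
Lemma positive_accretion_le (phi : R -> R) (L t0 l : R) : 0 < t0 -> 0 <= L ->
  (forall x, 0 <= phi x <= 1) -> (forall x y, `|phi x - phi y| <= `|x - y|) ->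
  (forall x, ~~ (- L <= x <= L) -> phi x = 0) ->
  pos_energy u phi t @[t --> t0^'+] --> l -> l <= pos_energy u phi t0.
Proof.
move=> t00 L0 phi01 phi_lip phi_out hl.
have [C HC] := ol.
(* the absolute value makes the bound monotone in t, whatever the sign of C *)
pose K := `|C| * (1 + t0^-1).
have K0 : 0 <= K by rewrite mulr_ge0// addr_ge0// invr_ge0 ltW.
have qK t : t0 <= t -> forall s y, 0 < s -> diffq s (u t) y <= K.
  move=> tt s y s0; have tp := lt_le_trans t00 tt.
  apply: diffq_le (su tp) s0 _; apply: ae_mono (HC t tp) => x /le_trans; apply.
  have t1 : 0 <= 1 + t^-1 by rewrite addr_ge0// invr_ge0 ltW.
  apply: (@le_trans _ _ (`|C| * (1 + t^-1))); first by rewrite ler_wpM2r// ler_norm.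
  by rewrite ler_wpM2l// lerD2l lef_pV2.
have [B B0 HB] := continuous_bounded_box t0 (t0 + 1) (- L - 1) (L + 3) (uext_continuous cu).
have uB t3 : t3 <= t0 + 1 -> forall t, t0 <= t <= t3 ->
    forall x, - L - 1 <= x <= L + 3 -> `|u t x| <= B.
  move=> t31 t /andP[t1 t2] x hx; have tp := lt_le_trans t00 t1.
  by rewrite -uext_pos//; apply: HB => //; rewrite t1 (le_trans t2).
pose D := K ^+ 2 * ((B + 2^-1) * (2 * L + 1) + 2 * E0 / 2) + K * (2 * E0) + 4 * K * E0.
have G t3 : t0 <= t3 -> t3 <= t0 + 1 ->
    pos_energy u phi t3 <= pos_energy u phi t0 + D * (t3 - t0).
  move=> t03 t31; rewrite -lerBlDl.
  exact: (pos_energy_growth cu su mE ud t00 K0 L0 qK phi01 phi_lip phi_out (uB t3 t31) t03).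
have lim : pos_energy u phi t0 + D * (t - t0) @[t --> t0^'+] --> pos_energy u phi t0.
  rewrite -[X in _ --> X]addr0 -[X in _ --> _ + X](mulr0 D) -(subrr t0).
  apply: cvgD; first exact: cvg_cst.
  apply: cvgMr; apply: cvgB; last exact: cvg_cst.
  by apply: cvg_at_right_filter; exact: cvg_id.
apply: (ler_cvg_to hl lim); near=> t; apply: G; first by apply: ltW; near: t; exact: nbhs_right_gt.
by apply: ltW; near: t; apply: nbhs_right_lt; rewrite ltrDl.
Unshelve. all: by end_near. Qed.

End PositiveTime.

Lemma mass_le (f v : R -> R) : slice f v ->
  mass f v <= \int[leb]_x (f x ^+ 2) + \int[leb]_x (v x ^+ 2).
Proof.
move=> sl; have [_ _ i1 i2] := sl.
rewrite -(RintegralD measurableT i1 i2); apply: le_Rintegral => //.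
- exact: density_integrable.
- exact: integrable_add.
move=> x _; rewrite lerD2l ler_pdivrMr// ler_peMr ?sqr_ge0// ler1n//.
Qed.

Lemma H1norm_sqr_le (f g : R -> R) : H1norm f <= H1norm g ->
  H1norm f ^+ 2 <= H1norm g ^+ 2.
Proof.
rewrite /H1norm; move: (_ + _) (_ + _) => a b ab.
by rewrite ler_sqr ?nnegrE ?sqrtr_ge0.
Qed.

End Conclusion.

Unset Implicit Arguments.
Set Strict Implicit.
Set Printing Implicit Defensive.

Theorem theorem2p14 (R : realType) (u0 : R -> R) (u : R -> R -> R)
    (mu : R -> {measure set (measurableTypeR R) -> \bar R}) :
  weak_solution u0 u -> dissipative u -> accretion_measure u mu ->
  forall t : R, 0 <= t ->
  forall A : set (measurableTypeR R), measurable A -> mu t A = 0%E.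
Proof.
move=> [u0H cu _ ui ud] [ol we] acc t0 t00.
have cut t : 0 <= t -> continuous (u t).
  move=> tp; have : continuous (fun x => uext u (t, x)) by exact: uext_slice_continuous.
  by rewrite /uext /= max_l.
have hH t : 0 <= t -> in_H1 (u t) /\ H1norm (u t) <= H1norm (u 0).
  rewrite le_eqVlt => /predU1P[<-|/we//]; split => //.
  by rewrite (_ : u 0 = u0)//; apply/funext.
have su t : 0 <= t -> slice (u t) (wderiv (u t)).
  by move=> tp; apply: in_H1_slice; [exact: cut|have [] := hH t tp].
have en t : 0 <= t -> \int[lebesgue_measure]_x (u t x ^+ 2) +
    \int[lebesgue_measure]_x (wderiv (u t) x ^+ 2) <= H1norm (u 0) ^+ 2.
  move=> tp; rewrite -(H1norm_sqr (su t tp)).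
  by apply: H1norm_sqr_le; have [] := hH t tp.
have sup t : 0 < t -> slice (u t) (wderiv (u t)) by move/ltW; exact: su.
have mE t : 0 < t -> mass (u t) (wderiv (u t)) <= H1norm (u 0) ^+ 2.
  by move=> tp; apply: le_trans (mass_le (sup t tp)) (en t (ltW tp)).
apply: measure_eq0_cutoff => L L1.
have [l hl ->] := acc t0 t00 (cutoff L) (@cutoff_continuous R L) (@cutoff_compact R L).
rewrite lee_fin subr_le0; move: t00 hl; rewrite le_eqVlt => /predU1P[<-|t00] hl.
  apply: (initial_accretion_le (@cutoff_bounds R L) (@cutoff_lip R L) cu su
    (fun t tp => en t (ltW tp)) _ hl).
  by rewrite (H1norm_sqr (su 0 (lexx 0))).
apply: (positive_accretion_le cu sup mE ud ol t00 (le_trans ler01 L1)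
  (@cutoff_bounds R L) (@cutoff_lip R L) (@cutoff_out R L) hl).
Qed.
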